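(* Let $1<p\le q<\infty$ and let $b$ be a normal form parameter. Define $c_0(x)=b(x)^{1/p'}x^{1/q}$ and $c_2(t)=t^{-1/q'}\big(\frac{p'}{q'}\int_0^tx^{p'-1}b(x)\,dx\big)^{1/p'}$ for $x,t>0$, and for $i\in\{0,2\}$ let $$A_i=\sup_{t>0}c_i(t),\quad A_i^{(0)}=\liminf_{t\to0^+}c_i(t),\quad A_i^{(\infty)}=\liminf_{t\to\infty}c_i(t).$$ Then $$A_2\le A_0\le(q')^{1/p'}A_2,\quad A_0^{(0)}\le A_2^{(0)}\quad\text{and}\quad A_0^{(\infty)}\le A_2^{(\infty)}.$$ Consequently, $$\max\big(A_0,K_{p,q}A_0^{(0)},K_{p,q}A_0^{(\infty)}\big)\le\max\big((q')^{1/p'}A_2,K_{p,q}A_2^{(0)},K_{p,q}A_2^{(\infty)}\big)\le N_{p,q}(b)\le K_{p,q}A_2\le K_{p,q}A_0.$$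
   Context: $L^+$ is the set of Lebesgue measurable functions $(0,\infty)\to[0,\infty]$ and $\|\cdot\|_p$ is the usual $L^p$ norm for Lebesgue measure on $(0,\infty)$; $p',q'$ denote conjugate exponents, $\frac1p+\frac1{p'}=1$. A normal form parameter is a non-increasing function $b:(0,\infty)\to[0,\infty]$. Put $H_bf(x)=\int_0^{b(x)}f(t)\,dt$ for $f\in L^+$, and let $N_{p,q}(b)\in[0,\infty]$ be the smallest $C$ such that $\|H_bf\|_q\le C\|f\|_p$ for all $f\in L^+$ with $\|f\|_p<\infty$. For $1<p\le q<\infty$ the constant $K_{p,q}$ is $$K_{p,q}=p^{1/p}(p')^{1/p'}\ \text{ if }p=q,\qquad K_{p,q}=\Big(\frac{\Gamma(s)}{\Gamma(s/p)\Gamma(s/q')}\Big)^{1/s}\ \text{ if }p<q,\ \text{ where }\tfrac1s=\tfrac1p-\tfrac1q.$$ (By classical results of Hardy ($p=q$) and Bliss ($p<q$), $N_{p,q}(x^{-p'/q})=K_{p,q}$.) *)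

(* Defs.v *)
From HB Require Import structures.
From mathcomp Require Import all_boot all_order all_algebra.
From mathcomp Require Import all_classical all_reals all_analysis.
From mathcomp Require Import measurable_realfun.

Set Implicit Arguments.
Unset Strict Implicit.
Unset Printing Implicit Defensive.

Import Order.TTheory GRing.Theory Num.Theory.
Import numFieldNormedType.Exports.

Local Open Scope classical_set_scope.
Local Open Scope ring_scope.
Local Open Scope ereal_scope.

(* [R] with the sigma-algebra of Lebesgue (not just Borel) measurable sets, on
   which [completed_lebesgue_measure] is defined. *)
Notation lebesgueType R := (caratheodory_type ((@wlength R idfun)^*)%mu).

Notation leb R := (@completed_lebesgue_measure R).

(* Functions on (0, oo) are encoded as functions on the whole line, whose
   values outside of [`]0, +oo[] are never used. *)
Definition Lplus (R : realType) (f : lebesgueType R -> \bar R) : Prop :=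
  measurable_fun (`]0%R, +oo[ : set (lebesgueType R)) f /\
  forall x : R, (0 < x)%R -> 0 <= f x.

(* [restrict] extends by 0, so this is the norm of L^p(0, oo). *)
Definition normp (R : realType) (p : R) (f : lebesgueType R -> \bar R)
    : \bar R :=
  Lnorm (leb R) p%:E (f \_ (`]0%R, +oo[ : set (lebesgueType R))).

Definition conj_exp (R : realType) (p : R) : R := ((1 - p^-1)^-1)%R.

Definition normal_form_parameter (R : realType) (b : R -> \bar R) : Prop :=
  (forall x, (0 < x)%R -> 0 <= b x) /\
  (forall x y, (0 < x)%R -> (x <= y)%R -> b y <= b x).

Definition H_op (R : realType) (b : R -> \bar R) (f : lebesgueType R -> \bar R)
    (x : R) : \bar R :=
  \int[leb R]_(t in [set t : lebesgueType R | (0 < t)%R /\ t%:E < b x]) f t.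

(* The infimum is a minimum: [C] ranges over a closed set, as the inequalities
   are non-strict and those with [normp p f = 0] do not depend on [C]
   (because [+oo * 0 = 0]). *)
Definition N_const (R : realType) (p q : R) (b : R -> \bar R) : \bar R :=
  ereal_inf [set C | 0 <= C /\
    forall f, Lplus f -> normp p f < +oo ->
      normp q (H_op b f) <= C * normp p f].

Definition Gamma (R : realType) (s : R) : R :=
  (\int[lebesgue_measure]_(t in `]0%R, +oo[) (t `^ (s - 1) * expR (- t)))%R.

Definition K_const (R : realType) (p q : R) : R :=
  (if p == q then
     p `^ p^-1 * conj_exp p `^ (conj_exp p)^-1
   else
     let s := (p^-1 - q^-1)^-1 in
     (Gamma s / (Gamma (s / p) * Gamma (s / conj_exp q))) `^ s^-1)%R.

Definition c0 (R : realType) (p q : R) (b : R -> \bar R) (x : R) : \bar R :=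
  poweR (b x) (conj_exp p)^-1 * (x `^ q^-1)%:E.

Definition c2 (R : realType) (p q : R) (b : R -> \bar R) (t : R) : \bar R :=
  (t `^ (- (conj_exp q)^-1))%:E *
  poweR ((conj_exp p / conj_exp q)%:E *
         \int[leb R]_(x in (`]0%R, t[ : set (lebesgueType R)))
           ((x `^ (conj_exp p - 1))%:E * b x))
        (conj_exp p)^-1.

Definition sup_pos (R : realType) (c : R -> \bar R) : \bar R :=
  ereal_sup [set c t | t in `]0%R, +oo[].

Definition liminf_0 (R : realType) (c : R -> \bar R) : \bar R :=
  limf_einf c (at_right (0%R : R)).

Definition liminf_oo (R : realType) (c : R -> \bar R) : \bar R :=
  limf_einf c (pinfty_nbhs R).

(* Main.v *)
(* Write k = q', l = p' and r = l / k - 1.  For nonincreasing g with primitive G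
   vanishing at 0, duality and Tonelli turn the pairing of g with H_b f into the
   pairing of f with the function h t = int_(b > t) g, and, since the sets
   (b > t) are initial segments, int h^l = int b d(G^l).

   Upper bound: as (G / x)^(l-1) g is nonincreasing, a bound on
   int_0^t x^(l-1) b for all t (which is what A_2 controls) allows one to replace
   b by A_2^l x^(-l/q) in int b d(G^l); the resulting inequality is that of
   Bliss (Hardy if p = q).  Only nonincreasing g are needed, because
   (H_b f)^(q-1) is nonincreasing.

   Lower bound: f = h^(l-1) shows that int b d(G^l) <= N^l (int g^k)^(l/k).
   Taking g constant on (0, t) gives (q')^(1/p') A_2 <= N; taking a truncated
   extremal of the Bliss (Hardy) inequality, rescaled so that its mass sits
   where c_2 exceeds a given number below its lower limit at 0 (at oo), gives
   the other two bounds. *)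

Require Import Defs.
From mathcomp Require Import all_boot all_order all_algebra.
From mathcomp Require Import all_classical all_reals all_analysis.
From mathcomp Require Import measurable_realfun.
From mathcomp Require Import ring lra.

Set Implicit Arguments.
Unset Strict Implicit.
Unset Printing Implicit Defensive.

Import Order.TTheory GRing.Theory Num.Theory.
Import numFieldNormedType.Exports.

Local Open Scope classical_set_scope.
Local Open Scope ring_scope.
Local Open Scope ereal_scope.

(** * Tonelli and comparison on the half-line *)

(** The sharp inequality between the primitives W of x^(-l/q) (G / x)^(l-1) g-type densities and U
    of g^k is obtained from a Bellman function P: the quantity U - (k / l) m^(-r) W - m P(lev / m),
    with lev = x^(-(k-1)) G^k, is nondecreasing, because its derivative is g^k minus a tangent line
    of z^k. On the extremal lev rises and then falls, so P has two branches, exchanged at a maximum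
    of lev; their difference there is bounded below by the beta integral that produces the Gamma
    quotient in K. For p = q the function P becomes linear. Two obstacles shape the rest. The
    calculus needs a continuous g, while (H_b f)^(q-1) is only monotone: averaging g over [x, m x]
    and dilating costs a factor m > 1, which is then removed. And both bounds end by solving X <= C
    X^(1-a) for X, which requires X < +oo; hence the truncations of H_b f and of h^(l-1). *)

Notation LT R := (lebesgueType R).
Notation mu := (@lebesgue_measure _).
Notation pos R := (`]0%R, +oo[%classic : set R).
Notation halfline R := (`]0%R, +oo[%classic : set (lebesgueType R)).

Lemma leb_measurable (R : realType) (A : set R) :
  measurable (A : set (measurableTypeR R)) -> measurable (A : set (LT R)).
Proof. by move=> mA; exact: sub_caratheodory. Qed.

Lemma leb_measurable_fun (R : realType) d (Y : measurableType d) (A : set R)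
    (f : R -> Y) :
  measurable (A : set (measurableTypeR R)) ->
  measurable_fun (A : set (measurableTypeR R)) f ->
  measurable_fun (A : set (LT R)) f.
Proof. by move=> mA mf _ B mB; apply: leb_measurable; exact: mf. Qed.

(** The identity from the Lebesgue to the Borel sigma-algebra is measurable and pushes the completed
    measure forward to [lebesgue_measure]. Thus the completed measure matters only where the
    arbitrary function of [Lplus] occurs; the other functions are Borel. *)
Lemma leb_integralE (R : realType) (A : set R) (f : R -> \bar R) :
  measurable (A : set (measurableTypeR R)) ->
  measurable_fun (A : set (measurableTypeR R)) f ->
  (forall x, A x -> 0 <= f x) ->
  \int[leb R]_(x in A) f x = \int[mu]_(x in A) f x.
Proof.
move=> mA mf f0.
have mid : measurable_fun [set: LT R] (fun x : LT R => x : measurableTypeR R).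
  exact: leb_measurable_fun.
rewrite -[LHS](@ge0_integral_pushforward _ _ (LT R) (measurableTypeR R) _ id mid (leb R) A f)//.
by move=> x /set_mem; exact: f0.
Qed.

Lemma measurable_EFinLT (R : realType) : measurable_fun [set: LT R] (fun x : LT R => (x : R)%:E).
Proof.
apply: leb_measurable_fun => //; exact/measurable_EFinP.
Qed.

Lemma tonelli_section d1 d2 (T1 : measurableType d1) (T2 : measurableType d2)
    (R : realType) (m1 : {sigma_finite_measure set T1 -> \bar R})
    (m2 : {sigma_finite_measure set T2 -> \bar R}) (A : set (T1 * T2))
    (g : T1 -> \bar R) (f : T2 -> \bar R) :
  measurable A -> measurable_fun setT g -> measurable_fun setT f ->
  (forall x, 0 <= g x) -> (forall t, 0 <= f t) ->
  \int[m1]_x (g x * \int[m2]_(t in xsection A x) f t) =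
  \int[m2]_t (f t * \int[m1]_(x in ysection A t) g x).
Proof.
move=> mA mg mf g0 f0.
pose F (z : T1 * T2) := g z.1 * (f z.2 * (\1_A z)%:E).
have mF : measurable_fun setT F.
  apply: emeasurable_funM; first exact: (measurableT_comp mg measurable_fst).
  apply: emeasurable_funM; first exact: (measurableT_comp mf measurable_snd).
  by apply/measurable_EFinP; exact: measurable_indic.
have F0 z : 0 <= F z by rewrite /F !mule_ge0// lee_fin.
have E1 x : \int[m2]_y F (x, y) = g x * \int[m2]_(t in xsection A x) f t.
  rewrite /F /= ge0_integralZl//; last 2 first.
  - apply: emeasurable_funM => //; apply/measurable_EFinP.
    by apply: measurableT_comp; [exact: measurable_indic|exact: pair1_measurable].
  - by move=> t _; rewrite mule_ge0// lee_fin.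
  congr (_ * _); rewrite [RHS]integral_mkcond; apply: eq_integral => t _.
  rewrite /patch indicE mem_xsection.
  by case: ifP => _; rewrite ?mule1 ?mule0.
have E2 t : \int[m1]_x F (x, t) = f t * \int[m1]_(x in ysection A t) g x.
  under eq_integral do rewrite /F/= muleCA.
  rewrite /F /= ge0_integralZl//; last 2 first.
  - apply: emeasurable_funM => //; apply/measurable_EFinP.
    by apply: measurableT_comp; [exact: measurable_indic|exact: pair2_measurable].
  - by move=> x _; rewrite mule_ge0// lee_fin.
  congr (_ * _); rewrite [RHS]integral_mkcond; apply: eq_integral => x _.
  rewrite /patch indicE mem_ysection.
  by case: ifP => _; rewrite ?mule1 ?mule0.
by under eq_integral do rewrite -E1; under [RHS]eq_integral do rewrite -E2; exact: fubini_tonelli.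
Qed.

(** The function [v] stands for the embedding of the reals into [\bar R]. With [v] and the type
    abstract, one proof serves both the Lebesgue and the Borel structure on the line. *)
Lemma tonelli_sublevel_gen d (T : measurableType d) (R : realType)
    (m : {sigma_finite_measure set T -> \bar R}) (I : set T) (v b f g : T -> \bar R) :
  measurable I -> measurable_fun setT v -> measurable_fun I b -> measurable_fun I f ->
  measurable_fun I g -> (forall x, I x -> 0 <= f x) -> (forall x, I x -> 0 <= g x) ->
  \int[m]_(x in I) (g x * \int[m]_(t in I `&` [set t | v t < b x]) f t) =
  \int[m]_(t in I) (f t * \int[m]_(x in I `&` [set x | v t < b x]) g x).
Proof.
move=> mI mv mb mf mg f0 g0.
(* As [b] is measurable only on [I], it is extended by 0 to make the region measurable in the whole
   product; points outside [I] are cancelled by the restrictions of [f] and [g]. *)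
pose A := [set z : T * T | v z.2 < (b \_ I) z.1].
have mA : measurable A.
  rewrite -[A]setTI; apply: (measurable_lte measurableT).
    exact: (measurableT_comp mv measurable_snd).
  by apply: measurableT_comp measurable_fst; apply/(measurable_restrictT b mI).
have f0' t : 0 <= (f \_ I) t by apply: erestrict_ge0 => u; exact: f0.
have g0' t : 0 <= (g \_ I) t by apply: erestrict_ge0 => u; exact: g0.
have := tonelli_section m m mA ((measurable_restrictT g mI).1 mg)
  ((measurable_restrictT f mI).1 mf) g0' f0'.
set L := (X in X = _ -> _); set L' := (X in _ = X -> _).
have -> : L = \int[m]_(x in I) (g x * \int[m]_(t in I `&` [set t | v t < b x]) f t).
  rewrite [RHS]integral_mkcond; apply: eq_integral => x _.
  rewrite {1 3}/patch; case: ifPn => [/set_mem Ix|_]; last by rewrite mul0e.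
  congr (_ * _); rewrite -integral_mkcondr; congr (integral _ _ _).
  by apply/seteqP; split => t; rewrite /xsection/= inE/= /A/= /patch mem_set// => -[].
have -> // : L' = \int[m]_(t in I) (f t * \int[m]_(x in I `&` [set x | v t < b x]) g x).
rewrite [RHS]integral_mkcond; apply: eq_integral => t _.
rewrite {1 3}/patch; case: ifPn => [/set_mem It|_]; last by rewrite mul0e.
congr (_ * _); rewrite -integral_mkcondr; congr (integral _ _ _).
apply/seteqP; split => x; rewrite /ysection/= inE/= /A/= /patch => -[].
  by move=> + Ix; rewrite mem_set.
by move=> Ix; rewrite mem_set.
Qed.

Lemma set_posI (R : realType) (P : R -> Prop) :
  [set x : R | (0 < x)%R /\ P x] = `]0%R, +oo[%classic `&` [set x | P x].
Proof. by apply/seteqP; split => x /=; rewrite in_itv/= andbT. Qed.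

Lemma tonelli_sublevel (R : realType) (b f g : LT R -> \bar R) :
  measurable_fun (halfline R) b -> measurable_fun (halfline R) f ->
  measurable_fun (halfline R) g ->
  (forall x : R, (0 < x)%R -> 0 <= f x) -> (forall x : R, (0 < x)%R -> 0 <= g x) ->
  \int[leb R]_(x in halfline R) (g x *
    \int[leb R]_(t in [set t : LT R | (0 < t)%R /\ t%:E < b x]) f t) =
  \int[leb R]_(t in halfline R) (f t *
    \int[leb R]_(x in [set x : LT R | (0 < x)%R /\ t%:E < b x]) g x).
Proof.
move=> mb mf mg f0 g0.
have mI : measurable (halfline R) by apply: leb_measurable; exact: measurable_itv.
under eq_integral do rewrite set_posI; under [RHS]eq_integral do rewrite set_posI.
by apply: (tonelli_sublevel_gen (leb R) mI (@measurable_EFinLT R) mb mf mg) => x;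
  rewrite /= in_itv/= andbT; [exact: f0|exact: g0].
Qed.

Lemma initial_segment (R : realType) (J : set R) :
  (forall x, J x -> (0 < x)%R) ->
  (forall x y, (0 < x)%R -> (x <= y)%R -> J y -> J x) ->
  [\/ J = set0, exists2 t : R, (0 < t)%R & J = `]0%R, t[%classic,
     exists2 t : R, (0 < t)%R & J = `]0%R, t]%classic | J = `]0%R, +oo[%classic].
Proof.
move=> J0 Jd.
have [->|/set0P[x0 Jx0]] := eqVneq J set0; first by constructor 1.
have [ubJ|ubJ] := pselect (has_ubound J); last first.
  constructor 4; apply/seteqP; split => x /=; rewrite in_itv/= andbT; first exact: J0.
  move=> x_gt0; apply: contrapT => nJx; apply: ubJ; exists x => y Jy.
  by rewrite leNgt; apply/negP => xy; apply: nJx; apply: Jd Jy => //; exact: ltW.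
have supJ : has_sup J by split => //; exists x0.
have s0 : (0 < sup J)%R by apply: (lt_le_trans (J0 _ Jx0)); apply: ub_le_sup.
have lt_in x : (0 < x)%R -> (x < sup J)%R -> J x.
  move=> x_gt0 xs; have sx : (0 < sup J - x)%R by rewrite subr_gt0.
  have [y Jy xy] := sup_adherent sx supJ.
  by apply: Jd Jy => //; move: xy; rewrite opprB addrC subrK => /ltW.
have [Js|nJs] := pselect (J (sup J)).
  constructor 3; exists (sup J) => //; apply/seteqP; split => x /=; rewrite in_itv/=.
    by move=> Jx; rewrite (J0 _ Jx)/= ub_le_sup.
  by case/andP => x_gt0; rewrite le_eqVlt => /predU1P[->//|]; exact: lt_in.
constructor 2; exists (sup J) => //; apply/seteqP; split => x /=; rewrite in_itv/=.
  move=> Jx; rewrite (J0 _ Jx)/= lt_neqAle ub_le_sup// andbT.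
  by apply/eqP => xs; apply: nJs; rewrite -xs.
by case/andP => x_gt0; exact: lt_in.
Qed.

Lemma eq_lerW (R : realType) (x y : R) : x = y -> (x <= y)%R.
Proof. by move=> ->. Qed.

Lemma le_poweR (R : realType) (r : R) (x y : \bar R) :
  (0 <= r)%R -> 0 <= x -> x <= y -> x `^ r <= y `^ r.
Proof.
move=> r0 x0 xy; apply: gt0_ler_poweR => //; rewrite in_itv/= leey andbT//.
exact: le_trans xy.
Qed.

Lemma nonincreasing_emeasurable (R : realType) (b : R -> \bar R) :
  (forall x y, (0 < x)%R -> (x <= y)%R -> b y <= b x) ->
  measurable_fun (pos R) b.
Proof.
move=> nib mI; apply: (measurability _ (ErealGenOInfty.measurableE R)).
move=> _ [_ [r ->] <-]; apply: is_interval_measurable => x y /=.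
rewrite !in_itv/= !andbT => -[x0 bx] [y0 b_y] z /andP[xz zy].
have z0 : (0 < z)%R by exact: lt_le_trans xz.
by split; rewrite in_itv/= ?z0// andbT (lt_le_trans b_y)// nib.
exact: measurable_itv.
Qed.

Lemma sublevel_measurable (R : realType) (b : R -> \bar R) (t : R) :
  (forall x y, (0 < x)%R -> (x <= y)%R -> b y <= b x) ->
  measurable [set x : R | (0 < x)%R /\ t%:E < b x].
Proof.
move=> nib; apply: is_interval_measurable => x y /= [x0 tx] [y0 ty] z /andP[xz zy].
have z0 : (0 < z)%R by exact: lt_le_trans xz.
by split=> //; rewrite (lt_le_trans ty)// nib.
Qed.

Lemma tonelli_sublevelB (R : realType) (b f g : R -> \bar R) :
  measurable_fun (pos R) b -> measurable_fun (pos R) f ->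
  measurable_fun (pos R) g ->
  (forall x : R, (0 < x)%R -> 0 <= f x) -> (forall x : R, (0 < x)%R -> 0 <= g x) ->
  \int[mu]_(x in `]0%R, +oo[) (g x *
    \int[mu]_(t in [set t : R | (0 < t)%R /\ t%:E < b x]) f t) =
  \int[mu]_(t in `]0%R, +oo[) (f t *
    \int[mu]_(x in [set x : R | (0 < x)%R /\ t%:E < b x]) g x).
Proof.
move=> mb mf mg f0 g0.
have mI : measurable (`]0%R, +oo[ : set R) by exact: measurable_itv.
have mE : measurable_fun setT (@EFin R) by exact/measurable_EFinP.
under eq_integral do rewrite set_posI; under [RHS]eq_integral do rewrite set_posI.
by apply: (tonelli_sublevel_gen (@lebesgue_measure R) mI mE mb mf mg) => x;
  rewrite /= in_itv/= andbT; [exact: f0|exact: g0].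
Qed.

Lemma measurable_fun_segment d (Y : measurableType d) (R : realType) (t : R) (F : R -> Y) :
  measurable_fun (pos R) F -> measurable_fun (`]0%R, t[ : set R) F.
Proof. by move=> mF; apply: measurable_funS mF => // x /=; rewrite !in_itv/= => /andP[->]. Qed.

Lemma ge0_integralZl_segment (R : realType) (c t : R) (F : R -> \bar R) : (0 <= c)%R ->
  measurable_fun (pos R) F -> (forall x : R, (0 < x)%R -> 0 <= F x) ->
  \int[mu]_(x in `]0%R, t[) (c%:E * F x) =
  c%:E * \int[mu]_(x in `]0%R, t[) F x.
Proof.
move=> c0 mF F0; apply: ge0_integralZl => //; first exact: measurable_fun_segment.
by move=> x; rewrite /= in_itv/= => /andP[x0 _]; exact: F0.
Qed.

Lemma integral_itv0y_cvg (R : realType) (g : R -> \bar R) :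
  measurable_fun (pos R) g ->
  (forall x : R, (0 < x)%R -> 0 <= g x) ->
  \int[mu]_(x in `]0%R, n%:R[) g x @[n --> \oo] -->
  \int[mu]_(x in `]0%R, +oo[) g x.
Proof.
move=> mg g0.
have -> : (`]0%R, +oo[%classic : set R) = \bigcup_n (`]0%R, n%:R[%classic).
  apply/seteqP; split => x /=; rewrite in_itv/= ?andbT.
    move=> x0; exists (Num.bound x) => //=; rewrite in_itv/= x0/=.
    by rewrite archi_boundP// ltW.
  by move=> [n _] /=; rewrite !in_itv/= => /andP[->].
apply: ge0_nondecreasing_set_cvg_integral => //.
- move=> n m nm; apply/subsetPset => x /=; rewrite !in_itv/= => /andP[->/= xn].
  by rewrite (lt_le_trans xn)// ler_nat.
- by move=> i; apply: measurable_funS mg => // x /=; rewrite !in_itv/= => /andP[->].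
- by move=> i x /=; rewrite in_itv/= => /andP[x0 _]; exact: g0.
Qed.

(** The right endpoint of a bounded segment is a null set, so that open and closed segments need no
    distinction under an integral. *)
Lemma initial_segment_integral (R : realType) (J : set R) :
  (forall x, J x -> (0 < x)%R) ->
  (forall x y, (0 < x)%R -> (x <= y)%R -> J y -> J x) ->
  [\/ J = set0,
      exists2 t : R, (0 < t)%R &
        forall g : R -> \bar R, measurable_fun (pos R) g ->
        \int[mu]_(x in J) g x = \int[mu]_(x in `]0%R, t[) g x |
      J = `]0%R, +oo[%classic].
Proof.
move=> J0 Jd; have [->|[t t0 ->]|[t t0 ->]|->] := initial_segment J0 Jd.
- by constructor 1.
- by constructor 2; exists t.
- constructor 2; exists t => // g mg; rewrite integral_itv_bndo_bndc//.
  by apply: measurable_funS mg => // x /=; rewrite !in_itv/= => /andP[->].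
- by constructor 3.
Qed.

Lemma initial_segment_integral_le (R : realType) (J : set R) (g1 g2 : R -> \bar R) :
  (forall x, J x -> (0 < x)%R) ->
  (forall x y, (0 < x)%R -> (x <= y)%R -> J y -> J x) ->
  measurable_fun (pos R) g1 -> measurable_fun (pos R) g2 ->
  (forall x : R, (0 < x)%R -> 0 <= g1 x) -> (forall x : R, (0 < x)%R -> 0 <= g2 x) ->
  (forall t : R, (0 < t)%R -> \int[mu]_(x in `]0%R, t[) g1 x <=
     \int[mu]_(x in `]0%R, t[) g2 x) ->
  \int[mu]_(x in J) g1 x <= \int[mu]_(x in J) g2 x.
Proof.
move=> J0 Jd mg1 mg2 g10 g20 g12.
have [->|[t t0 tE]|->] := initial_segment_integral J0 Jd.
- by rewrite !integral_set0.
- by rewrite !tE// g12.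
- have c1 := integral_itv0y_cvg mg1 g10; have c2 := integral_itv0y_cvg mg2 g20.
  rewrite -(cvg_lim _ c1)// -(cvg_lim _ c2)//; apply: lee_lim; [exact: cvgP c1|exact: cvgP c2|].
  near=> n; apply: g12; rewrite ltr0n; near: n; exact: nbhs_infty_gt.
Unshelve. all: by end_near.
Qed.

Lemma integral_sublevel_cst1 (R : realType) (y : \bar R) : 0 <= y ->
  \int[mu]_(t in [set t : R | (0 < t)%R /\ t%:E < y]) cst 1 t = y.
Proof.
move=> y0.
have -> : [set t : R | (0 < t)%R /\ t%:E < y] = [set` Interval (BRight 0%R) (if y is r%:E then BLeft r else BInfty _ false)].
  apply/seteqP; split => x /=; rewrite in_itv/=; move: y0; case: y => [r||]//= r0; rewrite ?lte_fin ?ltry ?andbT.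
  - by move=> [-> ->].
  - by case.
  - by move/andP.
  - by [].
rewrite integral_cst; last exact: (measurable_itv (Interval _ _)).
rewrite mul1e; move: y0; case: y => [r||]//= r0; rewrite lebesgue_measure_itv/=.
  rewrite lte_fin; case: ltP => [_|]; first by rewrite oppr0 adde0.
  by move=> r0'; congr EFin; apply/eqP; rewrite eq_le r0' andbT -lee_fin.
by rewrite ltry oppr0 adde0.
Qed.

(* Layer-cake: [phi] is an average of indicators of initial segments. *)
Lemma integral_nonincreasing_comparison (R : realType) (phi g1 g2 : R -> \bar R) :
  (forall x : R, (0 < x)%R -> 0 <= phi x) ->
  (forall x y : R, (0 < x)%R -> (x <= y)%R -> phi y <= phi x) ->
  measurable_fun (pos R) g1 -> measurable_fun (pos R) g2 ->
  (forall x : R, (0 < x)%R -> 0 <= g1 x) -> (forall x : R, (0 < x)%R -> 0 <= g2 x) ->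
  (forall t : R, (0 < t)%R -> \int[mu]_(x in `]0%R, t[) g1 x <=
     \int[mu]_(x in `]0%R, t[) g2 x) ->
  \int[mu]_(x in `]0%R, +oo[) (g1 x * phi x) <=
  \int[mu]_(x in `]0%R, +oo[) (g2 x * phi x).
Proof.
move=> phi0 niphi mg1 mg2 g10 g20 g12.
have mphi := nonincreasing_emeasurable niphi.
have layer (g : R -> \bar R) : measurable_fun (pos R) g ->
    (forall x : R, (0 < x)%R -> 0 <= g x) ->
  \int[mu]_(x in `]0%R, +oo[) (g x * phi x) =
  \int[mu]_(t in `]0%R, +oo[)
    \int[mu]_(x in [set x : R | (0 < x)%R /\ t%:E < phi x]) g x.
  move=> mg g0.
  (* The value [phi x] is the length of (0, phi x); written as an integral of 1 it lends itself to
     Tonelli. *)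
  transitivity (\int[mu]_(x in `]0%R, +oo[) (g x *
    \int[mu]_(t in [set t : R | (0 < t)%R /\ t%:E < phi x]) cst 1 t)).
    apply: eq_integral => x; rewrite inE/= in_itv/= andbT => x0.
    by rewrite integral_sublevel_cst1// phi0.
  rewrite (tonelli_sublevelB mphi (@measurable_cst _ _ _ _ _ 1) mg _ g0)//.
  by apply: eq_integral => t _; rewrite mul1e.
rewrite !layer//.
have seg (t : R) : (forall x, [set x : R | (0 < x)%R /\ t%:E < phi x] x -> (0 < x)%R) /\
  (forall x y, (0 < x)%R -> (x <= y)%R -> [set x : R | (0 < x)%R /\ t%:E < phi x] y ->
     [set x : R | (0 < x)%R /\ t%:E < phi x] x).
  split=> [x []//|x y x0 xy /= [y0 ty]]; split=> //.
  by rewrite (lt_le_trans ty)// niphi.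
have le_t (t : R) := initial_segment_integral_le (seg t).1 (seg t).2 mg1 mg2 g10 g20 g12.
apply: ge0_le_integral => //.
- by move=> t _; apply: integral_ge0 => x /= [x0 _]; exact: g10.
- apply: nonincreasing_emeasurable => t u t0 tu.
  apply: ge0_subset_integral.
  + exact: sublevel_measurable.
  + exact: sublevel_measurable.
  + by apply: measurable_funS mg1 => // x [x0 _] /=; rewrite in_itv/= x0.
  + by move=> x [x0 _]; exact: g10.
  + by move=> x [x0 ux]; split=> //; rewrite (le_lt_trans _ ux)// lee_fin.
- apply: nonincreasing_emeasurable => t u t0 tu.
  apply: ge0_subset_integral.
  + exact: sublevel_measurable.
  + exact: sublevel_measurable.
  + by apply: measurable_funS mg2 => // x [x0 _] /=; rewrite in_itv/= x0.
  + by move=> x [x0 _]; exact: g20.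
  + by move=> x [x0 ux]; split=> //; rewrite (le_lt_trans _ ux)// lee_fin.
Qed.

(** The measure [c] times the pushforward of Lebesgue measure under x -> c x gives every interval
    its length, hence is Lebesgue measure. *)
Lemma ge0_integral_scale (R : realType) (c : R) (f : R -> \bar R) : (0 < c)%R ->
  measurable_fun (pos R) f -> (forall x : R, (0 < x)%R -> 0 <= f x) ->
  \int[mu]_(x in `]0%R, +oo[) f (c * x)%R =
  c^-1%:E * \int[mu]_(x in `]0%R, +oo[) f x.
Proof.
move=> c0 mf f0.
pose phi (x : measurableTypeR R) : measurableTypeR R := (c * x)%R.
have mphi : measurable_fun setT phi by exact: mulrl_measurable.
pose m' := mscale (NngNum (ltW c0)) (pushforward (@lebesgue_measure R) phi).
have E A : measurable A -> lebesgue_measure A = m' mphi A.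
  apply: lebesgue_measure_unique => _ [[a b]/= ab <-].
  rewrite /m' /mscale/= /pushforward.
  have -> : phi @^-1` `]a, b]%classic = `](a / c)%R, (b / c)%R]%classic.
    apply/seteqP; split => x /=; rewrite !in_itv/= /phi ltr_pdivrMr// ler_pdivlMr//;
      by rewrite (mulrC c).
  rewrite !lebesgue_measure_itv/= !lte_fin ltr_pM2r ?invr_gt0//.
  case: ifP => _; last by rewrite mule0.
  by rewrite -EFinD -!EFinB -EFinM -mulrBl mulrC divfK// gt_eqF.
have mI : measurable (`]0%R, +oo[ : set (measurableTypeR R)) by exact: measurable_itv.
have -> : \int[mu]_(x in `]0%R, +oo[) f x = \int[m' mphi]_(x in `]0%R, +oo[) f x.
  apply: eq_measure_integral => A mA _; exact: E.
rewrite /m' ge0_integral_mscale//; last by move=> x; rewrite /= in_itv/= andbT; exact: f0.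
rewrite muleA -EFinM mulVf ?gt_eqF// mul1e ge0_integral_pushforward//; last first.
  by move=> x /set_mem; rewrite /= in_itv/= andbT; exact: f0.
congr (integral _ _ _); apply/seteqP; split => x /=; rewrite !in_itv/= !andbT /phi pmulr_rgt0//.
Qed.

(** Young's inequality for u / a^(1/p) and v / b^(1/q). When a and b are the integrals of u^p and
    v^q, integration turns the bracket into 1/p + 1/q = 1, which is Hoelder's inequality. *)
Lemma young_scaled (R : realType) (p q a b u v : R) :
  (0 < p -> 0 < q -> p^-1 + q^-1 = 1 -> 0 < a -> 0 < b -> 0 <= u -> 0 <= v ->
  u * v <= a `^ p^-1 * b `^ q^-1 * (p^-1 / a * u `^ p + q^-1 / b * v `^ q))%R.
Proof.
move=> p0 q0 pq a0 b0 u0 v0.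
have ap0 : (0 < a `^ p^-1)%R by exact: powR_gt0.
have bq0 : (0 < b `^ q^-1)%R by exact: powR_gt0.
have := @conjugate_powR _ (u / a `^ p^-1)%R (v / b `^ q^-1)%R p q.
rewrite !divr_ge0 ?powR_ge0// => /(_ isT isT p0 q0 pq).
have inv (x s : R) : (0 < x -> 0 < s -> (x `^ s^-1)^-1 `^ s = x^-1)%R.
  by move=> x0 s0; rewrite -powRN -powRrM mulNr mulVf ?gt_eqF// powRN powRr1// ltW.
rewrite !powRM ?invr_ge0 ?powR_ge0// !inv// => H.
have -> : (u * v = a `^ p^-1 * b `^ q^-1 * (u / a `^ p^-1 * (v / b `^ q^-1)))%R.
  by field; rewrite !gt_eqF.
rewrite ler_pM2l ?mulr_gt0//; apply: le_trans H _.
by apply: eq_lerW; field; rewrite !gt_eqF.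
Qed.

(** Values and norms may be infinite, as is the case for a general [f] in [Lplus] and for its image
    under the operator. Norms equal to 0 or +oo are settled first; the rest is Young's inequality
    scaled by the two integrals. *)
Lemma hoelder_ge0 d (T : measurableType d) (R : realType)
    (m : {measure set T -> \bar R}) (D : set T) (f g : T -> \bar R) (p q : R) :
  measurable D -> measurable_fun D f -> measurable_fun D g ->
  (forall x, D x -> 0 <= f x) -> (forall x, D x -> 0 <= g x) ->
  (0 < p)%R -> (0 < q)%R -> (p^-1 + q^-1 = 1)%R ->
  \int[m]_(x in D) (f x * g x) <=
  (\int[m]_(x in D) (f x `^ p)) `^ p^-1 * (\int[m]_(x in D) (g x `^ q)) `^ q^-1.
Proof.
move=> mD mf mg f0 g0 p0 q0 pq.
have mfp : measurable_fun D (fun x => f x `^ p) by apply: (measurableT_comp (measurable_poweR p)).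
have mgq : measurable_fun D (fun x => g x `^ q) by apply: (measurableT_comp (measurable_poweR q)).
have mfg : measurable_fun D (fun x => f x * g x) by exact: emeasurable_funM.
have null (h k : T -> \bar R) (s : R) : (0 < s)%R -> measurable_fun D h -> measurable_fun D k ->
    (forall x, D x -> 0 <= h x) -> (forall x, D x -> 0 <= k x) ->
    \int[m]_(x in D) (h x `^ s) = 0 -> \int[m]_(x in D) (h x * k x) = 0.
  move=> s0 mh mk h0 k0 hs; apply/eqP; rewrite eq_le; apply/andP; split; last first.
    by apply: integral_ge0 => x Dx; rewrite mule_ge0 ?h0 ?k0.
  have mhs : measurable_fun D (fun x => h x `^ s) by apply: (measurableT_comp (measurable_poweR s)).
  (* Pointwise h k <= +oo h^s, and the right side integrates to +oo * 0 = 0. This replaces an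
     argument with sets of measure zero. *)
  have : \int[m]_(x in D) (+oo * h x `^ s) = 0.
    by rewrite ge0_integralZl// ?hs ?mule0// => x _; exact: poweR_ge0.
  move=> <-; apply: ge0_le_integral => //.
  - by move=> x Dx; rewrite mule_ge0 ?h0 ?k0.
  - exact: emeasurable_funM.
  - exact: emeasurable_funM.
  - move=> x Dx; have := h0 _ Dx; rewrite le_eqVlt => /predU1P[<-|hx].
      by rewrite mul0e mule_ge0// poweR_ge0.
    by rewrite gt0_mulye ?leey// poweR_gt0.
set A := \int[m]_(x in D) (f x `^ p); set B := \int[m]_(x in D) (g x `^ q).
have A0 : 0 <= A by apply: integral_ge0 => x _; exact: poweR_ge0.
have B0 : 0 <= B by apply: integral_ge0 => x _; exact: poweR_ge0.
have [A0'|An0] := eqVneq A 0.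
  by rewrite (null f g p)// mule_ge0 ?poweR_ge0.
have [B0'|Bn0] := eqVneq B 0.
  under eq_integral do rewrite muleC.
  by rewrite (null g f q)// mule_ge0 ?poweR_ge0.
have Agt0 : 0 < A by rewrite lt0e An0.
have Bgt0 : 0 < B by rewrite lt0e Bn0.
have [Ay|Ay] := eqVneq A +oo.
  by rewrite Ay poweRyr ?gt_eqF ?invr_gt0// gt0_mulye ?leey// poweR_gt0.
have [By|By] := eqVneq B +oo.
  by rewrite By poweRyr ?gt_eqF ?invr_gt0// gt0_muley ?leey// poweR_gt0.
have Afin : A \is a fin_num by rewrite ge0_fin_numE// lt_neqAle Ay leey.
have Bfin : B \is a fin_num by rewrite ge0_fin_numE// lt_neqAle By leey.
have [a aE] : exists a, A = a%:E by exists (fine A); rewrite fineK.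
have [b bE] : exists b, B = b%:E by exists (fine B); rewrite fineK.
have a0 : (0 < a)%R by rewrite -lte_fin -aE.
have b0 : (0 < b)%R by rewrite -lte_fin -bE.
have ap0 : (0 < a `^ p^-1)%R by exact: powR_gt0.
have bq0 : (0 < b `^ q^-1)%R by exact: powR_gt0.
have ptw x : D x -> f x * g x <= (a `^ p^-1 * b `^ q^-1)%:E *
    ((p^-1 / a)%:E * f x `^ p + (q^-1 / b)%:E * g x `^ q).
  move=> Dx; have := f0 _ Dx; have := g0 _ Dx; case: (f x) => [u| |]//; case: (g x) => [v| |]//.
  - move=> v0 u0; have {}v0 : (0 <= v)%R by []. have {}u0 : (0 <= u)%R by [].
    suff : (u * v <= a `^ p^-1 * b `^ q^-1 * (p^-1 / a * u `^ p + q^-1 / b * v `^ q))%R.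
      by rewrite -lee_fin.
    exact: young_scaled.
  - move=> _ u0; apply: (le_trans (leey _)); rewrite poweRyr ?gt_eqF//.
    rewrite (gt0_muley (x := (q^-1 / b)%:E)) ?lte_fin ?divr_gt0 ?invr_gt0//.
    rewrite addey ?gt0_muley ?lte_fin ?mulr_gt0 ?lexx//.
  - move=> v0 _; apply: (le_trans (leey _)); rewrite poweRyr ?gt_eqF//.
    rewrite (gt0_muley (x := (p^-1 / a)%:E)) ?lte_fin ?divr_gt0 ?invr_gt0//.
    rewrite addye ?gt0_muley ?lte_fin ?mulr_gt0 ?lexx//.
  - move=> _ _; apply: (le_trans (leey _)); rewrite !poweRyr ?gt_eqF//.
    rewrite (gt0_muley (x := (p^-1 / a)%:E)) ?lte_fin ?divr_gt0 ?invr_gt0//.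
    rewrite (gt0_muley (x := (q^-1 / b)%:E)) ?lte_fin ?divr_gt0 ?invr_gt0//.
    by rewrite addye// gt0_muley ?lte_fin ?mulr_gt0 ?leey.
apply: (@le_trans _ _ (\int[m]_(x in D) ((a `^ p^-1 * b `^ q^-1)%:E *
    ((p^-1 / a)%:E * f x `^ p + (q^-1 / b)%:E * g x `^ q)))).
  apply: ge0_le_integral => //.
  - by move=> x Dx; rewrite mule_ge0 ?f0 ?g0.
  - by apply: measurable_funeM; apply: emeasurable_funD; exact: measurable_funeM.
have pa0 : (0 <= p^-1 / a)%R by rewrite divr_ge0 ?invr_ge0 ?ltW.
have qb0 : (0 <= q^-1 / b)%R by rewrite divr_ge0 ?invr_ge0 ?ltW.
rewrite ge0_integralZl//; last 3 first.
- by apply: emeasurable_funD; exact: measurable_funeM.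
- by move=> x Dx; rewrite adde_ge0// mule_ge0 ?poweR_ge0// lee_fin.
- by rewrite lee_fin mulr_ge0 ?powR_ge0.
rewrite ge0_integralD//; last 4 first.
- by move=> x Dx; rewrite mule_ge0 ?poweR_ge0// lee_fin.
- exact: measurable_funeM.
- by move=> x Dx; rewrite mule_ge0 ?poweR_ge0// lee_fin.
- exact: measurable_funeM.
rewrite !ge0_integralZl//; try by move=> x _; exact: poweR_ge0.
rewrite -/A -/B aE bE !poweR_EFin -!EFinM lee_fin !divfK ?gt_eqF// pq mulr1//.
Qed.

(** * Calculus on the half-line *)

Section derive_combinators.
Local Open Scope ring_scope.
Variable R : realType.
Implicit Types (f g : R -> R) (x a b c : R).

Lemma is_derive_cont f x a : is_derive x (1 : R) f a -> {for x, continuous f}.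
Proof. by move=> [df _]; apply: differentiable_continuous; exact/derivable1_diffP. Qed.

Lemma derive_id_fun x : is_derive x (1 : R) (fun y : R => y) 1.
Proof. exact: is_derive_id. Qed.

Lemma derive_cst_fun c x : is_derive x (1 : R) (fun _ : R => c) 0.
Proof. exact: is_derive_cst. Qed.

Lemma deriveD_fun f g x a b : is_derive x (1 : R) f a -> is_derive x (1 : R) g b ->
  is_derive x (1 : R) (fun y => f y + g y) (a + b).
Proof. by move=> df dg; exact: is_deriveD. Qed.

Lemma deriveB_fun f g x a b : is_derive x (1 : R) f a -> is_derive x (1 : R) g b ->
  is_derive x (1 : R) (fun y => f y - g y) (a - b).
Proof. by move=> df dg; exact: is_deriveB. Qed.

Lemma deriveN_fun f x a : is_derive x (1 : R) f a -> is_derive x (1 : R) (fun y => - f y) (- a).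
Proof. by move=> df; exact: is_deriveN. Qed.

Lemma deriveM_fun f g x a b : is_derive x (1 : R) f a -> is_derive x (1 : R) g b ->
  is_derive x (1 : R) (fun y => f y * g y) (a * g x + f x * b).
Proof.
move=> df dg; have := is_deriveM df dg.
by rewrite /GRing.scale/= addrC (mulrC (g x)).
Qed.

Lemma deriveZ_fun c f x a : is_derive x (1 : R) f a ->
  is_derive x (1 : R) (fun y => c * f y) (c * a).
Proof. by move=> df; exact: (is_deriveZ c df). Qed.

Lemma derive_comp_fun f g x a b : is_derive (g x) (1 : R) f a ->
  is_derive x (1 : R) g b -> is_derive x (1 : R) (fun y => f (g y)) (a * b).
Proof. by move=> df dg; exact: (is_derive1_comp df dg). Qed.

Lemma derive_powR_fun f x a c : 0 < f x -> is_derive x (1 : R) f a ->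
  is_derive x (1 : R) (fun y => f y `^ c) (c * f x `^ (c - 1) * a).
Proof. by move=> fx df; exact: (is_derive1_comp (is_derive1_powR c fx) df). Qed.

Lemma is_derive_ext f a b x : is_derive x (1 : R) f a -> a = b -> is_derive x (1 : R) f b.
Proof. by move=> ? <-. Qed.

Lemma derive_ge0_le f x y : x <= y ->
  (forall z, x <= z <= y -> exists2 d, 0 <= d & is_derive z (1 : R) f d) -> f x <= f y.
Proof.
move=> xy H.
apply: (@ger0_derive1_le_cc _ f x y) => //; rewrite ?in_itv/= ?lexx ?xy//.
- move=> z; rewrite in_itv/= => /andP[/ltW xz /ltW zy].
  by have [|d _ []//] := H z; rewrite xz.
- move=> z; rewrite in_itv/= => /andP[/ltW xz /ltW zy].
  by have [|d d0 [df dE]] := H z; rewrite ?xz// derive1E dE.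
- apply: continuous_in_subspaceT => z /set_mem/=; rewrite in_itv/= => zxy.
  by have [d d0 df] := H z zxy; exact: is_derive_cont df.
Qed.

Lemma derive_eq0_eq f x y : x <= y ->
  (forall z, x <= z <= y -> is_derive z (1 : R) f 0) -> f x = f y.
Proof.
move=> xy H; apply/eqP; rewrite eq_le; apply/andP; split.
  by apply: derive_ge0_le => // z /H ?; exists 0.
rewrite -lerN2; apply: (@derive_ge0_le (fun z => - f z)) => // z /H df; exists 0 => //.
by have := is_deriveN df; rewrite oppr0.
Qed.

Lemma continuous_powR_fun f x c : 0 < f x -> {for x, continuous f} ->
  {for x, continuous (fun y => f y `^ c)}.
Proof.
move=> fx cf; apply: (@continuous_comp _ _ _ f (fun z => z `^ c)) => //.
exact: is_derive_cont (is_derive1_powR c fx).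
Qed.

Lemma continuous_powR_at c x : 0 < x -> {for x, continuous (fun z : R => z `^ c)}.
Proof. by move=> x0; exact: is_derive_cont (is_derive1_powR c x0). Qed.

Lemma powRDp (r s : R) x : 0 < x -> x `^ (r + s) = x `^ r * x `^ s.
Proof. by move=> x0; rewrite powRD// (gt_eqF x0) implybT. Qed.

Lemma mulr_powRB1p c x : 0 < x -> x * x `^ (c - 1) = x `^ c.
Proof. by move=> x0; rewrite -[X in X * _]powRr1 ?(ltW x0)// -(powRDp _ _ x0) addrC subrK. Qed.

Lemma continuous_positive_itv f : (forall x, 0 < x -> {for x, continuous f}) ->
  measurable_fun (pos R) f.
Proof.
move=> cf; apply: open_continuous_measurable_fun; first exact: interval_open.
by move=> x; rewrite inE/= in_itv/= andbT; exact: cf.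
Qed.

Lemma measurable_EFin_powR c : measurable_fun (pos R) (fun x => (x `^ c)%:E).
Proof. by apply/measurable_EFinP; apply: measurable_funTS; exact: measurable_powR. Qed.

(** Boundedness on each (0, X] stands in for continuity at 0 and gives integrability there. The last
    clause converts bounds of [f] into linear bounds of [F], which force the limit 0 at 0. *)
Lemma primitive_from0 f :
  (forall x, 0 < x -> {for x, continuous f}) -> (forall x, 0 < x -> 0 <= f x) ->
  (forall X, exists M, forall x, 0 < x <= X -> f x <= M) ->
  exists F : R -> R, [/\ (forall x, 0 < x -> is_derive x (1 : R) F (f x)),
    (forall x, 0 < x -> (\int[mu]_(y in `]0%R, x[) (f y)%:E)%E = (F x)%:E),
    (forall x, 0 < x -> 0 <= F x) &
    (forall x M, 0 < x -> (forall y, 0 < y < x -> f y <= M) -> F x <= M * x)].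
Proof.
move=> cf f0 bf.
have mf := continuous_positive_itv cf.
have mfx x : measurable_fun (`]0%R, x] : set R) f.
  by apply: measurable_funS mf => // y /=; rewrite !in_itv/= => /andP[->].
have intf x : lebesgue_measure.-integrable (`]0%R, x] : set R) (EFin \o f).
  have [M HM] := bf x.
  apply/integrableP; split; first by apply/measurable_EFinP; exact: mfx.
  apply: (@le_lt_trans _ _ (\int[mu]_(y in `]0%R, x]) (cst (`|M|%:E)%E y))%E).
    apply: ge0_le_integral => //.
    - by apply: measurableT_comp => //; apply/measurable_EFinP; exact: mfx.
    - move=> y /=; rewrite in_itv/= => /andP[y0 yx].
      rewrite lee_fin ger0_norm ?f0//; apply: le_trans (ler_norm _).
      by apply: HM; rewrite y0.
  rewrite integral_cst; last exact: (measurable_itv `]0, x]).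
  rewrite [X in (_ * X)%E](lebesgue_measure_itv `]0, x])/=; case: ifP => _; last by rewrite mule0 ltry.
  by rewrite -EFinB -EFinM ltry.
pose F x := (\int[mu]_(y in `]0%R, x]) f y)%R.
have FE x : (\int[mu]_(y in `]0%R, x[) (f y)%:E)%E = (F x)%:E.
  rewrite integral_itv_bndo_bndc; last first.
    apply/measurable_EFinP; apply: measurable_funS (mfx x) => // y /=.
    by rewrite !in_itv/= => /andP[-> /ltW].
  rewrite /F /Rintegral fineK//; apply: integrable_fin_num => //; exact: intf.
exists F; split.
- move=> x x0.
  have x1 : x < x + 1 by rewrite ltrDl.
  have bx : (BRight 0 < BRight x)%O by rewrite bnd_simp.
  have [dF F'] := @continuous_FTC1 R f (BRight 0) x (x + 1) x1 (intf _) bx (cf _ x0).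
  by apply: (@DeriveDef _ _ _ x 1 F (f x) dF); rewrite -derive1E; exact: F'.
- by move=> x x0.
- move=> x x0; rewrite -lee_fin -FE; apply: integral_ge0 => y /=.
  by rewrite in_itv/= => /andP[y0 _]; rewrite lee_fin f0.
- move=> x M x0 HM; rewrite -lee_fin -FE.
  apply: (@le_trans _ _ (\int[mu]_(y in `]0%R, x[) (cst (M%:E)%E y))%E).
    apply: ge0_le_integral => //.
    - by move=> y /=; rewrite in_itv/= => /andP[y0 _]; rewrite lee_fin f0.
    - apply/measurable_EFinP; apply: measurable_funS (mfx x) => // y /=.
      by rewrite !in_itv/= => /andP[-> /ltW].
  rewrite integral_cst; last exact: (measurable_itv `]0, x[).
  by rewrite [X in (_ * X)%E](lebesgue_measure_itv `]0, x[)/= lte_fin x0 oppr0 adde0.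
Qed.

(** The inverse is extended to the whole line by clamping its argument to [f c, f d]; it is then
    continuous everywhere and can be composed without range conditions. *)
Lemma continuous_increasing_inverse f c d : c < d -> {within `[c, d], continuous f} ->
  (forall x y, c <= x -> x < y -> y <= d -> f x < f y) ->
  exists h : R -> R, [/\ continuous h, {homo h : x y / x <= y}, (forall z, c <= h z <= d),
    (forall z, f c <= z <= f d -> f (h z) = z) &
    (forall y, c <= y <= d -> h (f y) = y)].
Proof.
move=> cd cf fmono.
have fle x y : c <= x -> x <= y -> y <= d -> f x <= f y.
  by move=> cx; rewrite le_eqVlt => /predU1P[->//|xy] yd; exact/ltW/fmono.
have fcd : f c < f d by apply: fmono.
pose cl z := Num.min (Num.max z (f c)) (f d).
have clP z : f c <= cl z <= f d.
  by rewrite /cl le_min ge_min le_max lexx orbT (ltW fcd) lexx orbT.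
have clid z : f c <= z <= f d -> cl z = z.
  by move=> /andP[cz zd]; rewrite /cl max_l// min_l.
have ex z : exists y, c <= y <= d /\ f y = cl z.
  have [|y] := @IVT _ f c d (cl z) (ltW cd) cf.
    by rewrite min_l ?max_r ?(ltW fcd)// clP.
  by rewrite in_itv/= => ? ?; exists y.
have [h hP] := choice ex.
have inj x y : c <= x <= d -> c <= y <= d -> f x = f y -> x = y.
  move=> /andP[cx xd] /andP[cy yd] fxy.
  by case: (ltgtP x y) => // /fmono => [/(_ cx yd)|/(_ cy xd)]; rewrite fxy ltxx.
have hf y : c <= y <= d -> h (f y) = y.
  move=> ycd; have [hcd fh] := hP (f y); apply: inj => //.
  by rewrite fh clid//; case/andP: ycd => ? ?; rewrite !fle.
have fh z : f c <= z <= f d -> f (h z) = z.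
  by move=> zcd; have [_ ->] := hP z; rewrite clid.
have hle x y : x <= y -> h x <= h y.
  move=> xy; rewrite leNgt; apply/negP => hyx.
  have [/andP[cx xd] fx] := hP x; have [/andP[cy yd] fy] := hP y.
  have := fmono _ _ cy hyx xd; rewrite fx fy; apply/negP; rewrite -leNgt.
  by rewrite /cl le_min ge_min ge_max !ge_min !le_max xy !lexx ?orbT /=.
exists h; split => //; last by move=> z; have [] := hP z.
have hinc : {in `[f c, f d] &, increasing_fun h}.
  move=> x y; rewrite !in_itv/= => xcd ycd.
  apply/idP/idP => [|]; last exact: hle.
  move=> hxy; have [/andP[cx xd] fx] := hP x; have [/andP[cy yd] fy] := hP y.
  by rewrite -(fh x xcd) -(fh y ycd) fle.
have hsurj : set_surj `[f c, f d] `[h (f c), h (f d)] h.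
  rewrite !hf ?lexx ?(ltW cd)// => y /=; rewrite in_itv/= => ycd.
  exists (f y) => /=; last exact: hf.
  by rewrite in_itv/=; case/andP: ycd => ? ?; rewrite !fle.
have ch := segment_inc_surj_continuous hinc hsurj.
have hcl z : h z = h (cl z).
  have [hz fz] := hP z; have [hz' fz'] := hP (cl z).
  by apply: inj => //; rewrite fz fz' (clid (cl z)).
have ccl : continuous cl.
  move=> z; apply: (@continuous_min _ _ (fun z => Num.max z (f c)) (fun=> f d)); last exact: cst_continuous.
  by apply: (@continuous_max _ _ id (fun=> f c)); [exact: id|exact: cst_continuous].
move=> z; rewrite (_ : h = h \o cl); last by apply/funext => ?; exact: hcl.
move/subspace_continuousP : ch => /(_ (cl z)) ch.
have := ch; rewrite /= in_itv/= clP => /(_ isT) {}ch.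
move=> A /ch hA; have := ccl z _ hA.
rewrite !nbhs_simpl/=; apply: filterS => y /=; apply; rewrite in_itv/=; exact: clP.
Qed.

End derive_combinators.

(** * The inequalities of Bliss and Hardy *)

Section bliss.
Local Open Scope ring_scope.
Variable R : realType.
Implicit Types (f g : R -> R) (x y z a b c s t u e m M T D : R).

Lemma derive_gt0_lt f x y : x < y ->
  (forall z, x <= z <= y -> exists2 d, (x < z < y -> 0 < d) & is_derive z (1 : R) f d) -> f x < f y.
Proof.
move=> xy H.
apply: (@gtr0_derive1_lt_cc _ f x y) => //; rewrite ?in_itv/= ?lexx ?(ltW xy)//.
- move=> z; rewrite in_itv/= => /andP[/ltW xz /ltW zy].
  by have [|d _ []//] := H z; rewrite xz.
- move=> z; rewrite in_itv/= => /andP[xz zy].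
  by have [|d d0 [df dE]] := H z; rewrite ?(ltW xz) ?(ltW zy)// derive1E dE d0// xz.
- apply: continuous_in_subspaceT => z /set_mem/=; rewrite in_itv/= => zxy.
  by have [d d0 df] := H z zxy; exact: is_derive_cont df.
Qed.

(** Starts a monotonicity argument at the excluded endpoint 0: [A] is the value at an interior
    point, and [- h e] a lower bound for the value at [e]. *)
Lemma ge0_of_cvg0 (h : R -> R) (A c : R) : 0 < c -> h x @[x --> 0^'+] --> 0 ->
  (forall e, 0 < e <= c -> - h e <= A) -> 0 <= A.
Proof.
move=> c0 h0 H.
have hN : (fun e => - h e) x @[x --> 0^'+] --> (0 : R).
  by rewrite -[X in _ --> X]oppr0; exact: cvgN.
apply: (@cvgr_to_le _ _ _ _ _ _ _ hN); near=> e; apply: H.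
by apply/andP; split; [near: e; exact: nbhs_right_gt|near: e; exact: nbhs_right_le].
Unshelve. all: by end_near. Qed.

(** Young's inequality with exponents k and k / (k - 1) for w and z^(k-1). The left side is the
    tangent line of the convex function w^k at z. *)
Lemma young_tangent (k z w : R) : 1 < k -> 0 <= z -> 0 <= w ->
  k * z `^ (k - 1) * w - (k - 1) * z `^ k <= w `^ k.
Proof.
move=> k1 z0 w0; have k0 : 0 < k by exact: lt_trans k1.
have k10 : 0 < k - 1 by rewrite subr_gt0.
have := @conjugate_powR _ w (z `^ (k - 1)) k (k / (k - 1)) w0 (powR_ge0 _ _) k0.
rewrite divr_gt0// => /(_ isT).
have -> : k^-1 + (k / (k - 1))^-1 = 1 by field; rewrite !gt_eqF.
move=> /(_ erefl).
rewrite -powRrM (_ : (k - 1) * (k / (k - 1)) = k); last by field; rewrite gt_eqF.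
rewrite -(ler_pM2l k0) => H; rewrite lerBlDr.
have -> : k * z `^ (k - 1) * w = k * (w * z `^ (k - 1)) by ring.
apply: le_trans H _.
by apply: eq_lerW; field; rewrite !gt_eqF.
Qed.

Variable k : R.
Hypothesis k1 : 1 < k.
Let k0 : 0 < k. Proof. exact: lt_trans k1. Qed.
Let km : 0 < k - 1. Proof. by rewrite subr_gt0. Qed.
Let a := (k - 1) / k.
Let a0 : 0 < a. Proof. exact: divr_gt0. Qed.
Let a1 : a < 1. Proof. by rewrite /a ltr_pdivrMr// mul1r gtrBl. Qed.

(* With [lev x = x `^ (- (k - 1)) * G x `^ k], an extremal of Bliss's inequality
   satisfies [theta (x * g x / G x) = (lev x / m) `^ r] for a constant [m].  The two
   inverse branches of [theta] describe it before and after the maximum of [lev];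
   the [k]-th powers of these branches are the derivatives of the Bellman functions
   below. *)
Definition theta (y : R) : R := y `^ (k - 1) * (1 - y).

Lemma derive_theta y : 0 < y ->
  is_derive y (1 : R) theta (y `^ (k - 1 - 1) * (k - 1 - k * y)).
Proof.
move=> y0.
apply: (is_derive_ext (deriveM_fun (derive_powR_fun (k - 1) y0 (derive_id_fun y))
  (deriveB_fun (derive_cst_fun 1 y) (derive_id_fun y)))).
rewrite -(mulr_powRB1 (ltW y0) km); ring.
Qed.

Lemma theta0 : theta 0 = 0.
Proof. by rewrite /theta powR0 ?mul0r// gt_eqF. Qed.

Lemma theta_incr x y : 0 <= x -> x < y -> y <= a -> theta x < theta y.
Proof.
move=> x0 xy ya; have y0 : 0 < y by exact: le_lt_trans xy.
have [xE|xn] := eqVneq x 0.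
  by rewrite xE theta0 mulr_gt0 ?powR_gt0// subr_gt0 (le_lt_trans ya).
have xgt : 0 < x by rewrite lt0r xn.
apply: derive_gt0_lt => // z /andP[xz zy].
have z0 : 0 < z by exact: lt_le_trans xz.
eexists; last exact: derive_theta.
move=> /andP[_ zy']; rewrite mulr_gt0 ?powR_gt0// subr_gt0 mulrC -ltr_pdivlMr//.
exact: lt_le_trans zy' ya.
Qed.

Lemma theta_decr x y : a <= x -> x < y -> y <= 1 -> theta y < theta x.
Proof.
move=> ax xy y1; have x0 : 0 < x by exact: lt_le_trans ax.
rewrite -ltrN2; apply: (@derive_gt0_lt (fun z => - theta z)) => // z /andP[xz zy].
have z0 : 0 < z by exact: lt_le_trans xz.
eexists; last exact: is_deriveN (derive_theta z0).
move=> /andP[xz' _]; rewrite -mulrN mulr_gt0 ?powR_gt0// opprB subr_gt0.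
by rewrite [ltRHS]mulrC -ltr_pdivrMr// (le_lt_trans ax).
Qed.

Lemma theta_le y : 0 <= y <= 1 -> theta y <= theta a.
Proof.
move=> /andP[y0 y1]; have [ya|ay|->//] := ltgtP y a.
  by apply/ltW/theta_incr.
exact/ltW/theta_decr.
Qed.

Lemma continuous_theta_pos y : 0 < y -> {for y, continuous theta}.
Proof. by move=> y0; exact: is_derive_cont (derive_theta y0). Qed.

(** At 0 the power y^(k-1) is not differentiable when k < 2, so the limit at this endpoint is taken
    directly. *)
Lemma continuous_theta_left : {within `[0, a], continuous theta}.
Proof.
apply/continuous_within_itvP => //; split.
- move=> y; rewrite in_itv/= => /andP[y0 _]; exact: continuous_theta_pos.
- rewrite theta0 -[X in _ --> X](mul0r (1 - 0)); apply: cvgM; first exact: powR_cvg0.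
  apply: cvgB; first exact: cvg_cst.
  exact: cvg_at_right_filter.
- apply: cvg_at_left_filter; exact: continuous_theta_pos.
Qed.

Lemma theta_inverse_left : exists Z : R -> R, [/\ continuous Z, {homo Z : x y / x <= y},
  (forall z, 0 <= Z z <= a), (forall z, 0 <= z <= theta a -> theta (Z z) = z) &
  (forall y, 0 <= y <= a -> Z (theta y) = y)].
Proof.
have [Z [cZ hZ bZ tZ Zt]] := continuous_increasing_inverse a0 continuous_theta_left theta_incr.
by exists Z; split => // z zb; apply: tZ; rewrite theta0.
Qed.

Lemma theta_inverse_right : exists Z : R -> R, [/\ continuous Z,
  (forall z, a <= Z z <= 1), (forall z, 0 <= z <= theta a -> theta (Z z) = z) &
  (forall y, a <= y <= 1 -> Z (theta y) = y)].
Proof.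
have c : {within `[a, 1], continuous (fun y => - theta y)}.
  apply: continuous_in_subspaceT => y /set_mem/=; rewrite in_itv/= => /andP[ay _].
  by apply: continuousN; apply: continuous_theta_pos; exact: lt_le_trans ay.
have t1 : theta 1 = 0 by rewrite /theta subrr mulr0.
have [|Z [cZ hZ bZ tZ Zt]] := continuous_increasing_inverse a1 c.
  by move=> x y ax xy y1; rewrite ltrN2 theta_decr.
exists (fun z => Z (- z)); split => //.
- move=> z; apply: (@continuous_comp _ _ _ (fun z => - z) Z); last exact: cZ.
  by apply: continuousN; exact: cvg_id.
- move=> z /andP[z0 zt]; apply: oppr_inj; rewrite tZ// lerN2 zt t1 oppr0.
  by rewrite oppr_le0.
Qed.

Variable l : R.
Hypothesis kl : k < l.
Let r := l / k - 1.
Let r0 : 0 < r. Proof. by rewrite subr_gt0 ltr_pdivlMr// mul1r. Qed.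
Let l0 : 0 < l. Proof. exact: lt_trans kl. Qed.
Let kr : k * r = l - k. Proof. by rewrite /r; field; rewrite gt_eqF. Qed.

Let s0 := theta a `^ r^-1.
Let ta0 : 0 < theta a. Proof. by rewrite mulr_gt0 ?powR_gt0// subr_gt0. Qed.
Let s00 : 0 < s0. Proof. exact: powR_gt0. Qed.

Lemma powRVK (x c : R) : 0 <= x -> c != 0 -> (x `^ c^-1) `^ c = x.
Proof. by move=> x0 c0; rewrite -powRrM mulVf// powRr1. Qed.

Lemma le_powR_nneg (c x y : R) : 0 <= c -> 0 <= x -> x <= y -> x `^ c <= y `^ c.
Proof.
by move=> c0 x0 xy; apply: ge0_ler_powR => //; rewrite nnegrE// (le_trans x0).
Qed.

Lemma level_range s : 0 < s <= s0 -> 0 < s `^ r <= theta a.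
Proof.
move=> /andP[s_gt0 ss0]; rewrite powR_gt0//=.
rewrite -[leRHS](@powRVK _ r) ?gt_eqF ?(ltW ta0)//.
by apply: le_powR_nneg => //; exact: ltW.
Qed.

(** [P] is the primitive from 0 of the k-th power of a branch. The bound 1 on the branch gives P s
    <= s; the last clause is kept for the increasing branch, whose power is largest at the right
    end. *)
Lemma bellman_branch (Z : R -> R) : continuous Z -> (forall z, 0 <= Z z <= 1) ->
  (forall z, 0 <= z <= theta a -> theta (Z z) = z) ->
  exists P : R -> R, [/\
    (forall s, 0 < s <= s0 -> is_derive s (1 : R) P (Z (s `^ r) `^ k)),
    (forall s, 0 < s <= s0 -> 0 <= P s <= s) &
    (forall s M, 0 < s <= s0 -> (forall t, 0 < t < s -> Z (t `^ r) `^ k <= M) -> P s <= M * s)].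
Proof.
(* The argument is frozen beyond [s0], where s^r exceeds the maximum of [theta]; the density is
   thereby continuous on all of (0, oo). *)
move=> cZ bZ tZ; pose w s := Z ((Num.min s s0) `^ r) `^ k.
have mins s : 0 < s -> 0 < Num.min s s0 <= s0.
  by move=> s_gt0; rewrite lt_min s_gt0 s00 ge_min lexx orbT.
have Zpos s : 0 < s -> 0 < Z ((Num.min s s0) `^ r).
  move=> /mins/level_range/andP[h1 h2]; rewrite lt0r; have /andP[-> _] := bZ (Num.min s s0 `^ r).
  rewrite andbT; apply/eqP => Z0.
  have := tZ (Num.min s s0 `^ r); rewrite (ltW h1) h2 Z0 theta0 => /(_ isT) h.
  by rewrite -h ltxx in h1.
have wE s : 0 < s <= s0 -> w s = Z (s `^ r) `^ k.
  by move=> /andP[_ ss0]; rewrite /w min_l.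
have w0 s : 0 <= w s by exact: powR_ge0.
have w1 s : w s <= 1.
  have /andP[z0 z1] := bZ (Num.min s s0 `^ r).
  rewrite /w -[leRHS](_ : 1 `^ k = 1); last by rewrite powR1.
  by apply: le_powR_nneg => //; exact: ltW.
have cw s : 0 < s -> {for s, continuous w}.
  move=> s_gt0; apply: continuous_powR_fun; first exact: Zpos.
  apply: (@continuous_comp _ _ _ (fun s => Num.min s s0 `^ r) Z); last exact: cZ.
  apply: continuous_powR_fun; first by case/andP: (mins _ s_gt0).
  apply: (@continuous_min _ _ id (fun=> s0)); [exact: id|exact: cst_continuous].
have [|P [dP _ P0 PM]] := @primitive_from0 R w cw (fun s _ => w0 s).
  by move=> X; exists 1 => s _; exact: w1.
exists P; split.
- by move=> s sb; rewrite -wE//; apply: dP; case/andP: sb.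
- move=> s /andP[s_gt0 ss0]; rewrite P0//= -[leRHS]mul1r; apply: PM => // y _; exact: w1.
- move=> s M /andP[s_gt0 ss0] H; apply: PM; first exact: s_gt0.
  move=> t /andP[t0 ts].
  by rewrite wE; [apply: H|]; rewrite t0//= (le_trans (ltW ts)).
Qed.


(* The level as a function of [u = x `^ r] on the extremal, where
   [x * g x / G x = (1 + u)^-1]. *)
Let S (u : R) := (u * (1 + u) `^ (- k)) `^ r^-1.
Let us := (k - 1)^-1.

Let theta_inv u : 0 < u -> theta (1 + u)^-1 = u * (1 + u) `^ (- k).
Proof.
move=> u0; have u1 : 0 < 1 + u by rewrite addr_gt0.
rewrite /theta -powR_inv1 ?(ltW u1)// -powRrM mulN1r.
have -> : - k = - (k - 1) + (- 1) by ring.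
rewrite (powRDp _ _ u1).
by rewrite powR_inv1 ?(ltW u1)//; field; rewrite gt_eqF.
Qed.

Let S_gt0 u : 0 < u -> 0 < S u.
Proof. by move=> u0; rewrite powR_gt0// mulr_gt0// powR_gt0// addr_gt0. Qed.

Let S_powr u : 0 < u -> S u `^ r = theta (1 + u)^-1.
Proof.
move=> u0; rewrite theta_inv// /S powRVK ?gt_eqF//.
by rewrite mulr_ge0 ?powR_ge0// ltW.
Qed.

Let inv01 u : 0 < u -> 0 <= (1 + u)^-1 <= 1.
Proof.
move=> u0; have u1 : 0 < 1 + u by rewrite addr_gt0.
by rewrite invr_ge0 (ltW u1) invf_le1// lerDl ltW.
Qed.

Let S_range u : 0 < u -> 0 < S u <= s0.
Proof.
move=> u0; rewrite S_gt0//= /s0 /S -theta_inv//; apply: le_powR_nneg.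
- by rewrite invr_ge0 ltW.
- by rewrite theta_inv// mulr_ge0 ?powR_ge0// ltW.
- exact/theta_le/inv01.
Qed.

Let us0 : 0 < us. Proof. by rewrite invr_gt0. Qed.

Let usE : (1 + us)^-1 = a.
Proof. by rewrite /us /a; field; rewrite !gt_eqF. Qed.

Let S_us : S us = s0.
Proof. by rewrite /S -theta_inv// usE. Qed.

Let S_le u : 0 < u -> S u <= u `^ r^-1.
Proof.
move=> u0; apply: le_powR_nneg; first by rewrite invr_ge0 ltW.
  by rewrite mulr_ge0 ?powR_ge0// ltW.
rewrite -[leRHS]mulr1 ler_pM2l// -[leRHS](powRr0 (1 + u)).
by apply: ler_powR; rewrite ?lerDl ?oppr_le0 ltW.
Qed.

Let S_split u : 0 < u -> (1 + u) `^ (- k - 1) * S u = u `^ r^-1 * (1 + u) `^ (- (l / r + 1)).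
Proof.
move=> u0; have u1 : 0 < 1 + u by rewrite addr_gt0.
rewrite /S powRM ?powR_ge0 ?(ltW u0)// -powRrM mulrCA -(powRDp _ _ u1).
congr (_ * _ `^ _).
have -> : l = k * r + k by rewrite kr subrK.
by field; rewrite gt_eqF.
Qed.

Let derive_S u : 0 < u -> exists d, is_derive u (1 : R) S d.
Proof.
move=> u0; have u1 : 0 < 1 + u by rewrite addr_gt0.
eexists; apply: (derive_powR_fun r^-1 (x := u) (f := fun u => u * (1 + u) `^ (- k))).
  by rewrite mulr_gt0// powR_gt0.
exact: (deriveM_fun (derive_id_fun u) (derive_powR_fun (- k) u1
  (deriveD_fun (derive_cst_fun 1 u) (derive_id_fun u)))).
Qed.

Variable kap : R -> R.
Hypothesis dkap : forall u, 0 < u ->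
  is_derive u (1 : R) kap (k * (u `^ r^-1 * (1 + u) `^ (- (l / r + 1)))).
Hypothesis kap_bound : forall u, 0 < u -> 0 <= kap u <= k * u.

(** Integration by parts along the extremal. As P' at S u equals (1 + u)^(-k), subtracting (1 +
    u)^(-k) S u cancels the terms with S' and leaves k (1 + u)^(-k-1) S u, which is the derivative
    of [kap]. *)
Let derive_gap (P Z : R -> R) u : 0 < u ->
  is_derive (S u) (1 : R) P (Z (S u `^ r) `^ k) -> Z (theta (1 + u)^-1) = (1 + u)^-1 ->
  is_derive u (1 : R) (fun u => P (S u) - (1 + u) `^ (- k) * S u - kap u) 0.
Proof.
move=> u0 dP Zu; have u1 : 0 < 1 + u by rewrite addr_gt0.
have [d dS] := derive_S u0.
rewrite S_powr// Zu -powR_inv1 ?(ltW u1)// -powRrM mulN1r in dP.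
apply: (is_derive_ext (deriveB_fun (deriveB_fun (derive_comp_fun dP dS)
  (deriveM_fun (derive_powR_fun (- k) u1 (deriveD_fun (derive_cst_fun 1 u) (derive_id_fun u))) dS))
  (dkap u0))).
rewrite -S_split//; ring.
Qed.

(** The right branch of the inverse of [theta] describes the extremal for u <= us, the left one for
    u >= us, where [us] is the maximum point of [S]. Constancy of the gap function gives a lower
    bound of [Pp s0] by kap us, from its behaviour at 0, and an upper bound of [Pm s0] by kap us -
    kap u; the common term a^k s0 cancels in the difference. *)
Lemma bellman_pair : exists Yp Ym Pp Pm : R -> R, [/\
  (forall s, 0 < s <= s0 -> [/\ 0 <= Yp s, theta (Yp s) = s `^ r &
     is_derive s (1 : R) Pp (Yp s `^ k)]),
  (forall s, 0 < s <= s0 -> [/\ 0 <= Ym s, theta (Ym s) = s `^ r &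
     is_derive s (1 : R) Pm (Ym s `^ k)]),
  (forall s, 0 < s <= s0 -> Pp s <= s),
  (forall s, 0 < s <= s0 -> 0 <= Pm s) &
  (forall u, 0 < u -> kap u <= Pp s0 - Pm s0)].
Proof.
have [Zp [cZp bZp tZp Zpt]] := theta_inverse_right.
have [Zm [cZm hZm bZm tZm Zmt]] := theta_inverse_left.
have bp z : 0 <= Zp z <= 1.
  by have /andP[h ->] := bZp z; rewrite (le_trans (ltW a0) h).
have bm z : 0 <= Zm z <= 1.
  by have /andP[-> h] := bZm z; rewrite (le_trans h (ltW a1)).
have [Pp [dPp bPp MPp]] := bellman_branch cZp bp tZp.
have [Pm [dPm bPm MPm]] := bellman_branch cZm bm tZm.
exists (fun s => Zp (s `^ r)), (fun s => Zm (s `^ r)), Pp, Pm; split.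
- move=> s sb; split; [by case/andP: (bp (s `^ r))| |exact: dPp].
  by have /andP[h1 h2] := level_range sb; rewrite tZp// (ltW h1).
- move=> s sb; split; [by case/andP: (bm (s `^ r))| |exact: dPm].
  by have /andP[h1 h2] := level_range sb; rewrite tZm// (ltW h1).
- by move=> s /bPp/andP[].
- by move=> s /bPm/andP[].
have akE : (1 + us) `^ (- k) = a `^ k.
  rewrite -usE -[in RHS]powR_inv1; last by rewrite addr_ge0// ltW.
  by rewrite -powRrM mulN1r.
have gapP : 0 <= Pp s0 - a `^ k * s0 - kap us.
  have h0 : (fun u => u `^ r^-1 + k * u) x @[x --> 0^'+] --> (0 : R).
    rewrite -[X in _ --> X](addr0 0); apply: cvgD.
      by apply: powR_cvg0; rewrite invr_gt0.
    rewrite -[X in _ --> X](mulr0 k); apply: cvgM; first exact: cvg_cst.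
    by apply: cvg_at_right_filter; exact: cvg_id.
  apply: (ge0_of_cvg0 us0 h0) => e /andP[e0 eus].
  have E : Pp (S e) - (1 + e) `^ (- k) * S e - kap e = Pp (S us) - (1 + us) `^ (- k) * S us - kap us.
    apply: (derive_eq0_eq (f := fun u => Pp (S u) - (1 + u) `^ (- k) * S u - kap u)) => // z /andP[ez zus].
    have z0 : 0 < z by exact: lt_le_trans ez.
    have z1 : 0 < 1 + z by rewrite addr_gt0.
    apply: (derive_gap z0 (dPp _ (S_range z0))); apply: Zpt.
    case/andP: (inv01 z0) => _ ->; rewrite andbT -usE lef_pV2 ?posrE ?addr_gt0//.
    by rewrite lerD2l.
  rewrite S_us akE in E; rewrite -E.
  have /andP[P0 _] := bPp _ (S_range e0).
  have /andP[_ ke] := kap_bound e0.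
  have e1 : (1 + e) `^ (- k) * S e <= e `^ r^-1.
    rewrite -[leRHS]mul1r; apply: ler_pM; rewrite ?powR_ge0 ?S_le//.
    by rewrite -[leRHS](powRr0 (1 + e)) ler_powR ?lerDl ?oppr_le0 ?(ltW e0) ?ltW.
  lra.
(* The value of [Pm] at S u is not known, but it is at most (1 + u)^(-k) S u, since the left branch
   is monotone and its k-th power at S u is (1 + u)^(-k). *)
have gapM u : us <= u -> Pm s0 - a `^ k * s0 - kap us <= - kap u.
  move=> usu; have u0 : 0 < u by exact: lt_le_trans usu.
  have E : Pm (S us) - (1 + us) `^ (- k) * S us - kap us = Pm (S u) - (1 + u) `^ (- k) * S u - kap u.
    apply: (derive_eq0_eq (f := fun u => Pm (S u) - (1 + u) `^ (- k) * S u - kap u)) => // z /andP[ez zus].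
    have z0 : 0 < z by exact: lt_le_trans ez.
    have z1 : 0 < 1 + z by rewrite addr_gt0.
    apply: (derive_gap z0 (dPm _ (S_range z0))); apply: Zmt.
    case/andP: (inv01 z0) => -> _ /=; rewrite -usE lef_pV2 ?posrE ?addr_gt0//.
    by rewrite lerD2l.
  rewrite S_us akE in E; rewrite E -[leRHS]add0r lerD2r subr_le0.
  apply: MPm; first exact: S_range.
  move=> t /andP[t0 tS].
  have -> : (1 + u) `^ (- k) = (Zm (S u `^ r)) `^ k.
    rewrite S_powr// Zmt; last first.
      case/andP: (inv01 u0) => -> _ /=; rewrite -usE lef_pV2 ?posrE ?addr_gt0//.
      by rewrite lerD2l.
    by rewrite -powR_inv1 ?addr_ge0 ?(ltW u0)// -powRrM mulN1r.
  apply: le_powR_nneg; [exact: ltW|by case/andP: (bm (t `^ r))|].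
  by apply: hZm; apply: le_powR_nneg; exact: ltW.
move=> u u0; have [uus|uus] := leP us u.
  by have := gapM _ uus; lra.
have kapu : kap u <= kap us.
  apply: (derive_ge0_le (ltW uus)) => z /andP[uz zus].
  have z0 : 0 < z by exact: lt_le_trans uz.
  eexists; last exact: dkap.
  by rewrite !mulr_ge0 ?powR_ge0// ltW.
have := gapM _ (lexx us); lra.
Qed.


Variables g G U W : R -> R.
Hypothesis g0 : forall x, 0 < x -> 0 <= g x.
Hypothesis G0 : forall x, 0 < x -> 0 < G x.
Hypothesis dG : forall x, 0 < x -> is_derive x (1 : R) G (g x).
Hypothesis dU : forall x, 0 < x -> is_derive x (1 : R) U (g x `^ k).
Hypothesis dW : forall x, 0 < x ->
  is_derive x (1 : R) W (x `^ (- ((k - 1) * l / k)) * (l * G x `^ (l - 1) * g x)).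
Hypothesis U0 : forall x, 0 < x -> 0 <= U x.
Hypothesis W0 : W x @[x --> 0^'+] --> 0.
Let lev (x : R) := x `^ (- (k - 1)) * G x `^ k.
Hypothesis lev_cvg0 : lev x @[x --> 0^'+] --> 0.

Let lev_gt0 x : 0 < x -> 0 < lev x.
Proof. by move=> x0; rewrite mulr_gt0 ?powR_gt0 ?G0. Qed.

(** Since [lev] is positive and vanishes at 0, its values on some (0, e] lie below [lev T], and
    compactness of [e, T] suffices. *)
Let lev_max T : 0 < T -> exists2 x0, 0 < x0 <= T & forall x, 0 < x <= T -> lev x <= lev x0.
Proof.
move=> T0.
have levc x : 0 < x -> {for x, continuous lev}.
  move=> x0; apply: is_derive_cont.
  exact: (deriveM_fun (derive_powR_fun (- (k - 1)) x0 (derive_id_fun x))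
     (derive_powR_fun k (G0 x0) (dG x0))).
have [e /andP[e0 eT] He] : exists2 e, 0 < e <= T & forall x, 0 < x <= e -> lev x < lev T.
  have : \forall x \near 0^'+, lev x < lev T by apply: (cvgr_lt _ lev_cvg0); exact: lev_gt0.
  case=> e /= e0 He; exists (Num.min (e / 2) T).
    by rewrite lt_min divr_gt0// T0 ge_min lexx orbT.
  move=> x /andP[x0]; rewrite le_min => /andP[xe _]; apply: He => //=.
  rewrite sub0r normrN gtr0_norm// (le_lt_trans xe)// ltr_pdivrMr// ltr_pMr//.
  by rewrite ltr1n.
have [|x0] := @EVT_max R lev e T eT.
  apply: continuous_in_subspaceT => x /set_mem/=; rewrite in_itv/= => /andP[ex _].
  by apply: levc; exact: lt_le_trans ex.
rewrite in_itv/= => /andP[ex0 x0T] Hx0; exists x0; first by rewrite (lt_le_trans e0 ex0).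
move=> x /andP[x_gt0 xT]; have [xe|ex] := leP x e; last by apply: Hx0; rewrite in_itv/= (ltW ex).
apply: (@le_trans _ _ (lev T)); first by apply/ltW/He; rewrite x_gt0.
by apply: Hx0; rewrite in_itv/= eT lexx.
Qed.

Let energy (P : R -> R) m x := U x - k / l * m `^ (- r) * W x - m * P (lev x / m).

(* The tangent line of [z ^ k] at [y * G / x]. *)
Let derive_energy (P : R -> R) m x y : 0 < m -> 0 < x -> 0 <= y ->
  theta y = (lev x / m) `^ r -> is_derive (lev x / m) (1 : R) P (y `^ k) ->
  exists2 d, 0 <= d & is_derive x (1 : R) (energy P m) d.
Proof.
move=> m0 x0 y0 ty dP; have Gx := G0 x0; have gx := g0 x0.
have dlev : is_derive x (1 : R) (fun x => lev x / m) (m^-1 *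
    (- (k - 1) * x `^ (- (k - 1) - 1) * 1 * G x `^ k +
     x `^ (- (k - 1)) * (k * G x `^ (k - 1) * g x))).
  have := deriveZ_fun m^-1 (deriveM_fun (derive_powR_fun (- (k - 1)) x0 (derive_id_fun x))
     (derive_powR_fun k Gx (dG x0))).
  by under eq_fun do rewrite mulrC.
have dE := deriveB_fun (deriveB_fun (dU x0) (deriveZ_fun (k / l * m `^ (- r)) (dW x0)))
  (deriveZ_fun m (derive_comp_fun (g := fun x => lev x / m) dP dlev)).
eexists; last exact: dE.
set t := x `^ (- (k - 1)) * G x `^ (k - 1) * g x.
have E1 : k / l * m `^ (- r) * (x `^ (- ((k - 1) * l / k)) * (l * G x `^ (l - 1) * g x)) =
    k * theta y * t.
  rewrite ty powRM ?invr_ge0 ?(ltW m0) ?(ltW (lev_gt0 x0))//.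
  rewrite -[in RHS](powR_inv1 (ltW m0)) -[in RHS]powRrM mulN1r.
  rewrite /lev powRM ?powR_ge0// -!powRrM kr.
  have -> : x `^ (- ((k - 1) * l / k)) = x `^ (- (k - 1) * r) * x `^ (- (k - 1)).
    rewrite -(powRDp _ _ x0).
    by congr (_ `^ _); rewrite /r; field; rewrite gt_eqF.
  have -> : G x `^ (l - 1) = G x `^ (l - k) * G x `^ (k - 1).
    rewrite -(powRDp _ _ Gx).
    by congr (_ `^ _); ring.
  rewrite /t; field; rewrite gt_eqF//.
have yk : y `^ k = y * y `^ (k - 1) by rewrite mulr_powRB1.
have xk : x `^ (- (k - 1) - 1) = x `^ (- k) by congr (_ `^ _); ring.
have z0 : 0 <= y * G x / x by rewrite !mulr_ge0 ?invr_ge0// ltW.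
have := young_tangent k1 z0 gx.
have -> : (y * G x / x) `^ (k - 1) = y `^ (k - 1) * (x `^ (- (k - 1)) * G x `^ (k - 1)).
  rewrite !powRM ?mulr_ge0 ?invr_ge0 ?(ltW x0) ?(ltW Gx)//.
  rewrite -[x^-1](powR_inv1 (ltW x0)) -[in LHS]powRrM mulN1r; ring.
have -> : (y * G x / x) `^ k = y `^ k * (x `^ (- k) * G x `^ k).
  rewrite !powRM ?mulr_ge0 ?invr_ge0 ?(ltW x0) ?(ltW Gx)//.
  rewrite -[x^-1](powR_inv1 (ltW x0)) -[in LHS]powRrM mulN1r; ring.
rewrite -subr_ge0 => /le_trans; apply.
rewrite E1 xk /theta le_eqVlt; apply/orP; left; apply/eqP.
rewrite yk /t; field; exact: lt0r_neq0.
Qed.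

(** The energy is taken with [Pp] on (0, x0] and with [Pm] on [x0, T], where [x0] maximises [lev].
    It is nonnegative near 0 up to a vanishing error, nondecreasing on both pieces, and jumps at
    [x0] by m (Pp s0 - Pm s0) >= m c. *)
Lemma bliss_energy T c : 0 < T -> (forall u, 0 < u -> exists2 v, 0 < v & c - u <= kap v) ->
  exists2 m, 0 < m & k / l * m `^ (- r) * W T + m * c <= U T.
Proof.
move=> T0 Hc; have [Yp [Ym [Pp [Pm [HYp HYm bPp bPm gap]]]]] := bellman_pair.
have [x0 /andP[x00 x0T] Hx0] := lev_max T0.
(* With this scaling lev / m stays in (0, s0], the common domain of the branches, and equals [s0] at
   [x0], where [theta] is at its maximum and the branches may be exchanged. *)
pose m := lev x0 / s0.
have m0 : 0 < m by rewrite divr_gt0 ?lev_gt0.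
have lev_range x : 0 < x <= T -> 0 < lev x / m <= s0.
  move=> xT; rewrite divr_gt0//; last by apply: lev_gt0; case/andP: xT.
  rewrite ler_pdivrMr// /m mulrC divfK ?gt_eqF//=; exact: Hx0.
have levx0 : lev x0 / m = s0.
  by rewrite /m; field; rewrite !gt_eqF ?lev_gt0.
have Ep : 0 <= energy Pp m x0.
  have h0 : (fun x => k / l * m `^ (- r) * W x + lev x) x @[x --> 0^'+] --> (0 : R).
    rewrite -[X in _ --> X](addr0 0); apply: cvgD => //.
    by rewrite -[X in _ --> X](mulr0 (k / l * m `^ (- r))); apply: cvgM => //; exact: cvg_cst.
  apply: (ge0_of_cvg0 x00 h0) => e /andP[e0 ex0].
  apply: (@le_trans _ _ (energy Pp m e)).
    rewrite /energy; have := U0 e0.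
    have : m * Pp (lev e / m) <= lev e.
      rewrite mulrC -ler_pdivlMr//; apply: bPp; apply: lev_range.
      by rewrite e0 (le_trans ex0).
    lra.
  apply: derive_ge0_le => // z /andP[ez zx0].
  have z0 : 0 < z by exact: lt_le_trans ez.
  have [|Y0 tY dP] := HYp (lev z / m); first by apply: lev_range; rewrite z0 (le_trans zx0).
  exact: derive_energy Y0 tY dP.
have Em : energy Pm m x0 <= energy Pm m T.
  apply: derive_ge0_le => // z /andP[ez zT].
  have z0 : 0 < z by exact: lt_le_trans ez.
  have [|Y0 tY dP] := HYm (lev z / m); first by apply: lev_range; rewrite z0.
  exact: derive_energy Y0 tY dP.
exists m => //.
have cgap : c <= Pp s0 - Pm s0.
  apply/ler_addgt0Pr => e e0; have [v v0 cv] := Hc e e0.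
  have := gap v v0; lra.
have PmT : 0 <= m * Pm (lev T / m).
  by rewrite mulr_ge0 ?(ltW m0)// bPm// lev_range// T0/=.
have : m * c <= m * Pp s0 - m * Pm s0 by rewrite -mulrBr ler_pM2l.
rewrite /energy levx0 in Ep Em; move: Ep Em PmT; lra.
Qed.

(** Young's inequality with exponents l / k and 1 / (1 - k / l) bounds the product by the energy sum
    (k / l) m^(-r) W T + m c, for c = (1 - k / l) D. The powers of the unknown [m] cancel because r
    k / l = 1 - k / l. *)
Lemma bliss_inequality T D : 0 < T -> 0 <= D -> 0 <= W T ->
  (forall u, 0 < u -> exists2 v, 0 < v & (1 - k / l) * D - u <= kap v) ->
  W T `^ (k / l) * D `^ (1 - k / l) <= U T.
Proof.
move=> T0 D0 WT HD; have [m m0] := bliss_energy T0 HD.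
apply: le_trans.
have kl1 : 0 < k / l by rewrite divr_gt0.
have lk1 : 0 < 1 - k / l by rewrite subr_gt0 ltr_pdivrMr// mul1r.
have lk2 : 0 < l - k by rewrite subr_gt0.
have := @conjugate_powR _ ((m `^ (- r) * W T) `^ (k / l)) ((m * D) `^ (1 - k / l)) (l / k) (1 - k / l)^-1.
rewrite !powR_ge0 divr_gt0// invr_gt0 lk1 => /(_ isT isT isT isT).
have -> : (l / k)^-1 + (1 - k / l)^-1^-1 = 1 by rewrite invrK invf_div addrC subrK.
move=> /(_ erefl).
rewrite -!powRrM mulfV ?gt_eqF// powRr1 ?mulr_ge0 ?powR_ge0 ?(ltW m0)//.
have -> : k / l * (l / k) = 1 by field; rewrite !gt_eqF.
rewrite powRr1 ?mulr_ge0 ?powR_ge0//.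
rewrite !powRM ?powR_ge0 ?(ltW m0)// -powRrM invf_div invrK => H.
apply: le_trans (le_trans H _); last by apply: eq_lerW; ring.
have -> : m `^ (- r * (k / l)) * W T `^ (k / l) * (m `^ (1 - k / l) * D `^ (1 - k / l)) =
  m `^ (- r * (k / l)) * m `^ (1 - k / l) * (W T `^ (k / l) * D `^ (1 - k / l)) by ring.
rewrite -(powRDp _ _ m0).
have -> : - r * (k / l) + (1 - k / l) = 0 by rewrite /r; field; rewrite !gt_eqF.
by rewrite powRr0 mul1r.
Qed.

End bliss.

(** * Gamma and beta integrals *)

Section gamma.
Local Open Scope ring_scope.
Variable R : realType.
Implicit Types (x t s a b c T : R).

Lemma ge0_integralZl_halfline c (f : R -> R) : 0 <= c ->
  measurable_fun (pos R) f -> (forall x, 0 < x -> 0 <= f x) ->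
  (\int[mu]_(x in `]0%R, +oo[) (c * f x)%:E = c%:E * \int[mu]_(x in `]0%R, +oo[) (f x)%:E)%E.
Proof.
move=> c0 mf f0; rewrite -ge0_integralZl//; first exact/measurable_EFinP.
by move=> x; rewrite /= in_itv/= andbT lee_fin; exact: f0.
Qed.

(** The inequality ln z <= z - 1 at z = x / (2 s) yields the constant C = (2 s)^s. *)
Lemma powR_expR_bound s : 0 < s -> exists2 C, 0 < C & forall x, 0 < x ->
  x `^ s * expR (- x) <= C * expR (- (x / 2)).
Proof.
move=> s0; have s20 : 0 < 2 * s by rewrite mulr_gt0.
exists (expR (s * ln (2 * s))); first exact: expR_gt0.
move=> x x0; rewrite /powR gt_eqF// -!expRD ler_expR.
have h : ln (x / (2 * s)) <= x / (2 * s) - 1.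
  by have := @le_ln1Dx R (x / (2 * s) - 1); rewrite (_ : 1 + (x / (2 * s) - 1) = x / (2 * s)); [apply; rewrite ltrBrDl subrr divr_gt0|ring].
have : s * ln x <= x / 2 + s * ln (2 * s); last by lra.
have -> : ln x = ln (x / (2 * s)) + ln (2 * s).
  by rewrite -lnM ?posrE ?divr_gt0// divfK// gt_eqF.
rewrite mulrDr lerD2r; apply: (@le_trans _ _ (s * (x / (2 * s)))).
  by rewrite ler_pM2l//; apply: le_trans h _; rewrite gerBl.
by apply: eq_lerW; field; rewrite gt_eqF.
Qed.

Let igd s t := t `^ (s - 1) * expR (- t).

Let igd_cont s t : 0 < t -> {for t, continuous (igd s)}.
Proof.
move=> t0; apply: (@continuousM _ _ (fun t => t `^ (s - 1)) (fun t => expR (- t))).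
  exact: continuous_powR_fun.
apply: (@continuous_comp _ _ _ (fun t => - t) expR); first by apply: continuousN; exact: cvg_id.
exact: continuous_expR.
Qed.

Let igd_ge0 s t : 0 <= igd s t.
Proof. by rewrite mulr_ge0 ?powR_ge0 ?expR_ge0. Qed.

Let igd_bounded s : 1 < s -> forall X, exists M, forall x, 0 < x <= X -> igd s x <= M.
Proof.
move=> s1 X; have [|C C0 HC] := @powR_expR_bound (s - 1); first by rewrite subr_gt0.
exists C => x /andP[x0 _]; apply: le_trans (HC _ x0) _.
rewrite -[leRHS]mulr1 ler_pM2l// -expR0 ler_expR oppr_le0 divr_ge0// ltW//.
Qed.

Definition gamma_int s := (\int[mu]_(t in `]0%R, +oo[) (igd s t)%:E)%E.

Lemma measurable_gamma s : measurable_fun (pos R) (EFin \o igd s).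
Proof. by apply/measurable_EFinP; apply: continuous_positive_itv => x x0; exact: igd_cont. Qed.

Lemma gamma_int_ge0 s : (0 <= gamma_int s)%E.
Proof. by apply: integral_ge0 => t _; rewrite lee_fin. Qed.

(** The primitive from 0 is compared with - 2 C exp(- x / 2), a primitive of the dominating
    function, and so stays below 2 C. For s > 1 the integrand is bounded near 0; the Gamma arguments
    in [K_const] for p < q all satisfy this. *)
Lemma gamma_int_lty s : 1 < s -> (gamma_int s < +oo)%E.
Proof.
move=> s1; have [|C C0 HC] := @powR_expR_bound (s - 1); first by rewrite subr_gt0.
have [F [dF FE F0 PM]] := @primitive_from0 R (igd s) (fun x => @igd_cont s x) (fun x _ => igd_ge0 s x) (igd_bounded s1).
apply: (@le_lt_trans _ _ (2 * C)%:E); last exact: ltry.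
have c := integral_itv0y_cvg (measurable_gamma s) (fun x _ => igd_ge0 s x).
rewrite /gamma_int -(cvg_lim _ c)//; apply: lime_le; first exact: cvgP c.
near=> n; have n0 : 0 < n%:R :> R by rewrite ltr0n; near: n; exact: nbhs_infty_gt.
rewrite (FE _ n0) lee_fin.
have de x : is_derive x (1 : R) (fun x => expR (- (2^-1 * x))) (expR (- (2^-1 * x)) * - (2^-1 * 1)).
  exact: (derive_comp_fun (is_derive_expR _) (deriveN_fun (deriveZ_fun 2^-1 (derive_id_fun x)))).
pose h x := - (2 * C) * expR (- (2^-1 * x)) - F x.
have hle : forall e, 0 < e <= n%:R -> h e <= h n%:R.
  move=> e /andP[e0 en]; apply: derive_ge0_le => // z /andP[ez _].
  have z0 : 0 < z by exact: lt_le_trans ez.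
  eexists; last exact: (deriveB_fun (deriveZ_fun (- (2 * C)) (de z)) (dF _ z0)).
  have := HC z z0; rewrite /igd (mulrC z); lra.
have [M HM] := igd_bounded s1 n%:R.
have hM : (fun e => M * e) x @[x --> 0^'+] --> (0 : R).
  rewrite -[X in _ --> X](mulr0 M); apply: cvgM; first exact: cvg_cst.
  by apply: cvg_at_right_filter; exact: cvg_id.
have hn : 0 <= h n%:R + 2 * C.
  apply: (ge0_of_cvg0 n0 hM) => e /andP[e0 en].
  have := hle e; rewrite e0 en => /(_ isT).
  have : F e <= M * e.
    by apply: PM => // y /andP[y0 ye]; apply: HM; rewrite y0 (le_trans (ltW ye)).
  have : expR (- (2^-1 * e)) <= 1.
    by rewrite -expR0 ler_expR oppr_le0 mulr_ge0 ?invr_ge0// ltW.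
  by rewrite -(ler_pM2l (mulr_gt0 (ltr0Sn R 1) C0)) /h; lra.
have : 0 <= 2 * C * expR (- (2^-1 * n%:R)) by rewrite !mulr_ge0 ?expR_ge0// ltW.
move: hn; rewrite /h; lra.
Unshelve. all: by end_near. Qed.

Lemma GammaE s : 1 < s -> gamma_int s = (Gamma s)%:E.
Proof. by move=> s1; rewrite /Gamma /Rintegral fineK// ge0_fin_numE ?gamma_int_ge0// gamma_int_lty. Qed.

Lemma Gamma_gt0 s : 1 < s -> 0 < Gamma s.
Proof.
move=> s1; have [F [dF FE F0 _]] := @primitive_from0 R (igd s) (fun x => @igd_cont s x) (fun x _ => igd_ge0 s x) (igd_bounded s1).
apply: (@lt_le_trans _ _ (F 2)).
  apply: (le_lt_trans (F0 1 ltr01)); apply: derive_gt0_lt; first by rewrite ltr1n.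
  move=> z /andP[z1 _]; have z0 : 0 < z by exact: lt_le_trans z1.
  by exists (igd s z); [rewrite mulr_gt0 ?powR_gt0 ?expR_gt0|exact: dF].
rewrite -lee_fin -GammaE// -FE//; apply: ge0_subset_integral => //.
- exact: measurable_gamma.
- by move=> x _; rewrite lee_fin.
- by move=> x /=; rewrite !in_itv/= => /andP[->].
Qed.

Lemma gamma_int_scale s c : 1 < s -> 0 < c ->
  (\int[mu]_(t in `]0%R, +oo[) (t `^ (s - 1) * expR (- (c * t)))%:E)%E = (c `^ (- s) * Gamma s)%:E.
Proof.
move=> s1 c0; rewrite EFinM -GammaE//.
have := ge0_integral_scale c0 (measurable_gamma s) (fun x _ => igd_ge0 s x).
rewrite -/(gamma_int s) => H.
have -> : c `^ (- s) = c `^ (- (s - 1)) * c^-1.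
  by rewrite -[c^-1]powR_inv1 ?(ltW c0)// -powRD ?(gt_eqF c0) ?implybT//; congr (_ `^ _); ring.
rewrite EFinM -muleA -H -ge0_integralZl_halfline ?powR_ge0//.
- apply: eq_integral => t; rewrite inE/= in_itv/= andbT => t0.
  rewrite /igd powRM ?(ltW c0) ?(ltW t0)// powRN.
  by rewrite !mulrA mulVf ?mul1r// gt_eqF// powR_gt0.
- apply: continuous_positive_itv => x x0.
  apply: (@continuous_comp _ _ _ (fun x => c * x) (igd s)); last by apply: igd_cont; rewrite mulr_gt0.
  exact: is_derive_cont (deriveZ_fun c (derive_id_fun x)).
Qed.

Lemma Gamma_rec s : 1 < s -> Gamma (s + 1) = s * Gamma s.
Proof.
move=> s1; have s0 : 0 < s by exact: lt_trans s1.
have s11 : 1 < s + 1 by rewrite ltrDr.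
have [F [dF FE F0 FM]] := @primitive_from0 R (igd s) (fun x => @igd_cont s x) (fun x _ => igd_ge0 s x) (igd_bounded s1).
have [H [dH HE H0 HM]] := @primitive_from0 R (igd (s + 1)) (fun x => @igd_cont (s + 1) x) (fun x _ => igd_ge0 (s + 1) x) (igd_bounded s11).
have de x : is_derive x (1 : R) (fun x => expR (- x)) (expR (- x) * - 1).
  exact: (derive_comp_fun (is_derive_expR _) (deriveN_fun (derive_id_fun x))).
(* Integration by parts in differential form: [h] has derivative 0 and tends to 0 at 0, so it
   vanishes. *)
pose h x := s * F x - H x - x `^ s * expR (- x).
have hcst x y : 0 < x -> x <= y -> h x = h y.
  move=> x0 xy; apply: derive_eq0_eq => // z /andP[xz _].
  have z0 : 0 < z by exact: lt_le_trans xz.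
  apply: (is_derive_ext (deriveB_fun (deriveB_fun (deriveZ_fun s (dF _ z0)) (dH _ z0))
    (deriveM_fun (derive_powR_fun s z0 (derive_id_fun z)) (de z)))).
  rewrite /igd addrK; ring.
have h0 x : 0 < x -> h x = 0.
  move=> x0; have [M1 HM1] := igd_bounded s1 x; have [M2 HM2] := igd_bounded s11 x.
  have l1 : (fun e => M2 * e + e `^ s) x @[x --> 0^'+] --> (0 : R).
    rewrite -[X in _ --> X](addr0 0); apply: cvgD; last exact: powR_cvg0.
    rewrite -[X in _ --> X](mulr0 M2); apply: cvgM; first exact: cvg_cst.
    by apply: cvg_at_right_filter; exact: cvg_id.
  have l2 : (fun e => s * M1 * e) x @[x --> 0^'+] --> (0 : R).
    rewrite -[X in _ --> X](mulr0 (s * M1)); apply: cvgM; first exact: cvg_cst.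
    by apply: cvg_at_right_filter; exact: cvg_id.
  have b e : 0 < e <= x -> [/\ 0 <= F e, F e <= M1 * e, 0 <= H e & H e <= M2 * e].
    move=> /andP[e0 ex]; split; rewrite ?F0 ?H0//.
      by apply: FM => // y /andP[y0 ye]; apply: HM1; rewrite y0 (le_trans (ltW ye)).
    by apply: HM => // y /andP[y0 ye]; apply: HM2; rewrite y0 (le_trans (ltW ye)).
  apply/eqP; rewrite eq_le; apply/andP; split.
    rewrite -oppr_ge0; apply: (ge0_of_cvg0 x0 l2) => e /[dup]ex /andP[e0 ex'].
    rewrite -(hcst e x)//; have [F1 F2 H1 H2] := b e ex.
    have : 0 <= e `^ s * expR (- e) by rewrite mulr_ge0 ?powR_ge0 ?expR_ge0.
    have : s * F e <= s * (M1 * e) by rewrite ler_pM2l.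
    rewrite /h mulrA; lra.
  apply: (ge0_of_cvg0 x0 l1) => e /[dup]ex /andP[e0 ex'].
  rewrite -(hcst e x)//; have [F1 F2 H1 H2] := b e ex.
  have : e `^ s * expR (- e) <= e `^ s.
    by rewrite ger_pMr ?powR_gt0// -expR0 ler_expR oppr_le0 ltW.
  have : 0 <= s * F e by rewrite mulr_ge0// ltW.
  rewrite /h; lra.
have Hn n : (0 < n)%N -> (H n%:R)%:E = ((s * F n%:R)%:E - (n%:R `^ s * expR (- n%:R))%:E)%E.
  move=> n0; rewrite -EFinB; congr EFin; have := h0 n%:R; rewrite ltr0n n0 => /(_ isT).
  rewrite /h; lra.
have cF := integral_itv0y_cvg (measurable_gamma s) (fun x _ => igd_ge0 s x).
have cH := integral_itv0y_cvg (measurable_gamma (s + 1)) (fun x _ => igd_ge0 (s + 1) x).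
rewrite -/(gamma_int _) GammaE// in cF; rewrite -/(gamma_int _) GammaE// in cH.
have ce : n%:R `^ s * expR (- n%:R) @[n --> \oo] --> (0 : R).
  have [C C0 HC] := powR_expR_bound s0.
  have c2 : C * expR (- (n%:R / 2)) @[n --> \oo] --> (0 : R).
    rewrite -[X in _ --> X](mulr0 C); apply: cvgM; first exact: cvg_cst.
    apply: (@cvg_comp _ _ _ (fun n : nat => n%:R : R) (fun x => expR (- (x / 2))) _ +oo); first exact: cvgr_idn.
    apply: (@cvg_comp _ _ _ (fun x => x / 2) (fun x => expR (- x)) _ +oo); last exact: cvgr_expR.
    by apply: gt0_cvgMly; [rewrite invr_gt0|exact: cvg_id].
  apply: (squeeze_cvgr _ (cvg_cst 0) c2); near=> n.
  have n0 : 0 < n%:R :> R by rewrite ltr0n; near: n; exact: nbhs_infty_gt.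
  by rewrite mulr_ge0 ?powR_ge0 ?expR_ge0//= HC.
apply: EFin_inj; rewrite -(cvg_lim _ cH)//; apply: cvg_lim => //.
have : (s%:E * (\int[mu]_(t in `]0%R, n%:R[) (igd s t)%:E) - (n%:R `^ s * expR (- n%:R))%:E)%E @[n --> \oo]
   --> (s%:E * (Gamma s)%:E - 0%:E)%E.
  have c1 := cvgeZl (isT : s%:E \is a fin_num) cF.
  apply: (cvgeB _ c1); first by [].
  by apply: cvg_EFin; [near=> n|exact: ce].
rewrite sube0 -EFinM; apply: cvg_trans; apply: near_eq_cvg; near=> n.
have n0 : (0 < n)%N by near: n; exact: nbhs_infty_gt.
by rewrite FE ?ltr0n// HE ?ltr0n// Hn// EFinM.
Unshelve. all: by end_near. Qed.

(** Euler's beta function B(a, b), brought to the half-line by the substitution u / (1 + u). *)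
Definition beta_int a b := (\int[mu]_(u in `]0%R, +oo[) (u `^ (a - 1) * (1 + u) `^ (- (a + b)))%:E)%E.

Let expR_powR_meas c s : measurable_fun (pos R) (fun t => t `^ s * expR (- (c * t))).
Proof.
apply: continuous_positive_itv => t t0.
apply: (@continuousM _ _ (fun t => t `^ s) (fun t => expR (- (c * t)))).
  exact: continuous_powR_fun.
apply: (@continuous_comp _ _ _ (fun t => - (c * t)) expR); last exact: continuous_expR.
by apply: continuousN; exact: is_derive_cont (deriveZ_fun _ (derive_id_fun t)).
Qed.

Let integral_half2 (h : R * R -> R) u : 0 < u ->
  (\int[mu]_t (h (u, t) * \1_(`]0, +oo[ `*` `]0, +oo[) (u, t))%:E =
   \int[mu]_(t in `]0%R, +oo[) (h (u, t))%:E)%E.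
Proof.
move=> u0; rewrite [RHS]integral_mkcond; apply: eq_integral => t _; rewrite patchE indicE.
have -> : ((u, t) \in `]0, +oo[ `*` `]0, +oo[) = (t \in `]0, +oo[%classic).
  apply/idP/idP => /set_mem; first by case=> _ /= /mem_set.
  by move=> tI; apply/mem_set; split => //=; rewrite in_itv/= u0.
by case: ifP => _; rewrite ?mulr1 ?mulr0.
Qed.

Let integral_half1 (h : R * R -> R) t : 0 < t ->
  (\int[mu]_u (h (u, t) * \1_(`]0, +oo[ `*` `]0, +oo[) (u, t))%:E =
   \int[mu]_(u in `]0%R, +oo[) (h (u, t))%:E)%E.
Proof.
move=> t0; rewrite [RHS]integral_mkcond; apply: eq_integral => u _; rewrite patchE indicE.
have -> : ((u, t) \in `]0, +oo[ `*` `]0, +oo[) = (u \in `]0, +oo[%classic).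
  apply/idP/idP => /set_mem; first by case=> /= /mem_set.
  by move=> tI; apply/mem_set; split => //=; rewrite in_itv/= t0.
by case: ifP => _; rewrite ?mulr1 ?mulr0.
Qed.

Lemma tonelli_halfline (h : R * R -> R) : measurable_fun setT h -> (forall z, 0 <= h z) ->
  (\int[mu]_(u in `]0%R, +oo[) \int[mu]_(t in `]0%R, +oo[) (h (u, t))%:E =
   \int[mu]_(t in `]0%R, +oo[) \int[mu]_(u in `]0%R, +oo[) (h (u, t))%:E)%E.
Proof.
move=> mh h0.
have mF : measurable_fun setT (fun z : R * R => (h z * \1_(`]0, +oo[ `*` `]0, +oo[) z)%:E).
  apply/measurable_EFinP; apply: measurable_funM => //; apply: measurable_indic.
  by apply: measurableX; exact: measurable_itv.
have F0 z : (0 <= (h z * \1_(`]0, +oo[ `*` `]0, +oo[) z)%:E)%E by rewrite lee_fin mulr_ge0.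
have := @fubini_tonelli _ _ _ _ _ mu mu _ mF F0; rewrite /=.
set L := (X in X = _ -> _); set L' := (X in _ = X -> _).
suff [-> ->] : L = (\int[mu]_(u in `]0%R, +oo[) \int[mu]_(t in `]0%R, +oo[) (h (u, t))%:E)%E /\
  L' = (\int[mu]_(t in `]0%R, +oo[) \int[mu]_(u in `]0%R, +oo[) (h (u, t))%:E)%E by [].
split.
  rewrite [RHS]integral_mkcond; apply: eq_integral => u _; rewrite patchE; case: ifPn => uI.
    by apply: integral_half2; move: uI; rewrite inE/= in_itv/= andbT.
  apply: integral0_eq => t _; rewrite indicE memNset ?mulr0//.
  by move=> [uI' _]; move/negP: uI; apply; exact/mem_set.
rewrite [RHS]integral_mkcond; apply: eq_integral => t _; rewrite patchE; case: ifPn => tI.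
  by apply: integral_half1; move: tI; rewrite inE/= in_itv/= andbT.
apply: integral0_eq => u _; rewrite indicE memNset ?mulr0//.
by move=> [_ tI']; move/negP: tI; apply; exact/mem_set.
Qed.

(** The product Gamma(a + b) (1 + u)^(-(a+b)) is the integral of t^(a+b-1) exp(-(1 + u) t) over t.
    After exchanging the integrals, the one over u is t^(-a) Gamma(a), and the one over t becomes
    Gamma(b). Finiteness of the beta integral is read off from the product. *)
Lemma Gamma_beta a b : 1 < a -> 1 < b ->
  beta_int a b = (Gamma a * Gamma b / Gamma (a + b))%:E.
Proof.
move=> a1 b1; have ab : 1 < a + b by rewrite (lt_trans a1)// ltrDl (lt_trans ltr01).
have mI : measurable (`]0%R, +oo[ : set R) by exact: measurable_itv.
have Gab := Gamma_gt0 ab.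
suff : ((Gamma (a + b))%:E * beta_int a b = (Gamma a * Gamma b)%:E)%E.
  have : (0 <= beta_int a b)%E.
    by apply: integral_ge0 => u _; rewrite lee_fin mulr_ge0 ?powR_ge0.
  case: (beta_int a b) => [B| |]//= B0.
    rewrite -EFinM => -[<-]; congr EFin; rewrite mulrAC mulfV ?mul1r//.
    by rewrite gt_eqF.
  by rewrite gt0_muley ?lte_fin.
have alg c t : 0 < t ->
    t `^ (a + b - 1) * expR (- t) * (t `^ (- a) * c) = c * igd b t.
  move=> t0; have E : t `^ (b - 1) = t `^ (a + b - 1) * t `^ (- a).
    rewrite -(powRDp _ _ t0).
    by congr (_ `^ _); ring.
  by rewrite /igd E; ring.
pose h (z : R * R) : R := z.1 `^ (a - 1) * (z.2 `^ (a + b - 1) * expR (- ((1 + z.1) * z.2))).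
have mh : measurable_fun setT h.
  apply: measurable_funM; first exact: (measurableT_comp (measurable_powR (a - 1)) measurable_fst).
  apply: measurable_funM; first exact: (measurableT_comp (measurable_powR (a + b - 1)) measurable_snd).
  apply: (measurableT_comp (@measurable_expR R)); apply: measurableT_comp => //.
  apply: measurable_funM => //; exact: measurable_funD.
have h_ge0 z : 0 <= h z by rewrite !mulr_ge0 ?powR_ge0 ?expR_ge0.
have ft := tonelli_halfline mh h_ge0.
clear mh h_ge0.
rewrite /beta_int -ge0_integralZl_halfline; last 3 first.
- exact: ltW.
- apply: continuous_positive_itv => u u0.
  have u1 : 0 < 1 + u by rewrite addr_gt0.
  exact: is_derive_cont (deriveM_fun (derive_powR_fun (a - 1) u0 (derive_id_fun u))
     (derive_powR_fun (- (a + b)) u1 (deriveD_fun (derive_cst_fun 1 u) (derive_id_fun u)))).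
- by move=> u _; rewrite mulr_ge0 ?powR_ge0.
transitivity (\int[mu]_(u in `]0%R, +oo[) \int[mu]_(t in `]0%R, +oo[) (h (u, t))%:E)%E.
  apply: eq_integral => u; rewrite inE/= in_itv/= andbT => u0.
  have u1 : 0 < 1 + u by rewrite addr_gt0.
  rewrite /h/= ge0_integralZl_halfline; last 3 first.
  - exact: powR_ge0.
  - exact: expR_powR_meas.
  - by move=> t _; rewrite mulr_ge0 ?powR_ge0 ?expR_ge0.
  by rewrite (gamma_int_scale ab u1) -EFinM [in LHS]mulrC -[in LHS]mulrA.
rewrite ft EFinM -(GammaE b1) -ge0_integralZl_halfline; last 3 first.
- exact: ltW (Gamma_gt0 a1).
- by apply: continuous_positive_itv => x x0; exact: igd_cont.
- by move=> t _.
apply: eq_integral => t; rewrite inE/= in_itv/= andbT => t0.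
transitivity (\int[mu]_(u in `]0%R, +oo[) ((t `^ (a + b - 1) * expR (- t)) * (u `^ (a - 1) * expR (- (t * u))))%:E)%E.
  apply: eq_integral => u _; congr EFin; rewrite /h/=.
  by rewrite (_ : - ((1 + u) * t) = - t + - (t * u)) ?expRD; ring.
rewrite ge0_integralZl_halfline; last 3 first.
- by rewrite mulr_ge0 ?powR_ge0 ?expR_ge0.
- exact: expR_powR_meas.
- by move=> u _; rewrite mulr_ge0 ?powR_ge0 ?expR_ge0.
rewrite (gamma_int_scale a1 t0) -EFinM; congr EFin.
exact: alg.
Qed.

End gamma.

(** * Hardy's inequality, the case of equal exponents *)

Section hardy.
Local Open Scope ring_scope.
Variable R : realType.
Implicit Types x T e : R.
Variable k : R.
Hypothesis k1 : 1 < k.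
Variables g G U W : R -> R.
Hypothesis g0 : forall x, 0 < x -> 0 <= g x.
Hypothesis G0 : forall x, 0 < x -> 0 < G x.
Hypothesis dG : forall x, 0 < x -> is_derive x (1 : R) G (g x).
Hypothesis dU : forall x, 0 < x -> is_derive x (1 : R) U (g x `^ k).
Hypothesis dW : forall x, 0 < x ->
  is_derive x (1 : R) W (x `^ (- ((k - 1) * k / k)) * (k * G x `^ (k - 1) * g x)).
Hypothesis U0 : forall x, 0 < x -> 0 <= U x.
Hypothesis W0 : W x @[x --> 0^'+] --> 0.
Hypothesis lev_cvg0 : x `^ (- (k - 1)) * G x `^ k @[x --> 0^'+] --> 0.

(** The limiting case r = 0 of the Bellman argument: the Bellman function is linear with slope a^k,
    where a = (k - 1) / k is the maximum point of [theta], and the tangent line is taken at a G / x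
    throughout. *)
Lemma hardy_inequality T : 0 < T -> ((k - 1) / k) `^ (k - 1) / k * W T <= U T.
Proof.
move=> T0; have k0 : 0 < k by exact: lt_trans k1.
have km : 0 < k - 1 by rewrite subr_gt0.
have [a aE] : exists a, a = (k - 1) / k by exists ((k - 1) / k).
have a0 : 0 < a by rewrite aE; exact: divr_gt0.
rewrite -aE.
set m := a `^ (k - 1) / k.
pose lev x := x `^ (- (k - 1)) * G x `^ k.
pose energy x := U x - m * W x - a `^ k * lev x.
have lev_ge0 x : 0 <= lev x by rewrite mulr_ge0 ?powR_ge0.
have energy_mono x y : 0 < x -> x <= y -> energy x <= energy y.
  move=> x0 xy; apply: derive_ge0_le => // z /andP[xz _].
  have z0 : 0 < z by exact: lt_le_trans xz.
  have Gz := G0 z0; have gz := g0 z0.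
  eexists; last exact: (deriveB_fun (deriveB_fun (dU z0) (deriveZ_fun m (dW z0)))
    (deriveZ_fun (a `^ k) (deriveM_fun (derive_powR_fun (- (k - 1)) z0 (derive_id_fun z))
     (derive_powR_fun k Gz (dG z0))))).
  have w0 : 0 <= a * G z / z by rewrite !mulr_ge0 ?invr_ge0// ltW.
  have := young_tangent k1 w0 gz.
  have -> : (a * G z / z) `^ (k - 1) = a `^ (k - 1) * (z `^ (- (k - 1)) * G z `^ (k - 1)).
    rewrite !powRM ?mulr_ge0 ?invr_ge0 ?(ltW z0) ?(ltW Gz) ?(ltW a0)//.
    rewrite -[z^-1](powR_inv1 (ltW z0)) -[in LHS]powRrM mulN1r; ring.
  have -> : (a * G z / z) `^ k = a `^ k * (z `^ (- k) * G z `^ k).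
    rewrite !powRM ?mulr_ge0 ?invr_ge0 ?(ltW z0) ?(ltW Gz) ?(ltW a0)//.
    rewrite -[z^-1](powR_inv1 (ltW z0)) -[in LHS]powRrM mulN1r; ring.
  rewrite -subr_ge0 => /le_trans; apply.
  have zk : z `^ (- (k - 1) - 1) = z `^ (- k) by congr (_ `^ _); ring.
  have zk' : z `^ (- ((k - 1) * k / k)) = z `^ (- (k - 1)).
    by congr (_ `^ _); field; rewrite gt_eqF.
  have ak : a `^ k = (k - 1) / k * a `^ (k - 1) by rewrite -aE mulr_powRB1// ltW.
  rewrite zk zk' ak /m; apply: eq_lerW; field; rewrite gt_eqF//.
have : 0 <= energy T.
  have h0 : (fun x => m * W x + a `^ k * lev x) x @[x --> 0^'+] --> (0 : R).
    rewrite -[X in _ --> X](addr0 0); apply: cvgD.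
      by rewrite -[X in _ --> X](mulr0 m); apply: cvgM => //; exact: cvg_cst.
    by rewrite -[X in _ --> X](mulr0 (a `^ k)); apply: cvgM => //; exact: cvg_cst.
  apply: (ge0_of_cvg0 T0 h0) => e /andP[e0 eT].
  apply: le_trans (energy_mono _ _ e0 eT); have := U0 e0; rewrite /energy; lra.
have := mulr_ge0 (powR_ge0 a k) (lev_ge0 T); rewrite /energy; lra.
Qed.

End hardy.

(** * The constant K *)

Section exponents.
Local Open Scope ring_scope.
Variable R : realType.
Variables p q : R.
Hypothesis p1 : 1 < p.
Hypothesis pq : p <= q.

Lemma conj_exp_gt1 (c : R) : 1 < c -> 1 < conj_exp c.
Proof.
move=> c1; have c0 : 0 < c by exact: lt_trans c1.
have ci : c^-1 < 1 by rewrite invf_lt1.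
by rewrite /conj_exp invf_gt1 ?subr_gt0// gtrBl invr_gt0.
Qed.

Lemma conj_exp_inv (c : R) : (conj_exp c)^-1 = 1 - c^-1.
Proof. by rewrite /conj_exp invrK. Qed.

Lemma conj_exp_le : conj_exp q <= conj_exp p.
Proof.
have p0 : 0 < p by exact: lt_trans p1.
have q0 : 0 < q by exact: lt_le_trans pq.
have q1 : 1 < q by exact: lt_le_trans pq.
by rewrite /conj_exp lef_pV2 ?posrE ?subr_gt0 ?invf_lt1// lerD2l lerN2 lef_pV2.
Qed.

Lemma conj_exp_lt : p < q -> conj_exp q < conj_exp p.
Proof.
move=> pq'; have p0 : 0 < p by exact: lt_trans p1.
have q0 : 0 < q by exact: lt_le_trans pq.
have q1 : 1 < q by exact: lt_le_trans pq.
by rewrite /conj_exp ltf_pV2 ?posrE ?subr_gt0 ?invf_lt1// ltrD2l ltrN2 ltf_pV2.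
Qed.

End exponents.

Section kappa.
Local Open Scope ring_scope.
Variable R : realType.
Variables k l : R.
Hypothesis k1 : 1 < k.
Hypothesis kl : k < l.
Let r := l / k - 1.
Let k0 : 0 < k. Proof. exact: lt_trans k1. Qed.
Let r0 : 0 < r. Proof. by rewrite subr_gt0 ltr_pdivlMr// mul1r. Qed.
Let l0 : 0 < l. Proof. exact: lt_trans kl. Qed.

(** Up to a factor and the substitution u = x^r, [kap] is the primitive W of the extremal. It
    increases to k times the beta integral; the last clauses state this limit as an upper bound that
    is nearly reached. *)
Lemma kappa_exists : exists kap : R -> R, [/\
  (forall u : R, 0 < u -> is_derive u (1 : R) kap (k * (u `^ r^-1 * (1 + u) `^ (- (l / r + 1))))),
  (forall u : R, 0 < u -> 0 <= kap u <= k * u) &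
  forall B : R, beta_int (r^-1 + 1) ((l - 1) / r) = B%:E ->
    (forall u : R, 0 < u -> kap u <= k * B) /\
    forall u : R, 0 < u -> exists2 v, 0 < v & k * B - u <= kap v].
Proof.
pose phi (u : R) := k * (u `^ r^-1 * (1 + u) `^ (- (l / r + 1))).
have phi0 u : 0 <= phi u by rewrite !mulr_ge0 ?powR_ge0// ltW.
have cphi (u : R) : 0 < u -> {for u, continuous phi}.
  move=> u0; have u1 : 0 < 1 + u by rewrite addr_gt0.
  exact: is_derive_cont (deriveZ_fun k (deriveM_fun (derive_powR_fun r^-1 u0 (derive_id_fun u))
     (derive_powR_fun (- (l / r + 1)) u1 (deriveD_fun (derive_cst_fun 1 u) (derive_id_fun u))))).
have phi1 (u : R) : 0 < u -> phi u <= k.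
  move=> u0; have u1 : 1 <= 1 + u by rewrite lerDl ltW.
  rewrite -[leRHS]mulr1 ler_pM2l//.
  apply: (@le_trans _ _ ((1 + u) `^ r^-1 * (1 + u) `^ (- (l / r + 1)))).
    apply: ler_wpM2r; first exact: powR_ge0.
    by apply: le_powR_nneg; rewrite ?invr_ge0 ?ltW// ltrDr.
  rewrite -(powRDp _ _ (lt_le_trans ltr01 u1)).
  rewrite -[leRHS](powRr0 (1 + u)) ler_powR//.
  have -> : r^-1 - (l / r + 1) = - ((l - 1) / r + 1) by field; rewrite gt_eqF.
  by rewrite oppr_le0 addr_ge0// divr_ge0 ?(ltW r0)// subr_ge0 ltW// (lt_trans k1).
have [|kap [dk kE kap0 kapM]] := @primitive_from0 R phi cphi (fun u _ => phi0 u).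
  by move=> X; exists k => x /andP[x0 _]; exact: phi1.
exists kap; split.
- exact: dk.
- move=> u u0; rewrite kap0//=; apply: kapM => // y /andP[y0 _]; exact: phi1.
- move=> B BE.
  have mphi : measurable_fun (pos R) (EFin \o phi).
    by apply/measurable_EFinP; exact: continuous_positive_itv.
  have c := integral_itv0y_cvg mphi (fun x _ => phi0 x).
  have E : (\int[mu]_(x in `]0%R, +oo[) (EFin \o phi) x = (k * B)%:E)%E.
    rewrite EFinM -BE /beta_int -ge0_integralZl_halfline; last 3 first.
    + exact: ltW.
    + apply: continuous_positive_itv => x x0; have x1 : 0 < 1 + x by rewrite addr_gt0.
      exact: is_derive_cont (deriveM_fun (derive_powR_fun _ x0 (derive_id_fun x))
       (derive_powR_fun _ x1 (deriveD_fun (derive_cst_fun 1 x) (derive_id_fun x)))).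
    + by move=> x _; rewrite mulr_ge0 ?powR_ge0.
    apply: eq_integral => x _ /=; congr (_%:E); rewrite /phi; congr (_ * (_ `^ _ * _ `^ _)).
      by rewrite addrK.
    by field; rewrite gt_eqF.
  rewrite E in c; split=> u u0.
    rewrite -lee_fin -E -kE//; apply: ge0_subset_integral => //.
    - by move=> x _; rewrite lee_fin.
    - by move=> x; rewrite /= !in_itv/= => /andP[->].
  apply: contrapT => H; have : ((k * B)%:E <= (k * B - u)%:E)%E.
    rewrite -[leLHS](cvg_lim _ c)//; apply: lime_le; first exact: cvgP c.
    near=> n; have n0 : 0 < n%:R :> R by rewrite ltr0n; near: n; exact: nbhs_infty_gt.
    rewrite /= kE// lee_fin leNgt; apply/negP => h; apply: H; exists n%:R => //; exact: ltW.
  by apply/negP; rewrite -ltNge lte_fin gtrBl.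
Unshelve. all: by end_near. Qed.

End kappa.

Section sharp.
Local Open Scope ring_scope.
Variable R : realType.
Variables p q : R.
Hypothesis p1 : 1 < p.
Hypothesis pq : p <= q.
Let k := conj_exp q.
Let l := conj_exp p.
Let q1 : 1 < q. Proof. exact: lt_le_trans pq. Qed.
Let k1 : 1 < k. Proof. exact: conj_exp_gt1. Qed.
Let l1 : 1 < l. Proof. exact: conj_exp_gt1. Qed.
Let kl : k <= l. Proof. exact: conj_exp_le. Qed.
Let k0 : 0 < k. Proof. exact: lt_trans k1. Qed.
Let l0 : 0 < l. Proof. exact: lt_trans l1. Qed.

Let pinv : p^-1 = 1 - l^-1.
Proof. by rewrite conj_exp_inv opprB addrC subrK. Qed.

Let qinv : q^-1 = 1 - k^-1.
Proof. by rewrite conj_exp_inv opprB addrC subrK. Qed.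

Lemma K_const_eq : p = q -> K_const p q `^ l = l * p `^ (l - 1).
Proof.
move=> pq'; rewrite /K_const pq' eqxx -pq' -/l.
have p0 : 0 < p by exact: lt_trans p1.
rewrite powRM ?powR_ge0// -!powRrM mulVf ?gt_eqF// powRr1 ?(ltW l0)// mulrC.
congr (_ * _ `^ _); rewrite pinv; field.
by rewrite gt_eqF.
Qed.

(* [s / p] and [s / q'] in terms of [k = q'], [l = p'] and [r = l / k - 1], where [s = l / r]. *)
Lemma K_const_lt : p < q -> let r := l / k - 1 in exists2 B : R, 0 < B &
  beta_int (r^-1 + 1) ((l - 1) / r) = B%:E /\ K_const p q `^ l = (l / r * B) `^ (- r).
Proof.
move=> pq' r; have kl' : k < l by exact: conj_exp_lt.
have r0 : 0 < r by rewrite subr_gt0 ltr_pdivlMr// mul1r.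
have sE : (p^-1 - q^-1)^-1 = l / r.
  have -> : p^-1 - q^-1 = r / l by rewrite pinv qinv /r; field; rewrite !gt_eqF.
  by rewrite invf_div.
have s1E : l / r / p = (l - 1) / r.
  by rewrite pinv; field; rewrite !gt_eqF.
have s2E : l / r / k = r^-1 + 1.
  have -> : l = k * (r + 1) by rewrite /r subrK mulrC divfK// gt_eqF.
  by field; rewrite !gt_eqF.
have a1 : 1 < r^-1 + 1 by rewrite ltrDr invr_gt0.
have b1 : 1 < (l - 1) / r.
  by rewrite ltr_pdivlMr// mul1r /r ltrD2r ltr_pdivrMr// ltr_pMr.
have sr : 1 < l / r.
  by rewrite (lt_trans b1)// ltr_pM2r ?invr_gt0// gtrBl.
have abE : r^-1 + 1 + (l - 1) / r = l / r + 1 by field; rewrite gt_eqF.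
have GG := Gamma_beta a1 b1.
set B := (_ * _ / _) in GG.
have B0 : 0 < B by rewrite !mulr_gt0 ?invr_gt0 ?Gamma_gt0// abE (lt_trans sr)// ltrDl.
exists B => //; split => //.
rewrite /K_const (lt_eqF pq') sE s1E -/k s2E -powRrM invf_div.
have -> : r / l * l = r by rewrite divfK// gt_eqF.
have G0 := Gamma_gt0 sr; have Ga := Gamma_gt0 a1; have Gb := Gamma_gt0 b1.
(* The two beta arguments add up to s + 1, where s = l / r; the recursion Gamma(s + 1) = s Gamma(s)
   accounts for the factor l / r. *)
have -> : Gamma (l / r) / (Gamma ((l - 1) / r) * Gamma (r^-1 + 1)) = (l / r * B)^-1.
  rewrite /B abE (Gamma_rec sr).
  move: (Gamma (l / r)) (Gamma (r^-1 + 1)) (Gamma ((l - 1) / r)) G0 Ga Gb => x y z x0 y0 z0.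
  by field; rewrite !gt_eqF.
have lB : 0 < l / r * B by rewrite mulr_gt0// divr_gt0.
by rewrite -[(l / r * B)^-1](powR_inv1 (ltW lB)) -powRrM mulN1r.
Qed.

Lemma K_const_gt0 : 0 < K_const p q.
Proof.
have p0 : 0 < p by exact: lt_trans p1.
have [pq'|pq'] := eqVneq p q.
  by rewrite /K_const pq' eqxx mulr_gt0 ?powR_gt0 -?pq' -?/l.
have ltpq : p < q by rewrite lt_neqAle pq' pq.
have [B B0 [_ E]] := K_const_lt ltpq.
have kl' : k < l by exact: conj_exp_lt.
have r0 : 0 < l / k - 1 by rewrite subr_gt0 ltr_pdivlMr// mul1r.
have : 0 < K_const p q `^ l by rewrite E powR_gt0// mulr_gt0// divr_gt0.
by apply: gt0_powR; rewrite // /K_const (negPf pq') powR_ge0.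
Qed.

Variables g G U W : R -> R.
Hypothesis g0 : forall x : R, 0 < x -> 0 <= g x.
Hypothesis G0 : forall x : R, 0 < x -> 0 < G x.
Hypothesis dG : forall x : R, 0 < x -> is_derive x (1 : R) G (g x).
Hypothesis dU : forall x : R, 0 < x -> is_derive x (1 : R) U (g x `^ k).
Hypothesis dW : forall x : R, 0 < x ->
  is_derive x (1 : R) W (x `^ (- ((k - 1) * l / k)) * (l * G x `^ (l - 1) * g x)).
Hypothesis U0 : forall x : R, 0 < x -> 0 <= U x.
Hypothesis W0 : W x @[x --> 0^'+] --> 0.
Hypothesis lev_cvg0 : x `^ (- (k - 1)) * G x `^ k @[x --> 0^'+] --> 0.

Lemma sharp_inequality (T : R) : 0 < T -> 0 <= W T ->
  W T <= K_const p q `^ l * U T `^ (l / k).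
Proof.
move=> T0 WT; have p0 : 0 < p by exact: lt_trans p1.
have [pq'|pq'] := eqVneq p q.
  have klE : k = l by rewrite /k -pq'.
  rewrite K_const_eq// klE divff ?gt_eqF// powRr1 ?U0//.
  have dU' (x : R) : 0 < x -> is_derive x (1 : R) U (g x `^ l) by rewrite -klE; exact: dU.
  have dW' (x : R) : 0 < x -> is_derive x (1 : R) W (x `^ (- ((l - 1) * l / l)) * (l * G x `^ (l - 1) * g x)).
    by have := @dW x; rewrite klE.
  have lev' : x `^ (- (l - 1)) * G x `^ l @[x --> 0^'+] --> (0 : R) by rewrite -klE.
  have := hardy_inequality l1 g0 G0 dG dU' dW' U0 W0 lev' T0.
  have pa : (l - 1) / l = p^-1 by rewrite pinv; field; rewrite gt_eqF.
  rewrite pa -[p^-1]powR_inv1 ?(ltW p0)// -powRrM mulN1r powRN => H.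
  have E : W T = l * p `^ (l - 1) * ((p `^ (l - 1))^-1 / l * W T).
    by field; rewrite !gt_eqF ?powR_gt0.
  by rewrite E ler_pM2l// mulr_gt0// powR_gt0.
have ltpq : p < q by rewrite lt_neqAle pq' pq.
have kl' : k < l by exact: conj_exp_lt.
have [B B0 [BE ->]] := K_const_lt ltpq.
set r := l / k - 1 in BE *.
have r0 : 0 < r by rewrite subr_gt0 ltr_pdivlMr// mul1r.
have [kap [dkap kapb kapB]] := kappa_exists k1 kl'.
(* [D] makes (1 - k / l) D the limit k B of [kap], and D^(-r) is the l-th power of K. *)
set D := l / r * B; have D0 : 0 < D by rewrite mulr_gt0// divr_gt0.
have DE : (1 - k / l) * D = k * B.
  have -> : 1 - k / l = k * r / l by rewrite /r; field; rewrite !gt_eqF.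
  by rewrite /D; field; rewrite !gt_eqF.
have HD u : 0 < u -> exists2 v, 0 < v & (1 - k / l) * D - u <= kap v.
  by rewrite DE; exact: (kapB B BE).2.
have := bliss_inequality k1 kl' dkap kapb g0 G0 dG dU dW U0 W0 lev_cvg0 T0 (ltW D0) WT HD.
rewrite -ler_pdivlMr ?powR_gt0// -powRN => H.
have kl0 : 0 < k / l by exact: divr_gt0.
have := le_powR_nneg (ltW (divr_gt0 l0 k0)) (powR_ge0 _ _) H.
rewrite -powRrM (_ : k / l * (l / k) = 1); last by field; rewrite !gt_eqF.
rewrite powRr1// => /le_trans; apply.
rewrite powRM ?powR_ge0 ?U0// -powRrM mulrC.
rewrite (_ : - (1 - k / l) * (l / k) = - r)//.
by rewrite /r; field; rewrite !gt_eqF.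
Qed.

End sharp.

(** * Primitives and nonincreasing test functions *)

Section primitives.
Local Open Scope ring_scope.
Variable R : realType.
Implicit Types (f g F G : R -> R) (x y a b c M T e : R).

(** The value at 0 is imposed as a limit, as values outside (0, oo) carry no meaning. It singles out
    one primitive on (0, oo), which is the integral over (0, x) for a continuous, nonnegative,
    locally bounded [f]. *)
Definition prim f F : Prop :=
  (forall x, 0 < x -> is_derive x (1 : R) F (f x)) /\ F x @[x --> 0^'+] --> 0.

Lemma cvg0_linear c : (fun x => c * x) x @[x --> 0^'+] --> (0 : R).
Proof.
rewrite -[X in _ --> X](mulr0 c); apply: cvgM; first exact: cvg_cst.
by apply: cvg_at_right_filter; exact: cvg_id.
Qed.

Lemma cvg0_of_bound F (h : R -> R) c : 0 < c -> h x @[x --> 0^'+] --> 0 ->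
  (forall x, 0 < x <= c -> 0 <= F x <= h x) -> F x @[x --> 0^'+] --> (0 : R).
Proof.
move=> c0 h0 H; apply: (squeeze_cvgr _ (cvg_cst 0) h0); near=> x; apply: H.
by apply/andP; split; [near: x; exact: nbhs_right_gt|near: x; exact: nbhs_right_le].
Unshelve. all: by end_near. Qed.

Lemma prim_mono f F x y : prim f F -> (forall x, 0 < x -> 0 <= f x) ->
  0 < x -> x <= y -> F x <= F y.
Proof.
move=> [dF _] f0 x0 xy; apply: derive_ge0_le => // z /andP[xz _].
have z0 : 0 < z by exact: lt_le_trans xz.
by exists (f z); [exact: f0|exact: dF].
Qed.

Lemma prim_ge0 f F x : prim f F -> (forall x, 0 < x -> 0 <= f x) -> 0 < x -> 0 <= F x.
Proof.
move=> pF f0 x0; have FN0 : (fun y => - F y) y @[y --> 0^'+] --> (0 : R).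
  by rewrite -[X in _ --> X]oppr0; apply: cvgN; exact: pF.2.
apply: (ge0_of_cvg0 x0 FN0) => e /andP[e0 ex]; rewrite opprK.
exact: prim_mono f0 e0 ex.
Qed.

Lemma prim_le f F g G x : prim f F -> prim g G -> (forall y, 0 < y <= x -> f y <= g y) ->
  0 < x -> F x <= G x.
Proof.
move=> [dF F0] [dG G0] fg x0; rewrite -subr_ge0.
have h0 : (fun y => F y - G y) y @[y --> 0^'+] --> (0 : R).
  by rewrite -[X in _ --> X](subrr 0); exact: cvgB.
apply: (ge0_of_cvg0 x0 h0) => e /andP[e0 ex]; rewrite opprB.
apply: (derive_ge0_le (f := fun y => G y - F y)) => // z /andP[ez zx].
have z0 : 0 < z by exact: lt_le_trans ez.
by eexists; last exact: (deriveB_fun (dG _ z0) (dF _ z0)); rewrite subr_ge0 fg// z0.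
Qed.

Lemma prim_unique f F g G x : prim f F -> prim g G -> (forall y, 0 < y -> f y = g y) ->
  0 < x -> F x = G x.
Proof.
move=> pF pG fg x0; apply/eqP; rewrite eq_le; apply/andP; split.
  by apply: (prim_le pF pG) => // y /andP[y0 _]; rewrite fg.
by apply: (prim_le pG pF) => // y /andP[y0 _]; rewrite fg.
Qed.

Lemma prim_cst M : prim (fun=> M) (fun x => M * x).
Proof.
split; last exact: cvg0_linear.
by move=> x _; have := deriveZ_fun M (derive_id_fun x); rewrite mulr1.
Qed.

Definition locally_bounded f := forall X, exists M, forall x, 0 < x <= X -> f x <= M.

Lemma primP f : (forall x, 0 < x -> {for x, continuous f}) -> (forall x, 0 < x -> 0 <= f x) ->
  locally_bounded f -> exists2 F, prim f F &
    forall x, 0 < x -> (\int[mu]_(y in `]0%R, x[) (f y)%:E)%E = (F x)%:E.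
Proof.
move=> cf f0 bf; have [F [dF FE F0 FM]] := primitive_from0 cf f0 bf.
exists F => //; split=> //; have [M HM] := bf 1.
apply: (cvg0_of_bound ltr01 (cvg0_linear M)) => x /andP[x0 x1]; rewrite F0//=.
by apply: FM => // y /andP[y0 yx]; apply: HM; rewrite y0 (le_trans (ltW yx)).
Qed.

Lemma prim_integral f F : (forall x, 0 < x -> {for x, continuous f}) ->
  (forall x, 0 < x -> 0 <= f x) -> locally_bounded f -> prim f F ->
  forall x, 0 < x -> (\int[mu]_(y in `]0%R, x[) (f y)%:E)%E = (F x)%:E.
Proof.
move=> cf f0 bf pF x x0; have [G pG ->//] := primP cf f0 bf.
by congr (_%:E); exact: (prim_unique pG pF).
Qed.

End primitives.

Section profile.
Local Open Scope ring_scope.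
Variable R : realType.
Variables k l : R.
Hypothesis k1 : 1 < k.
Hypothesis kl : k <= l.
Let k0 : 0 < k. Proof. exact: lt_trans k1. Qed.
Let l1 : 1 < l. Proof. exact: lt_le_trans kl. Qed.
Let l0 : 0 < l. Proof. exact: lt_trans l1. Qed.
Let km : 0 < k - 1. Proof. by rewrite subr_gt0. Qed.
Let lm : 0 < l - 1. Proof. by rewrite subr_gt0. Qed.
Implicit Types (x y c M T e : R) (f F g G U W : R -> R).

(** Continuity allows differentiation of the primitives; boundedness gives G x <= M x, so that the
    quantities built from G vanish at 0; a positive value makes G positive, so that its powers are
    differentiable. *)
Definition test_fun g : Prop := [/\ (forall x, 0 < x -> {for x, continuous g}),
  (forall x, 0 < x -> 0 <= g x),
  (forall x y, 0 < x -> x <= y -> g y <= g x),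
  (exists M, forall x, 0 < x -> g x <= M) & exists2 x, 0 < x & 0 < g x].

(** The density of d(G^l). *)
Definition power_density G g x := l * G x `^ (l - 1) * g x.

(* The additional factor is [x^(-p'/q)], the parameter for which the norm is [K]. *)
Definition weighted_density G g x := x `^ (- ((k - 1) * l / k)) * power_density G g x.

Definition profile g G U W : Prop := [/\ prim g G, prim (fun x => g x `^ k) U,
  prim (weighted_density G g) W & forall x, 0 < x -> 0 < G x].

Section facts.
Variables g G : R -> R.
Hypothesis tg : test_fun g.
Hypothesis pG : prim g G.

Lemma test_prim_gt0 x : 0 < x -> 0 < G x.
Proof.
have [cg g0 nig _ [x0 x00 gx0]] := tg; move=> x_gt0.
pose y := Num.min x x0; have y0 : 0 < y by rewrite lt_min x_gt0.
have gy : 0 < g y by rewrite (lt_le_trans gx0)// nig// ge_min lexx orbT.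
apply: (@lt_le_trans _ _ (g y * y)); first exact: mulr_gt0.
apply: (@le_trans _ _ (G y)); last by apply: (prim_mono pG) => //; rewrite ge_min lexx.
by apply: (prim_le (prim_cst (g y)) pG) => // z /andP[z0 zy]; exact: nig.
Qed.

Lemma test_prim_ge x : 0 < x -> g x * x <= G x.
Proof.
have [cg g0 nig _ _] := tg; move=> x0.
by apply: (prim_le (prim_cst (g x)) pG) => // z /andP[z0 zx]; exact: nig.
Qed.

Lemma test_prim_le M x : (forall x, 0 < x -> g x <= M) -> 0 < x -> G x <= M * x.
Proof.
move=> gM x0; apply: (prim_le pG (prim_cst M)) => // z /andP[z0 _]; exact: gM.
Qed.

(** A test function may vanish at some points; there the power is not covered by differentiability
    and continuity is checked by hand. *)
Lemma test_powR_cont c x : 0 < c -> 0 < x -> {for x, continuous (fun x => g x `^ c)}.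
Proof.
have [cg g0 nig _ _] := tg => c0 x0.
have [gx|gx|gx] := ltgtP (g x) 0.
- by have := g0 x x0; rewrite leNgt gx.
- by apply: continuous_powR_fun => //; exact: cg.
- apply/cvgrPdist_lt => e e0; rewrite gx powR0 ?gt_eqF//.
  have := cg x x0; move/cvgrPdist_lt => /(_ (e `^ c^-1)); rewrite powR_gt0// => /(_ isT).
  rewrite gx => H; near=> y.
  have y0 : 0 < y by near: y; exact: lt_nbhsr.
  have : `|0 - g y| < e `^ c^-1 by near: y; exact: H.
  rewrite !sub0r !normrN (ger0_norm (g0 _ y0)) ger0_norm ?powR_ge0// => h.
  rewrite -[ltRHS](@powRVK _ e c) ?gt_eqF ?(ltW e0)//.
  by apply: gt0_ltr_powR; rewrite ?nnegrE ?powR_ge0// g0.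
Unshelve. all: by end_near. Qed.

Lemma test_powR_bounded c : 0 < c -> locally_bounded (fun x => g x `^ c).
Proof.
have [cg g0 nig [M gM] _] := tg => c0 X; exists (M `^ c) => x /andP[x0 _].
by apply: le_powR_nneg; rewrite ?g0 ?gM ?ltW.
Qed.

Lemma power_density_ge0 x : 0 < x -> 0 <= power_density G g x.
Proof.
have [_ g0 _ _ _] := tg => x0; rewrite /power_density mulr_ge0 ?g0//.
by rewrite mulr_ge0 ?powR_ge0 ?ltW.
Qed.

Lemma weighted_density_ge0 x : 0 < x -> 0 <= weighted_density G g x.
Proof. by move=> x0; rewrite /weighted_density mulr_ge0 ?powR_ge0 ?power_density_ge0. Qed.

Lemma power_density_cont x : 0 < x -> {for x, continuous (power_density G g)}.
Proof.
have [cg _ _ _ _] := tg => x0; have Gx := test_prim_gt0 x0.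
apply: (@continuousM _ _ (fun x => l * G x `^ (l - 1)) g); last exact: cg.
exact: is_derive_cont (deriveZ_fun l (derive_powR_fun (l - 1) Gx (pG.1 _ x0))).
Qed.

Lemma weighted_density_cont x : 0 < x -> {for x, continuous (weighted_density G g)}.
Proof.
move=> x0; apply: (@continuousM _ _ (fun x => x `^ (- ((k - 1) * l / k))) (power_density G g)).
  exact: continuous_powR_at.
exact: power_density_cont.
Qed.

Let power_density_le M x : (forall x, 0 < x -> g x <= M) -> 0 < x ->
  power_density G g x <= l * (M * x) `^ (l - 1) * M.
Proof.
have [_ g0 _ _ _] := tg => gM x0; rewrite /power_density.
have Gx := test_prim_gt0 x0.
apply: ler_pM; rewrite ?g0 ?gM ?mulr_ge0 ?powR_ge0 ?(ltW l0)//.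
rewrite ler_pM2l//; apply: le_powR_nneg; [exact: ltW|exact: ltW|exact: test_prim_le].
Qed.

Lemma power_density_bounded : locally_bounded (power_density G g).
Proof.
have [_ g0 _ [M gM] _] := tg => X; exists (l * (M * X) `^ (l - 1) * M) => x /andP[x0 xX].
have M0 : 0 <= M by rewrite (le_trans (g0 _ x0))// gM.
apply: le_trans (power_density_le gM x0) _; apply: ler_wpM2r => //; rewrite ler_pM2l//.
by apply: le_powR_nneg; rewrite ?(ltW lm) ?mulr_ge0 ?(ltW x0)// ler_wpM2l.
Qed.

Let weighted_density_le M x : (forall x, 0 < x -> g x <= M) -> 0 < x ->
  weighted_density G g x <= l * M `^ l * x `^ (l / k - 1).
Proof.
have [_ g0 _ _ _] := tg => gM x0.
have M0 : 0 <= M by rewrite (le_trans (g0 _ x0))// gM.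
rewrite /weighted_density.
apply: (@le_trans _ _ (x `^ (- ((k - 1) * l / k)) * (l * (M * x) `^ (l - 1) * M))).
  by apply: ler_wpM2l; rewrite ?powR_ge0//; exact: power_density_le.
have E : x `^ (l / k - 1) = x `^ (- ((k - 1) * l / k)) * x `^ (l - 1).
  rewrite -(powRDp _ _ x0).
  by congr (_ `^ _); field; rewrite gt_eqF.
rewrite E powRM ?(ltW x0)// -(mulr_powRB1 M0 l0); apply: eq_lerW; ring.
Qed.

Lemma weighted_density_bounded : locally_bounded (weighted_density G g).
Proof.
have [_ g0 _ [M gM] _] := tg => X; exists (l * M `^ l * X `^ (l / k - 1)) => x /andP[x0 xX].
apply: le_trans (weighted_density_le gM x0) _; apply: ler_wpM2l.
  by rewrite mulr_ge0 ?powR_ge0 ?ltW.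
by apply: le_powR_nneg; rewrite ?(ltW x0)// subr_ge0 ler_pdivlMr// mul1r.
Qed.

Lemma prim_power_density : prim (power_density G g) (fun x => G x `^ l).
Proof.
have [_ g0 _ [M gM] _] := tg; split.
  move=> x x0; exact: (is_derive_ext (derive_powR_fun l (test_prim_gt0 x0) (pG.1 _ x0))).
have M0 : 0 <= M by apply: le_trans (g0 _ ltr01) (gM _ ltr01).
have h0 : (fun x => M `^ l * x `^ l) x @[x --> 0^'+] --> (0 : R).
  by rewrite -[X in _ --> X](mulr0 (M `^ l)); apply: cvgM; [exact: cvg_cst|exact: powR_cvg0].
apply: (cvg0_of_bound ltr01 h0) => x /andP[x0 _]; rewrite powR_ge0/= -powRM ?(ltW x0)//.
apply: le_powR_nneg; [exact: ltW|exact/ltW/test_prim_gt0|exact: test_prim_le].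
Qed.

Lemma test_level_cvg0 : x `^ (- (k - 1)) * G x `^ k @[x --> 0^'+] --> 0.
Proof.
have [_ g0 _ [M gM] _] := tg.
have M0 : 0 <= M by apply: le_trans (g0 _ ltr01) (gM _ ltr01).
apply: (cvg0_of_bound ltr01 (cvg0_linear (M `^ k))) => x /andP[x0 _].
rewrite mulr_ge0 ?powR_ge0//=.
apply: (@le_trans _ _ (x `^ (- (k - 1)) * (M * x) `^ k)).
  apply: ler_wpM2l; rewrite ?powR_ge0//.
  apply: le_powR_nneg; [exact: ltW|exact/ltW/test_prim_gt0|exact: test_prim_le].
rewrite powRM ?(ltW x0)// mulrCA -(powRDp _ _ x0).
by rewrite (_ : - (k - 1) + k = 1) ?powRr1 ?(ltW x0)//; ring.
Qed.

(* [x^(l-1)] times this factor is [power_density]. *)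
Lemma slope_density_nincr x y : 0 < x -> x <= y ->
  l * (G y / y) `^ (l - 1) * g y <= l * (G x / x) `^ (l - 1) * g x.
Proof.
have [_ g0 nig _ _] := tg => x0 xy; have y0 : 0 < y by exact: lt_le_trans xy.
(* The slope G / x has derivative (g - G / x) / x, which is nonpositive because a nonincreasing g
   lies below its mean G / x. *)
have slope : G y / y <= G x / x.
  rewrite -(powR_inv1 (ltW x0)) -(powR_inv1 (ltW y0)) -lerN2.
  apply: (derive_ge0_le (f := fun z => - (G z * z `^ (- 1)))) => // z /andP[xz _].
  have z0 : 0 < z by exact: lt_le_trans xz.
  eexists; last exact: (deriveN_fun (deriveM_fun (pG.1 _ z0) (derive_powR_fun (- 1) z0 (derive_id_fun z)))).
  have -> : z `^ (- 1) = z * z `^ (- 1 - 1).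
    exact/esym/mulr_powRB1p.
  have := test_prim_ge z0; have : 0 < z `^ (- 1 - 1) by exact: powR_gt0.
  move: (z `^ _) => w w0 h; rewrite oppr_ge0.
  have -> : g z * (z * w) + G z * (-1 * w * 1) = (g z * z - G z) * w by ring.
  by rewrite pmulr_lle0// subr_le0.
apply: ler_pM; rewrite ?g0 ?nig ?mulr_ge0 ?powR_ge0 ?(ltW l0)//.
rewrite ler_pM2l//; apply: le_powR_nneg; [exact: ltW| |exact: slope].
by apply: divr_ge0; [exact/ltW/test_prim_gt0|exact: ltW].
Qed.

End facts.

Lemma profileP g : test_fun g -> exists G U W, profile g G U W.
Proof.
move=> tg; have [cg g0 nig [M gM] nz] := tg.
have [|G pG _] := primP cg g0; first by move=> X; exists M => x /andP[x0 _]; exact: gM.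
have [|||U pU _] := @primP R (fun x => g x `^ k).
- by move=> x; exact: test_powR_cont.
- by move=> x _; exact: powR_ge0.
- exact: test_powR_bounded.
have [|||W pW _] := @primP R (weighted_density G g).
- by move=> x; exact: weighted_density_cont.
- by move=> x; exact: weighted_density_ge0.
- exact: weighted_density_bounded.
by exists G, U, W; split => // x; exact: (test_prim_gt0 tg pG).
Qed.


Lemma prim_integral_y f F (C : \bar R) : (forall x, 0 < x -> {for x, continuous f}) ->
  (forall x, 0 < x -> 0 <= f x) -> locally_bounded f -> prim f F ->
  (forall x, 0 < x -> ((F x)%:E <= C)%E) ->
  (\int[mu]_(y in `]0%R, +oo[) (f y)%:E <= C)%E.
Proof.
move=> cf f0 bf pF FC.
have mf : measurable_fun (pos R) (EFin \o f).
  by apply/measurable_EFinP; exact: continuous_positive_itv.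
have f0' x : 0 < x -> (0 <= (EFin \o f) x)%E by move=> x0; rewrite lee_fin f0.
have c := integral_itv0y_cvg mf f0'.
rewrite -(cvg_lim _ c)//; apply: lime_le; first exact: cvgP c.
near=> n; have n0 : 0 < n%:R :> R by rewrite ltr0n; near: n; exact: nbhs_infty_gt.
by rewrite /= (prim_integral cf f0 bf pF n0) FC.
Unshelve. all: by end_near. Qed.

Lemma prim_le_integral_y f F x : (forall x, 0 < x -> {for x, continuous f}) ->
  (forall x, 0 < x -> 0 <= f x) -> locally_bounded f -> prim f F -> 0 < x ->
  ((F x)%:E <= \int[mu]_(y in `]0%R, +oo[) (f y)%:E)%E.
Proof.
move=> cf f0 bf pF x0; rewrite -(prim_integral cf f0 bf pF x0).
apply: ge0_subset_integral => //.
- by apply/measurable_EFinP; exact: continuous_positive_itv.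
- by move=> y; rewrite /= in_itv/= andbT lee_fin; exact: f0.
- by move=> y; rewrite /= !in_itv/= => /andP[->].
Qed.

Lemma test_prim_integral g G : test_fun g -> prim g G -> forall x, 0 < x ->
  (\int[mu]_(y in `]0%R, x[) (g y)%:E)%E = (G x)%:E.
Proof.
move=> [cg g0 _ [M gM] _] pG; apply: prim_integral => //.
by move=> X; exists M => x /andP[x0 _]; exact: gM.
Qed.

Lemma power_density_integral g G x : test_fun g -> prim g G -> 0 < x ->
  ((\int[mu]_(y in `]0%R, x[) (g y)%:E) `^ l)%E =
  (\int[mu]_(y in `]0%R, x[) (power_density G g y)%:E)%E.
Proof.
move=> tg pG x0; rewrite (test_prim_integral tg pG x0).
by rewrite (prim_integral (power_density_cont tg pG) (power_density_ge0 G tg)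
  (power_density_bounded tg pG) (prim_power_density tg pG) x0).
Qed.

End profile.

Lemma sharp_integral (R : realType) (p q : R) (g G : R -> R) :
  (1 < p)%R -> (p <= q)%R -> test_fun g -> prim g G ->
  \int[mu]_(x in `]0%R, +oo[) (weighted_density (conj_exp q) (conj_exp p) G g x)%:E <=
  (K_const p q `^ conj_exp p)%:E *
  (\int[mu]_(x in `]0%R, +oo[) (g x `^ conj_exp q)%:E) `^ (conj_exp p / conj_exp q).
Proof.
move=> p1 pq tg pG.
have q1 : (1 < q)%R by exact: lt_le_trans pq.
have k1 := conj_exp_gt1 q1; have l1 := conj_exp_gt1 p1; have kl := conj_exp_le p1 pq.
have k0 : (0 < conj_exp q)%R by exact: lt_trans k1.
have l0 : (0 < conj_exp p)%R by exact: lt_trans l1.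
have [|||U pU _] := @primP R (fun x => g x `^ conj_exp q)%R.
- by move=> x; exact: test_powR_cont.
- by move=> x _; exact: powR_ge0.
- exact: test_powR_bounded.
have [|||W pW _] := @primP R (weighted_density (conj_exp q) (conj_exp p) G g).
- by move=> x; exact: weighted_density_cont.
- by move=> x; exact: weighted_density_ge0.
- exact: weighted_density_bounded.
apply: (@prim_integral_y R (weighted_density (conj_exp q) (conj_exp p) G g) W _ _ _ _ pW).
- by move=> x; exact: weighted_density_cont.
- by move=> x; exact: weighted_density_ge0.
- exact: weighted_density_bounded.
move=> x x0.
have U0 y : (0 < y)%R -> (0 <= U y)%R.
  by apply: (prim_ge0 pU) => z _; exact: powR_ge0.
have Wx : (0 <= W x)%R by apply: (prim_ge0 pW) => //; exact: weighted_density_ge0.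
have [_ g0 _ _ _] := tg.
have := sharp_inequality p1 pq g0 (test_prim_gt0 tg pG) pG.1 pU.1 pW.1 U0 pW.2
  (test_level_cvg0 k1 tg pG) x0 Wx.
rewrite -lee_fin => /le_trans; apply; rewrite EFinM lee_pmul2l ?lte_fin ?powR_gt0 ?K_const_gt0//.
rewrite -poweR_EFin; apply: le_poweR; first by rewrite divr_ge0// ltW.
  by rewrite lee_fin U0.
apply: (prim_le_integral_y _ _ _ pU) => //.
- by move=> y; exact: test_powR_cont.
- by move=> y _; exact: powR_ge0.
- exact: test_powR_bounded.
Qed.

(** * The operator and its adjoint *)

Lemma measurable_levels (R : realType) (c : \bar R) :
  measurable [set t : LT R | (0 < t)%R /\ t%:E < c].
Proof.
apply: leb_measurable; apply: is_interval_measurable => u v /= [u0 uz] [v0 vz] s /andP[us sv].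
by split; [exact: lt_le_trans us|rewrite (le_lt_trans _ vz)// lee_fin].
Qed.

Section duality.
Variable R : realType.
Variable b : R -> \bar R.
Hypothesis hb : normal_form_parameter b.
Let b0 : forall x, (0 < x)%R -> 0 <= b x. Proof. exact: hb.1. Qed.
Let nib : forall x y, (0 < x)%R -> (x <= y)%R -> b y <= b x. Proof. exact: hb.2. Qed.

Lemma measurable_halfline : measurable (halfline R).
Proof. by apply: leb_measurable; exact: measurable_itv. Qed.

Lemma halflineP (x : R) : halfline R x <-> (0 < x)%R.
Proof. by rewrite /= in_itv/= andbT. Qed.

Lemma measurable_fun_halfline (f : R -> \bar R) :
  measurable_fun (pos R) f -> measurable_fun (halfline R) f.
Proof. by move=> mf; apply: leb_measurable_fun => //; exact: measurable_itv. Qed.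

Lemma leb_integral_halfline (f : R -> \bar R) :
  measurable_fun (pos R) f -> (forall x, (0 < x)%R -> 0 <= f x) ->
  \int[leb R]_(x in halfline R) f x = \int[mu]_(x in `]0%R, +oo[) f x.
Proof.
move=> mf f0; rewrite leb_integralE//.
by move=> x; rewrite /= in_itv/= andbT; exact: f0.
Qed.

(* The adjoint operator [t |-> int_0^(b^-1 t) g], as [x < b^-1 t] iff [t < b x]. *)
Definition adjoint_op (g : R -> \bar R) (t : R) : \bar R :=
  \int[mu]_(x in [set x : R | (0 < x)%R /\ t%:E < b x]) g x.

Let sublevel_seg (t : R) : (forall x : R, [set x | (0 < x)%R /\ t%:E < b x] x -> (0 < x)%R) /\
  (forall x y : R, (0 < x)%R -> (x <= y)%R -> [set x | (0 < x)%R /\ t%:E < b x] y ->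
     [set x | (0 < x)%R /\ t%:E < b x] x).
Proof.
split=> [x []//|x y x0 xy /= [y0 ty]]; split=> //.
by rewrite (lt_le_trans ty)// nib.
Qed.

Section adjoint.
Variable g : R -> \bar R.
Hypothesis mg : measurable_fun (pos R) g.
Hypothesis g0 : forall x, (0 < x)%R -> 0 <= g x.

Lemma adjoint_op_ge0 t : 0 <= adjoint_op g t.
Proof. by apply: integral_ge0 => x /= [x0 _]; exact: g0. Qed.

Let mg_sub (t : R) : measurable_fun [set x : R | (0 < x)%R /\ t%:E < b x] g.
Proof. by apply: measurable_funS mg => // x [x0 _] /=; rewrite in_itv/= x0. Qed.

Lemma adjoint_op_nincr t u : (t <= u)%R -> adjoint_op g u <= adjoint_op g t.
Proof.
move=> tu; apply: ge0_subset_integral.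
- exact: sublevel_measurable.
- exact: sublevel_measurable.
- exact: mg_sub.
- by move=> x [x0 _]; exact: g0.
- by move=> x [x0 ux]; split=> //; rewrite (le_lt_trans _ ux)// lee_fin.
Qed.

Lemma measurable_adjoint_op : measurable_fun (pos R) (adjoint_op g).
Proof. by apply: nonincreasing_emeasurable => t u _; exact: adjoint_op_nincr. Qed.

Lemma adjoint_op_le t : adjoint_op g t <= \int[mu]_(x in `]0%R, +oo[) g x.
Proof.
apply: ge0_subset_integral.
- exact: sublevel_measurable.
- exact: measurable_itv.
- exact: mg.
- by move=> x; rewrite /= in_itv/= andbT; exact: g0.
- by move=> x [x0 _]; rewrite /= in_itv/= x0.
Qed.

Lemma adjoint_op_leb t : \int[leb R]_(x in [set x : LT R | (0 < x)%R /\ t%:E < b x]) g x = adjoint_op g t.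
Proof.
rewrite leb_integralE//.
- exact: sublevel_measurable.
- exact: mg_sub.
- by move=> x [x0 _]; exact: g0.
Qed.

Lemma H_op_duality (f : LT R -> \bar R) : Lplus f ->
  \int[leb R]_(x in halfline R) (g x * H_op b f x) =
  \int[leb R]_(t in halfline R) (f t * adjoint_op g t).
Proof.
move=> [mf f0]; rewrite (tonelli_sublevel _ mf _ f0 g0); last 2 first.
- by apply: measurable_fun_halfline; apply: nonincreasing_emeasurable; exact: nib.
- exact: measurable_fun_halfline.
by apply: eq_integral => t _; rewrite adjoint_op_leb.
Qed.

Lemma integral_adjoint_op :
  \int[mu]_(t in `]0%R, +oo[) adjoint_op g t = \int[mu]_(x in `]0%R, +oo[) (g x * b x).
Proof.
transitivity (\int[mu]_(x in `]0%R, +oo[) (g x *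
    \int[mu]_(t in [set t : R | (0 < t)%R /\ t%:E < b x]) cst 1 t)); last first.
  apply: eq_integral => x; rewrite inE/= in_itv/= andbT => x0.
  by rewrite integral_sublevel_cst1// b0.
rewrite (tonelli_sublevelB _ (@measurable_cst _ _ _ _ _ 1) mg _ g0)//; last first.
  exact: nonincreasing_emeasurable.
by apply: eq_integral => t _; rewrite mul1e.
Qed.

Variables (l : R) (w : R -> \bar R).
Hypothesis l1 : (1 < l)%R.
Hypothesis mw : measurable_fun (pos R) w.
Hypothesis w0 : forall x, (0 < x)%R -> 0 <= w x.
Hypothesis gw : forall t : R, (0 < t)%R ->
  (\int[mu]_(x in `]0%R, t[) g x) `^ l = \int[mu]_(x in `]0%R, t[) w x.
Let l0 : (0 < l)%R. Proof. exact: lt_trans l1. Qed.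

(** Each inequality passes from (0, n) to the half-line by monotonicity, one of them after taking
    l-th roots. No continuity of the power at +oo is involved. *)
Let gw_halfline : (\int[mu]_(x in `]0%R, +oo[) g x) `^ l = \int[mu]_(x in `]0%R, +oo[) w x.
Proof.
have sub_le (f : R -> \bar R) n : measurable_fun (pos R) f ->
  (forall x, (0 < x)%R -> 0 <= f x) ->
  \int[mu]_(x in `]0%R, n%:R[) f x <= \int[mu]_(x in `]0%R, +oo[) f x.
  move=> mf f0; apply: ge0_subset_integral.
  - exact: measurable_itv.
  - exact: measurable_itv.
  - exact: mf.
  - by move=> x; rewrite /= in_itv/= andbT; exact: f0.
  - by move=> x; rewrite /= !in_itv/= => /andP[->].
have int_ge0 (D : set R) (f : R -> \bar R) : (forall x, D x -> (0 < x)%R) ->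
  (forall x, (0 < x)%R -> 0 <= f x) -> 0 <= \int[mu]_(x in D) f x.
  by move=> D0 f0; apply: integral_ge0 => x /D0; exact: f0.
have pos n : forall x : R, `]0%R, n%:R[%classic x -> (0 < x)%R.
  by move=> x /=; rewrite in_itv/= => /andP[].
have posy : forall x : R, `]0%R, +oo[%classic x -> (0 < x)%R.
  by move=> x /=; rewrite in_itv/= => /andP[].
have cg := integral_itv0y_cvg mg g0; have cw := integral_itv0y_cvg mw w0.
apply/eqP; rewrite eq_le; apply/andP; split.
  suff : \int[mu]_(x in `]0%R, +oo[) g x <= (\int[mu]_(x in `]0%R, +oo[) w x) `^ l^-1.
    move=> /(le_poweR (ltW l0) (int_ge0 _ _ posy g0)).
    by rewrite -poweRrM mulVf ?gt_eqF// poweRe1// int_ge0.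
  rewrite -(cvg_lim _ cg)//; apply: lime_le; first exact: cvgP cg.
  near=> n; have n0 : (0 < n%:R :> R)%R by rewrite ltr0n; near: n; exact: nbhs_infty_gt.
  have -> : \int[mu]_(x in `]0%R, n%:R[) g x = (\int[mu]_(x in `]0%R, n%:R[) w x) `^ l^-1.
    by rewrite -gw// -poweRrM mulfV ?gt_eqF// poweRe1//; exact: int_ge0 (pos n) g0.
  apply: le_poweR; first by rewrite invr_ge0 ltW.
    exact: int_ge0 (pos n) w0.
  exact: sub_le.
rewrite -(cvg_lim _ cw)//; apply: lime_le; first exact: cvgP cw.
near=> n; have n0 : (0 < n%:R :> R)%R by rewrite ltr0n; near: n; exact: nbhs_infty_gt.
rewrite -gw//; apply: le_poweR; [exact: ltW|exact: int_ge0 (pos n) g0|exact: sub_le].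
Unshelve. all: by end_near. Qed.

Lemma adjoint_op_pow t : adjoint_op g t `^ l = adjoint_op w t.
Proof.
rewrite /adjoint_op.
have [->|[c c0 E]|->] := initial_segment_integral (sublevel_seg t).1 (sublevel_seg t).2.
- by rewrite !integral_set0 poweR0r// gt_eqF.
- by rewrite !E// gw.
- exact: gw_halfline.
Qed.

End adjoint.

Lemma integral_adjoint_op_pow (g w : R -> \bar R) (l : R) : (1 < l)%R ->
  measurable_fun (pos R) g -> measurable_fun (pos R) w ->
  (forall x, (0 < x)%R -> 0 <= g x) -> (forall x, (0 < x)%R -> 0 <= w x) ->
  (forall t : R, (0 < t)%R ->
    (\int[mu]_(x in `]0%R, t[) g x) `^ l = \int[mu]_(x in `]0%R, t[) w x) ->
  \int[mu]_(t in `]0%R, +oo[) (adjoint_op g t `^ l) = \int[mu]_(x in `]0%R, +oo[) (w x * b x).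
Proof.
move=> l1 mg mw g0 w0 gw; rewrite -integral_adjoint_op//.
by apply: eq_integral => t _; exact: adjoint_op_pow.
Qed.

Lemma H_op_ge0 (f : LT R -> \bar R) x : Lplus f -> 0 <= H_op b f x.
Proof. by move=> [_ f0]; apply: integral_ge0 => t /= [t0 _]; exact: f0. Qed.

Lemma H_op_nincr (f : LT R -> \bar R) : Lplus f ->
  forall x y, (0 < x)%R -> (x <= y)%R -> H_op b f y <= H_op b f x.
Proof.
move=> [mf f0] x y x0 xy.
have ms z := measurable_levels (b z).
apply: ge0_subset_integral; [exact: ms|exact: ms| | |].
- by apply: measurable_funS mf => //; [exact: measurable_halfline|move=> t [t0 _]; exact/halflineP].
- by move=> t [t0 _]; exact: f0.
- by move=> t [t0 ty]; split=> //; rewrite (lt_le_trans ty)// nib.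
Qed.

Lemma normpE (p : R) (f : LT R -> \bar R) : (0 < p)%R -> (forall x, (0 < x)%R -> 0 <= f x) ->
  normp p f = (\int[leb R]_(x in halfline R) (f x `^ p)) `^ p^-1.
Proof.
move=> p0 f0; rewrite /normp unlock /Lnorm/=; congr (_ `^ _).
rewrite [RHS]integral_mkcond; apply: eq_integral => x _; rewrite /patch.
case: ifPn => [/set_mem/halflineP x0|_].
  by rewrite gee0_abs// f0.
by rewrite abse0 poweR0r// gt_eqF.
Qed.

End duality.

(** * Upper bound *)

(** Division by x^(1-a). For x = +oo nothing could be concluded, which is why it is applied to
    truncated integrals only. *)
Lemma self_bound (R : realType) (a : R) (x C : \bar R) : (0 < a)%R -> 0 <= x -> x < +oo -> 0 <= C ->
  x <= C * x `^ (1 - a) -> x `^ a <= C.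
Proof.
move=> a0; case: x => [x| |]//; rewrite lee_fin => x0 _.
move: C => [c| |]//; rewrite ?leey// lee_fin => c0.
have [->|xn] := eqVneq x 0%R; first by move=> _; rewrite poweR0r ?gt_eqF// lee_fin.
have xgt : (0 < x)%R by rewrite lt0r xn.
rewrite !poweR_EFin -EFinM !lee_fin => H.
rewrite -(ler_pM2r (powR_gt0 (1 - a) xgt)) -powRD ?(gt_eqF xgt) ?implybT//.
by rewrite addrC subrK powRr1.
Qed.

(** Removes the factor lost by smoothing. *)
Lemma lee_mul_gt1 (R : realType) (x C : \bar R) : 0 <= C ->
  (forall m : R, (1 < m)%R -> x <= m%:E * C) -> x <= C.
Proof.
case: C => [c| |]//; rewrite ?leey// lee_fin => c0 H.
apply/lee_addgt0Pr => e e0; have c1 : (0 < c + 1)%R by rewrite ltr_wpDl.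
apply: (le_trans (H (1 + e / (c + 1))%R _)); first by rewrite ltrDl divr_gt0.
rewrite -EFinM -EFinD lee_fin mulrDl mul1r lerD2l -mulrA ler_piMr ?(ltW e0)//.
by rewrite mulrC ler_pdivrMr// mul1r lerDl.
Qed.

Lemma integral_powRB1 (R : realType) (s t : R) : (1 <= s)%R -> (0 < t)%R ->
  \int[mu]_(x in `]0%R, t[) (x `^ (s - 1))%:E = (s^-1 * t `^ s)%:E.
Proof.
move=> s1 t0; have s0 : (0 < s)%R by exact: lt_le_trans s1.
apply: (@prim_integral R (fun x => x `^ (s - 1))%R (fun x => s^-1 * x `^ s)%R) => //.
- move=> x x0; exact: continuous_powR_at.
- by move=> x _; exact: powR_ge0.
- move=> X; exists (X `^ (s - 1))%R => x /andP[x0 xX].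
  apply: le_powR_nneg; [by rewrite subr_ge0|exact: ltW|exact: xX].
split.
  move=> x x0; apply: (is_derive_ext (deriveZ_fun s^-1 (derive_powR_fun s x0 (derive_id_fun x)))).
  by field; rewrite gt_eqF.
rewrite -[X in _ --> X](mulr0 s^-1%R); apply: cvgM; first exact: cvg_cst.
exact: powR_cvg0.
Qed.

Section c2_bounds.
Variable R : realType.
Variables p q : R.
Hypothesis p1 : (1 < p)%R.
Hypothesis pq : (p <= q)%R.
Variable b : R -> \bar R.
Hypothesis hb : normal_form_parameter b.
Let k := conj_exp q.
Let l := conj_exp p.
Let q1 : (1 < q)%R. Proof. exact: lt_le_trans pq. Qed.
Let k1 : (1 < k)%R. Proof. exact: conj_exp_gt1. Qed.
Let l1 : (1 < l)%R. Proof. exact: conj_exp_gt1. Qed.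
Let kl : (k <= l)%R. Proof. exact: conj_exp_le. Qed.
Let k0 : (0 < k)%R. Proof. exact: lt_trans k1. Qed.
Let l0 : (0 < l)%R. Proof. exact: lt_trans l1. Qed.
Let p0 : (0 < p)%R. Proof. exact: lt_trans p1. Qed.
Let q0 : (0 < q)%R. Proof. exact: lt_trans q1. Qed.
Let pinv : (p^-1 = 1 - l^-1)%R.
Proof. by rewrite conj_exp_inv opprB addrC subrK. Qed.
Let qinv : (q^-1 = 1 - k^-1)%R.
Proof. by rewrite conj_exp_inv opprB addrC subrK. Qed.
Let b0 : forall x, (0 < x)%R -> 0 <= b x. Proof. exact: hb.1. Qed.
Let nib : forall x y, (0 < x)%R -> (x <= y)%R -> b y <= b x. Proof. exact: hb.2. Qed.

Definition weight (x : R) : \bar R := (x `^ (conj_exp p - 1))%:E * b x.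

Lemma weight_ge0 x : (0 < x)%R -> 0 <= weight x.
Proof. by move=> x0; rewrite mule_ge0 ?b0// lee_fin powR_ge0. Qed.

Lemma measurable_weight : measurable_fun (pos R) weight.
Proof.
apply: emeasurable_funM; last exact: nonincreasing_emeasurable.
exact: measurable_EFin_powR.
Qed.

Lemma integral_cpowR (c t : R) : (0 <= c)%R -> (0 <= t)%R ->
  \int[mu]_(x in `]0%R, t[) (c%:E * (x `^ (l / k - 1))%:E) = (c * (k / l * t `^ (l / k)))%:E.
Proof.
move=> c0; rewrite le_eqVlt => /predU1P[<-|t0].
  by rewrite set_itvoo0 ?integral_set0 ?powR0 ?mulr0// gt_eqF// divr_gt0.
rewrite ge0_integralZl_segment//; last 2 first.
- exact: measurable_EFin_powR.
- by move=> x _; rewrite lee_fin powR_ge0.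
by rewrite integral_powRB1// ?invf_div -?EFinM// ler_pdivlMr// mul1r.
Qed.

(** The factor (k / l) t^(l/k) is the integral of x^(l/k-1) over (0, t); thus the l-th power of [c2]
    is the ratio of two integrals, and a bound for [c2] is a comparison of integrals over (0, t). *)
Lemma c2_powR (t : R) : (0 < t)%R ->
  \int[mu]_(x in `]0%R, t[) weight x = (k / l * t `^ (l / k))%:E * c2 p q b t `^ l.
Proof.
move=> t0; have X0 : 0 <= \int[mu]_(x in `]0%R, t[) weight x.
  by apply: integral_ge0 => x /=; rewrite in_itv/= => /andP[x0 _]; exact: weight_ge0.
have sub : `]0%R, t[%classic `<=` (`]0%R, +oo[%classic : set R).
  by move=> x; rewrite /= !in_itv/= => /andP[->].
rewrite /c2 -/k -/l leb_integralE; last 3 first.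
- exact: measurable_itv.
- by apply: measurable_funS measurable_weight => //; exact: measurable_itv.
- by move=> x; rewrite /= in_itv/= => /andP[x0 _]; exact: weight_ge0.
rewrite -/(weight) poweRM ?poweR_ge0 ?lee_fin ?powR_ge0// -poweRrM mulVf ?gt_eqF//.
rewrite poweRe1; last by rewrite mule_ge0// lee_fin divr_ge0// ltW.
rewrite poweR_EFin -powRrM !muleA -!EFinM.
rewrite (_ : _ * _ * _ = 1)%R ?mul1e//.
have -> : (- k^-1 * l = - (l / k))%R by rewrite mulNr mulrC.
by rewrite powRN; field; rewrite !gt_eqF ?powR_gt0.
Qed.

Lemma weight_le_of_c2 (A : R) (t : R) : (0 <= A)%R -> (0 < t)%R -> c2 p q b t <= A%:E ->
  \int[mu]_(x in `]0%R, t[) weight x <=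
  \int[mu]_(x in `]0%R, t[) ((A `^ l)%:E * (x `^ (l / k - 1))%:E).
Proof.
move=> A0 t0 cA.
have kt : (0 < k / l * t `^ (l / k))%R by rewrite mulr_gt0 ?powR_gt0// divr_gt0.
rewrite (integral_cpowR (powR_ge0 _ _) (ltW t0)) c2_powR// [leRHS]EFinM muleC lee_pmul2r//.
rewrite -poweR_EFin; apply: le_poweR => //; first exact: ltW.
by rewrite /c2 mule_ge0 ?poweR_ge0// lee_fin powR_ge0.
Qed.

(** Splits b d(G^l) into [weight], which is controlled only through its integrals over (0, t), and a
    nonincreasing factor. *)
Lemma power_density_weight (g G : R -> R) (x : R) : (0 < x)%R -> test_fun g -> prim g G ->
  (power_density l G g x)%:E * b x = weight x * (l * (G x / x) `^ (l - 1) * g x)%:E.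
Proof.
move=> x0 tg pG; have Gx := test_prim_gt0 tg pG x0.
rewrite /weight muleAC -EFinM; congr (_%:E * _).
rewrite /power_density powRM ?invr_ge0 ?(ltW Gx) ?(ltW x0)//.
rewrite -[in RHS](powR_inv1 (ltW x0)) -powRrM mulN1r powRN -/l.
by field; rewrite gt_eqF// powR_gt0.
Qed.

Lemma weighted_density_weight (g G : R -> R) (x c : R) : (0 < x)%R -> test_fun g -> prim g G ->
  (c%:E * (x `^ (l / k - 1))%:E) * (l * (G x / x) `^ (l - 1) * g x)%:E =
  (c * weighted_density k l G g x)%:E.
Proof.
move=> x0 tg pG; have Gx := test_prim_gt0 tg pG x0.
rewrite -!EFinM; congr (_%:E).
rewrite /weighted_density /power_density powRM ?invr_ge0 ?(ltW Gx) ?(ltW x0)//.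
rewrite -[in LHS](powR_inv1 (ltW x0)) -[in LHS]powRrM mulN1r.
have -> : (x `^ (- ((k - 1) * l / k)) = x `^ (l / k - 1) * x `^ (- (l - 1)))%R.
  rewrite -(powRDp _ _ x0).
  by congr (_ `^ _)%R; field; rewrite gt_eqF.
by ring.
Qed.

Lemma measurable_test (g : R -> R) : test_fun g -> measurable_fun (pos R) (EFin \o g).
Proof. by move=> [cg _ _ _ _]; apply/measurable_EFinP; exact: continuous_positive_itv. Qed.

Lemma measurable_powR_itv (c s : R) : measurable_fun (pos R) (fun x : R => c%:E * (x `^ s)%:E).
Proof.
apply: measurable_funeM; exact: measurable_EFin_powR.
Qed.

Lemma adjoint_op_norm_le (A : R) (g G : R -> R) : (0 <= A)%R ->
  (forall t, (0 < t)%R -> c2 p q b t <= A%:E) -> test_fun g -> prim g G ->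
  \int[mu]_(t in `]0%R, +oo[) (adjoint_op b (EFin \o g) t `^ l) <=
  (A `^ l * K_const p q `^ l)%:E *
  (\int[mu]_(x in `]0%R, +oo[) (g x `^ k)%:E) `^ (l / k).
Proof.
move=> A0 hA tg pG; have [cg g0 nig _ _] := tg.
have -> : \int[mu]_(t in `]0%R, +oo[) (adjoint_op b (EFin \o g) t `^ l) =
  \int[mu]_(x in `]0%R, +oo[) ((EFin \o power_density l G g) x * b x).
  apply: (integral_adjoint_op_pow hb l1).
  - exact: measurable_test.
  - by apply/measurable_EFinP; apply: continuous_positive_itv => x x0; exact: (power_density_cont tg pG).
  - by move=> x x0; rewrite lee_fin g0.
  - by move=> x x0; rewrite /= lee_fin; exact: (power_density_ge0 k1 kl G tg).
  - by move=> t t0; exact: (power_density_integral k1 kl tg pG).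
apply: (@le_trans _ _ ((A `^ l)%:E * \int[mu]_(x in `]0%R, +oo[) (weighted_density k l G g x)%:E)); last first.
  rewrite EFinM -muleA; apply: lee_wpmul2l; first by rewrite lee_fin powR_ge0.
  exact: sharp_integral.
have phi0 (x : R) : (0 < x)%R -> 0 <= (l * (G x / x) `^ (l - 1) * g x)%:E.
  by move=> x0; rewrite lee_fin mulr_ge0 ?g0// mulr_ge0 ?powR_ge0// ltW.
have niphi (x y : R) : (0 < x)%R -> (x <= y)%R -> (l * (G y / y) `^ (l - 1) * g y)%:E <= (l * (G x / x) `^ (l - 1) * g x)%:E.
  by move=> x0 xy; rewrite lee_fin; exact: (slope_density_nincr k1 kl).
have := @integral_nonincreasing_comparison R (fun x => (l * (G x / x) `^ (l - 1) * g x)%:E)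
  weight (fun x => (A `^ l)%:E * (x `^ (l / k - 1))%:E) phi0 niphi measurable_weight
  (measurable_powR_itv _ _) weight_ge0.
have g20 (x : R) : (0 < x)%R -> 0 <= (A `^ l)%:E * (x `^ (l / k - 1))%:E.
  by move=> x0; rewrite mule_ge0// lee_fin powR_ge0.
move=> /(_ g20) /(_ (fun t t0 => weight_le_of_c2 A0 t0 (hA t t0))) H.
have E1 : \int[mu]_(x in `]0%R, +oo[) ((EFin \o power_density l G g) x * b x) =
  \int[mu]_(x in `]0%R, +oo[) (weight x * (l * (G x / x) `^ (l - 1) * g x)%:E).
  apply: eq_integral => x; rewrite inE/= in_itv/= andbT => x0; exact: power_density_weight.
have E2 : (A `^ l)%:E * \int[mu]_(x in `]0%R, +oo[) (weighted_density k l G g x)%:E =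
  \int[mu]_(x in `]0%R, +oo[) ((A `^ l)%:E * (x `^ (l / k - 1))%:E * (l * (G x / x) `^ (l - 1) * g x)%:E).
  rewrite -ge0_integralZl_halfline ?powR_ge0//.
  - apply: eq_integral => x; rewrite inE/= in_itv/= andbT => x0.
    by rewrite weighted_density_weight.
  - apply: continuous_positive_itv => x x0; exact: weighted_density_cont.
  - by move=> x x0; exact: weighted_density_ge0.
by rewrite E1 E2.
Qed.

Lemma test_duality_bound (A : R) (f : LT R -> \bar R) (g G : R -> R) : (0 <= A)%R ->
  (forall t, (0 < t)%R -> c2 p q b t <= A%:E) -> Lplus f -> test_fun g -> prim g G ->
  \int[leb R]_(x in halfline R) ((g x)%:E * H_op b f x) <=
  normp p f * ((A * K_const p q)%:E * (\int[mu]_(x in `]0%R, +oo[) (g x `^ k)%:E) `^ k^-1).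
Proof.
move=> A0 hA Lf tg pG; have [mf f0] := Lf; have [cg g0 nig _ _] := tg.
have mg := measurable_test tg.
have g0' x : (0 < x)%R -> 0 <= (EFin \o g) x by move=> x0; rewrite lee_fin g0.
rewrite (H_op_duality hb mg g0' Lf).
have ma := measurable_adjoint_op hb mg g0'.
have a0 t : 0 <= adjoint_op b (EFin \o g) t by exact: adjoint_op_ge0.
have pl : (p^-1 + l^-1 = 1)%R by rewrite pinv subrK.
apply: (le_trans (hoelder_ge0 _ (@measurable_halfline R) mf (measurable_fun_halfline ma) _ _ p0 l0 pl)).
- by move=> x /halflineP; exact: f0.
- by move=> x _; exact: a0.
rewrite normpE//; apply: lee_wpmul2l; first exact: poweR_ge0.
rewrite leb_integral_halfline; last 2 first.
- by apply: (measurableT_comp (measurable_poweR l)).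
- by move=> x _; exact: poweR_ge0.
have I0 : 0 <= \int[mu]_(x in `]0%R, +oo[) (g x `^ k)%:E.
  by apply: integral_ge0 => x _; rewrite lee_fin powR_ge0.
have K0 := K_const_gt0 p1 pq.
apply: (le_trans (le_poweR _ _ (adjoint_op_norm_le A0 hA tg pG))).
- by rewrite invr_ge0 ltW.
- by apply: integral_ge0 => t _; exact: poweR_ge0.
rewrite poweRM ?poweR_ge0//; last by rewrite lee_fin mulr_ge0 ?powR_ge0.
rewrite -poweRrM -powRM ?(ltW K0)// poweR_EFin -powRrM mulfV ?gt_eqF// powRr1; last first.
  by rewrite mulr_ge0// ltW.
rewrite (_ : l / k / l = k^-1)%R//; by field; rewrite !gt_eqF.
Qed.

End c2_bounds.

(** * Smoothing of nonincreasing functions *)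

Section smoothing.
Variable R : realType.
Implicit Types x y : R.
Variables (g : R -> R) (M : R).
Hypothesis g0 : forall x, (0 < x)%R -> (0 <= g x)%R.
Hypothesis gM : forall x, (0 < x)%R -> (g x <= M)%R.
Hypothesis nig : forall x y, (0 < x)%R -> (x <= y)%R -> (g y <= g x)%R.

Lemma measurable_nincr : measurable_fun (pos R) (EFin \o g).
Proof. by apply: nonincreasing_emeasurable => x y x0 xy; rewrite lee_fin; exact: nig. Qed.

Lemma nincr_integral_bounds x y : (0 < x)%R -> (x <= y)%R ->
  ((y - x) * g y)%:E <= \int[mu]_(z in `[x, y[) (g z)%:E <= ((y - x) * g x)%:E.
Proof.
move=> x0; rewrite le_eqVlt => /predU1P[<-|xy].
  by rewrite subrr !mul0r set_itvco0// integral_set0 lexx.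
have m1 : measurable (`[x, y[%classic : set R) by exact: measurable_itv.
have E (c : R) : \int[mu]_(z in `[x, y[) (cst c%:E z) = ((y - x) * c)%:E.
  rewrite integral_cst//= lebesgue_measure_itv/= lte_fin xy -EFinD -EFinM.
  by rewrite mulrC.
have mg' : measurable_fun (`[x, y[ : set R) (EFin \o g).
  apply: (@measurable_funS _ _ _ _ (`]0%R, +oo[ : set R)) measurable_nincr => // z.
  by rewrite /= !in_itv/= andbT => /andP[xz _]; exact: lt_le_trans xz.
rewrite -!E; apply/andP; split; apply: ge0_le_integral => //.
- by move=> z _; rewrite lee_fin g0// (lt_trans x0).
- move=> z; rewrite /= in_itv/= => /andP[xz zy]; rewrite lee_fin nig ?(ltW zy)//.
  exact: lt_le_trans xz.
- by move=> z; rewrite /= in_itv/= => /andP[xz _]; rewrite lee_fin g0// (lt_le_trans x0).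
- by move=> z; rewrite /= in_itv/= => /andP[xz _]; rewrite lee_fin nig.
Qed.

(** Where [g] jumps its primitive has no derivative; two-sided bounds on chords take the place of
    differentiation. *)
Lemma nincr_primitive : exists G : R -> R, forall x y, (0 < x)%R -> (x <= y)%R ->
  ((y - x) * g y <= G y - G x <= (y - x) * g x)%R.
Proof.
have M0 : (0 <= M)%R by apply: le_trans (g0 ltr01) (gM ltr01).
have mx x : measurable_fun (`]0%R, x[ : set R) (EFin \o g).
  exact: measurable_fun_segment measurable_nincr.
have Ifin x : (0 < x)%R -> \int[mu]_(z in `]0%R, x[) (g z)%:E \is a fin_num.
  move=> x0; rewrite ge0_fin_numE; last first.
    by apply: integral_ge0 => z; rewrite /= in_itv/= => /andP[z0 _]; rewrite lee_fin g0.
  apply: (@le_lt_trans _ _ (\int[mu]_(z in `]0%R, x[) (cst M%:E z))).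
    apply: ge0_le_integral => //.
    - by move=> z; rewrite /= in_itv/= => /andP[z0 _]; rewrite lee_fin g0.
    - exact: mx.
    - by move=> z; rewrite /= in_itv/= => /andP[z0 _]; rewrite lee_fin gM.
  rewrite integral_cst//=.
  by rewrite lebesgue_measure_itv/= lte_fin x0 -EFinD -EFinM ltry.
exists (fun x => fine (\int[mu]_(z in `]0%R, x[) (g z)%:E)) => x y x0 xy.
have y0 : (0 < y)%R by exact: lt_le_trans xy.
have U : `]0%R, y[%classic = `]0%R, x[%classic `|` (`[x, y[%classic : set R).
  apply/seteqP; split => z /=; rewrite !in_itv/=.
    by move=> /andP[z0 zy]; case: (ltP z x) => zx; [left|right]; rewrite ?z0 ?zx ?zy.
  by move=> [/andP[-> zx]|/andP[xz ->]]; rewrite ?andbT/= ?(lt_le_trans zx)// (lt_le_trans x0).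
have E : \int[mu]_(z in `]0%R, y[) (g z)%:E =
    \int[mu]_(z in `]0%R, x[) (g z)%:E + \int[mu]_(z in `[x, y[) (g z)%:E.
  rewrite U; apply: ge0_integral_setU.
  - exact: measurable_itv.
  - exact: measurable_itv.
  - by rewrite -U; exact: mx.
  - by rewrite -U => z; rewrite /= in_itv/= => /andP[z0 _]; rewrite lee_fin g0.
  - apply/disj_set2P; apply/seteqP; split => // z [] /=; rewrite !in_itv/=.
    by move=> /andP[_ zx] /andP[xz _]; move: (lt_le_trans zx xz); rewrite ltxx.
have := nincr_integral_bounds x0 xy.
have If : \int[mu]_(z in `[x, y[) (g z)%:E \is a fin_num.
  by have := Ifin _ y0; rewrite E fin_numD => /andP[].
rewrite E (fineD (Ifin _ x0) If) addrAC subrr add0r => /andP[h1 h2].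
by rewrite -!lee_fin fineK// h1 h2.
Qed.

(* [h x] is the mean of [g] over [[x, m * x]]; the loss [g (m * x)] is recovered by
   scaling, as [m] tends to [1]. *)
Lemma nincr_smoothing (m : R) : (1 < m)%R -> exists h : R -> R,
  [/\ forall x, (0 < x)%R -> {for x, continuous h},
      forall x y, (0 < x)%R -> (x <= y)%R -> (h y <= h x)%R &
      forall x, (0 < x)%R -> (g (m * x) <= h x <= g x)%R].
Proof.
move=> m1; have [G bG] := nincr_primitive.
have m0 : (0 < m)%R by exact: lt_trans m1.
have mB : (0 < m - 1)%R by rewrite subr_gt0.
have M0 : (0 <= M)%R by apply: le_trans (g0 ltr01) (gM ltr01).
have cG x : (0 < x)%R -> {for x, continuous G}.
  move=> x0; apply/cvgrPdist_le => e e0.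
  have L y z : (0 < y)%R -> (y <= z)%R -> (`|G z - G y| <= M * `|z - y|)%R.
    move=> y0 yz; have z0 := lt_le_trans y0 yz.
    have /andP[d1 d2] := bG _ _ y0 yz.
    rewrite (ger0_norm (_ : 0 <= z - y)%R) ?subr_ge0// ger0_norm; last first.
      by apply: le_trans d1; rewrite mulr_ge0 ?subr_ge0 ?g0.
    by apply: (le_trans d2); rewrite mulrC ler_wpM2r ?subr_ge0// gM.
  have L' y z : (0 < y)%R -> (0 < z)%R -> (`|G z - G y| <= M * `|z - y|)%R.
    move=> y0 z0; case: (leP y z) => [yz|/ltW zy]; first exact: L.
    by rewrite distrC (distrC z); exact: L.
  have M1 : (0 < M + 1)%R by rewrite ltr_wpDl.
  have nb : \forall y \near x, (`|x - y| <= e / (M + 1))%R.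
    by apply: filterS (nbhsx_ballx x _ (divr_gt0 e0 M1)) => z /ltW.
  near=> y.
  have y0 : (0 < y)%R by near: y; exact: lt_nbhsr.
  apply: (le_trans (L' y x y0 x0)).
  have yx : (`|x - y| <= e / (M + 1))%R by near: y.
  apply: (@le_trans _ _ ((M + 1) * `|x - y|)%R); first by rewrite ler_wpM2r// lerDl.
  by rewrite mulrC -ler_pdivlMr.
exists (fun x => (G (m * x) - G x) / ((m - 1) * x))%R; split.
- move=> x x0; apply: continuousM.
    apply: continuousB; last exact: cG.
    apply: (@continuous_comp _ _ _ (fun x => m * x)%R G).
      by apply: continuousM; [exact: cst_continuous|exact: cvg_id].
    by apply: cG; rewrite mulr_gt0.
  apply: continuousV; first by rewrite mulf_neq0 ?gt_eqF.
  by apply: continuousM; [exact: cst_continuous|exact: cvg_id].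
- move=> x y x0 xy; have y0 := lt_le_trans x0 xy.
  rewrite ler_pdivrMr ?mulr_gt0// mulrAC ler_pdivlMr ?mulr_gt0//.
  rewrite !(mulrCA _ (m - 1)%R) ler_pM2l//.
  have mx : (x <= m * x)%R by rewrite ler_peMl// ltW.
  have my : (y <= m * y)%R by rewrite ler_peMl// ltW.
  have mx0 := lt_le_trans x0 mx.
  (* Either the averaging intervals [x, m x] and [y, m y] do not overlap, and [g (m * x)] separates
     the means, or the integral N over their common part occurs in both. *)
  case: (leP (m * x)%R y) => [mxy|/ltW ymx].
    have /andP[a1 _] := bG _ _ x0 mx; have /andP[_ a2] := bG _ _ y0 my.
    have a3 := nig mx0 mxy.
    apply: (@le_trans _ _ ((m - 1) * y * g (m * x) * x)%R).
      rewrite ler_wpM2r ?(ltW x0)//; apply: (le_trans a2).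
      rewrite (_ : m * y - y = (m - 1) * y)%R; last by ring.
      by rewrite ler_wpM2l// mulr_ge0// ltW.
    rewrite [leLHS](_ : _ = ((m * x - x) * g (m * x) * y))%R; last by ring.
    by rewrite ler_wpM2r// ltW.
  have mxy : (m * x <= m * y)%R by rewrite ler_pM2l.
  have /andP[a1 _] := bG _ _ x0 xy.
  have /andP[b1 _] := bG _ _ y0 ymx.
  have /andP[_ d2] := bG _ _ mx0 mxy.
  have a3 := nig y0 ymx.
  set N := (G (m * x) - G y)%R in b1.
  have -> : (G (m * x) - G x = (G y - G x) + N)%R by rewrite /N; ring.
  have -> : (G (m * y) - G y = N + (G (m * y) - G (m * x)))%R by rewrite /N; ring.
  apply: (@le_trans _ _ ((N + (m * y - m * x) * g (m * x)) * x)%R).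
    by rewrite ler_wpM2r ?(ltW x0)// lerD2l.
  apply: (@le_trans _ _ (((y - x) * g y + N) * y)%R); last by rewrite ler_wpM2r ?(ltW y0)// lerD2r.
  rewrite -subr_ge0 [leRHS](_ : _ = (y - x) * (y * (g y - g (m * x)) + (N - (m * x - y) * g (m * x))))%R; last by ring.
  by rewrite mulr_ge0 ?subr_ge0// addr_ge0 ?subr_ge0// mulr_ge0 ?subr_ge0// ltW.
- move=> x x0; have mx : (x <= m * x)%R by rewrite ler_peMl// ltW.
  have /andP[a1 a2] := bG _ _ x0 mx.
  rewrite ler_pdivlMr ?mulr_gt0// ler_pdivrMr ?mulr_gt0//.
  have -> : ((m - 1) * x = m * x - x)%R by ring.
  by rewrite (mulrC (g (m * x))) a1 (mulrC (g x)).
Unshelve. all: by end_near.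
Qed.

End smoothing.

Section upper_bound.
Variable R : realType.
Variables p q : R.
Hypothesis p1 : (1 < p)%R.
Hypothesis pq : (p <= q)%R.
Variable b : R -> \bar R.
Hypothesis hb : normal_form_parameter b.
Let k := conj_exp q.
Let l := conj_exp p.
Let q1 : (1 < q)%R. Proof. exact: lt_le_trans pq. Qed.
Let k1 : (1 < k)%R. Proof. exact: conj_exp_gt1. Qed.
Let k0 : (0 < k)%R. Proof. exact: lt_trans k1. Qed.
Let p0 : (0 < p)%R. Proof. exact: lt_trans p1. Qed.
Let q0 : (0 < q)%R. Proof. exact: lt_trans q1. Qed.
Let qinv : (q^-1 = 1 - k^-1)%R.
Proof. by rewrite conj_exp_inv opprB addrC subrK. Qed.
Variables (A : R) (f : LT R -> \bar R).
Hypothesis A0 : (0 <= A)%R.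
Hypothesis hA : forall t, (0 < t)%R -> c2 p q b t <= A%:E.
Hypothesis Lf : Lplus f.

Let H_pos x : 0 <= H_op b f x. Proof. exact: H_op_ge0. Qed.
Let mH : measurable_fun (pos R) (H_op b f).
Proof. by apply: nonincreasing_emeasurable; exact: H_op_nincr. Qed.

(** The substitution of m x for x costs the factor m and replaces g by g(m x) <= h x and the
    nonincreasing [H_op b f] by a smaller function. As h <= g, the norm on the right does not
    grow. *)
Lemma nincr_duality_bound (g : R -> R) (M : R) :
  (forall x, (0 < x)%R -> (0 <= g x)%R) -> (forall x, (0 < x)%R -> (g x <= M)%R) ->
  (forall x y, (0 < x)%R -> (x <= y)%R -> (g y <= g x)%R) ->
  \int[mu]_(x in `]0%R, +oo[) ((g x)%:E * H_op b f x) <=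
  normp p f * ((A * K_const p q)%:E * (\int[mu]_(x in `]0%R, +oo[) (g x `^ k)%:E) `^ k^-1).
Proof.
move=> g0 gM nig; have K0 := ltW (K_const_gt0 p1 pq).
have N0 : 0 <= normp p f by rewrite normpE ?poweR_ge0//; exact: Lf.2.
apply: lee_mul_gt1.
  by rewrite mule_ge0// mule_ge0 ?poweR_ge0// lee_fin mulr_ge0.
move=> m m1; have m0 : (0 < m)%R by exact: lt_trans m1.
have [h [ch nih hg]] := nincr_smoothing g0 gM nig m1.
have h0 x : (0 < x)%R -> (0 <= h x)%R.
  by move=> x0; have /andP[+ _] := hg _ x0; apply: le_trans; rewrite g0// mulr_gt0.
have hM x : (0 < x)%R -> (h x <= M)%R.
  by move=> x0; have /andP[_ h2] := hg _ x0; exact: le_trans (gM _ x0).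
have mg : measurable_fun (pos R) (EFin \o g) by exact: measurable_nincr nig.
have mh : measurable_fun (pos R) (EFin \o h) by exact: measurable_nincr nih.
have mgH : measurable_fun (pos R) (fun x => (g x)%:E * H_op b f x).
  exact: emeasurable_funM mg mH.
have gH0 x : (0 < x)%R -> 0 <= (g x)%:E * H_op b f x.
  by move=> x0; rewrite mule_ge0// lee_fin g0.
have E : \int[mu]_(x in `]0%R, +oo[) ((g x)%:E * H_op b f x) =
    m%:E * \int[mu]_(x in `]0%R, +oo[) ((g (m * x))%:E * H_op b f (m * x)%R).
  rewrite (ge0_integral_scale m0 mgH gH0) muleA -EFinM mulfV ?gt_eqF//.
  by rewrite mul1e.
rewrite E; apply: lee_wpmul2l; first by rewrite lee_fin ltW.
have mhH : measurable_fun (pos R) (fun x => (h x)%:E * H_op b f x).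
  exact: emeasurable_funM mh mH.
have nigm x y : (0 < x)%R -> (x <= y)%R -> (g (m * y) <= g (m * x))%R.
  by move=> x0 xy; rewrite nig ?mulr_gt0// ler_pM2l.
have niHm x y : (0 < x)%R -> (x <= y)%R -> H_op b f (m * y)%R <= H_op b f (m * x)%R.
  by move=> x0 xy; apply: (H_op_nincr hb Lf); rewrite ?mulr_gt0// ler_pM2l.
have mgHm : measurable_fun (pos R) (fun x => (g (m * x))%:E * H_op b f (m * x)%R).
  apply: emeasurable_funM; last exact: nonincreasing_emeasurable niHm.
  exact: measurable_nincr nigm.
apply: (@le_trans _ _ (\int[mu]_(x in `]0%R, +oo[) ((h x)%:E * H_op b f x))).
  apply: ge0_le_integral => //.
  - by move=> x; rewrite /= in_itv/= andbT => x0; rewrite gH0// mulr_gt0.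
  - move=> x; rewrite /= in_itv/= andbT => x0; apply: lee_pmul => //.
    + by rewrite lee_fin g0// mulr_gt0.
    + by rewrite lee_fin; have /andP[] := hg _ x0.
    + by apply: (H_op_nincr hb Lf) => //; rewrite ler_peMl// ltW.
apply: (@le_trans _ _ (normp p f * ((A * K_const p q)%:E *
    (\int[mu]_(x in `]0%R, +oo[) (h x `^ k)%:E) `^ k^-1))).
  (* A test function takes a positive value, so h = 0 is treated apart. *)
  have [nz|z] := pselect (exists2 x, (0 < x)%R & (0 < h x)%R).
    have th : test_fun h by split => //; exists M.
    have [G [U [W [pG _ _ _]]]] := profileP k1 (conj_exp_le p1 pq) th.
    rewrite -(leb_integral_halfline mhH); last first.
      by move=> x x0; rewrite mule_ge0// lee_fin h0.
    exact: (test_duality_bound p1 pq hb A0 hA Lf th pG).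
  rewrite (_ : \int[mu]_(x in _) _ = 0); first by rewrite mule_ge0// mule_ge0 ?poweR_ge0// lee_fin mulr_ge0.
  apply: integral0_eq => x; rewrite /= in_itv/= andbT => x0.
  have -> : h x = 0%R; last by rewrite mul0e.
  by apply/eqP; rewrite eq_le h0// andbT leNgt; apply/negP => hx; apply: z; exists x.
apply: lee_wpmul2l => //; apply: lee_wpmul2l; first by rewrite lee_fin mulr_ge0.
have Ik (u : R -> R) : 0 <= \int[mu]_(x in `]0%R, +oo[) (u x `^ k)%:E.
  by apply: integral_ge0 => x _; rewrite lee_fin powR_ge0.
apply: le_poweR => //; first by rewrite invr_ge0 ltW.
have nik (u : R -> R) : (forall x, (0 < x)%R -> (0 <= u x)%R) ->
    (forall x y, (0 < x)%R -> (x <= y)%R -> (u y <= u x)%R) ->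
    measurable_fun (pos R) (fun x => (u x `^ k)%:E).
  move=> u0 niu; apply: nonincreasing_emeasurable => x y x0 xy; rewrite lee_fin.
  by apply: le_powR_nneg; [exact: ltW|rewrite u0// (lt_le_trans x0)|exact: niu].
apply: ge0_le_integral => //.
- by move=> x _; rewrite lee_fin powR_ge0.
- exact: nik.
- exact: nik.
- move=> x; rewrite /= in_itv/= andbT => x0; rewrite lee_fin.
  by apply: le_powR_nneg; [exact: ltW|exact: h0|have /andP[] := hg _ x0].
Qed.

Let trunc (n : nat) (x : R) : \bar R := mine (H_op b f x) n%:R%:E.

Let truncE n x : (fine (trunc n x))%:E = trunc n x.
Proof.
rewrite fineK// ge0_fin_numE; first by rewrite /trunc gt_min ltry orbT.
by rewrite /trunc le_min H_pos lee_fin ler0n.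
Qed.

Let trunc_ge0 n x : (0 <= fine (trunc n x))%R.
Proof. by rewrite -lee_fin truncE /trunc le_min H_pos lee_fin ler0n. Qed.

Let trunc_le n x : (fine (trunc n x) <= n%:R)%R.
Proof. by rewrite -lee_fin truncE /trunc ge_min lexx orbT. Qed.

Let trunc_nincr n x y : (0 < x)%R -> (x <= y)%R -> (fine (trunc n y) <= fine (trunc n x))%R.
Proof.
move=> x0 xy; rewrite -lee_fin !truncE /trunc le_min !ge_min lexx orbT andbT.
by rewrite (H_op_nincr hb Lf).
Qed.

(* [(min(H f, n))^s] on [(0, n)]; for [s = q - 1] it saturates the duality defining the [L^q] norm. *)
Let level (s : R) (n : nat) (x : R) : R := if (x < n%:R)%R then (fine (trunc n x) `^ s)%R else 0%R.

Let level_ge0 s n x : (0 <= level s n x)%R.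
Proof. by rewrite /level; case: ifP => // _; exact: powR_ge0. Qed.

Let level_nincr s n x y : (0 <= s)%R -> (0 < x)%R -> (x <= y)%R -> (level s n y <= level s n x)%R.
Proof.
move=> s0 x0 xy; rewrite /level; case: (ltP y n%:R%R) => yn; last exact: level_ge0.
by rewrite (le_lt_trans xy yn); apply: le_powR_nneg => //; exact: trunc_nincr.
Qed.

Let level_le s n x : (0 <= s)%R -> (level s n x <= n%:R `^ s)%R.
Proof.
move=> s0; rewrite /level; case: ifP => _; last exact: powR_ge0.
exact: le_powR_nneg.
Qed.

Let level_integral_lty n : \int[mu]_(x in `]0%R, +oo[) (level q n x)%:E < +oo.
Proof.
have ml : measurable_fun (pos R) (EFin \o level q n).
  by apply: measurable_nincr => x y; apply: level_nincr; exact: ltW.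
rewrite (_ : \int[mu]_(x in _) _ = \int[mu]_(x in `]0%R, n%:R[) (level q n x)%:E).
  apply: (@le_lt_trans _ _ (\int[mu]_(x in `]0%R, n%:R[) (cst (n%:R `^ q)%:E x))).
    apply: ge0_le_integral => //.
    - by move=> x _; rewrite lee_fin.
    - exact: measurable_fun_segment ml.
    - by move=> x _; rewrite lee_fin level_le// ltW.
  rewrite integral_cst//= lebesgue_measure_itv/= lte_fin.
  by case: ifP => _; rewrite ?mule0// -EFinD -EFinM ltry.
rewrite [LHS]integral_mkcond [RHS]integral_mkcond; apply: eq_integral => x _.
rewrite /patch !mem_setE !in_itv/= andbT; case: (ltP 0%R (x : R)) => //= x0.
by rewrite /level; case: ifP.
Qed.

(** As (q - 1) k = q, the k-th power of the level of order q - 1 is the level of order q, so the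
    duality bound reads I <= C I^(1/k) with I finite and can be solved for I. *)
Let level_integral_bound n : normp p f < +oo ->
  \int[mu]_(x in `]0%R, +oo[) (level q n x)%:E <= ((A * K_const p q)%:E * normp p f) `^ q.
Proof.
move=> Nf; have K0 := ltW (K_const_gt0 p1 pq).
have N0 : 0 <= normp p f by rewrite normpE ?poweR_ge0//; exact: Lf.2.
have C0 : 0 <= (A * K_const p q)%:E * normp p f by rewrite mule_ge0// lee_fin mulr_ge0.
set I := \int[mu]_(x in _) _.
have I0 : 0 <= I by apply: integral_ge0 => x _; rewrite lee_fin.
have qB : (0 <= q - 1)%R by rewrite subr_ge0 ltW.
have E : \int[mu]_(x in `]0%R, +oo[) (level (q - 1) n x `^ k)%:E = I.
  apply: eq_integral => x _; congr _%:E; rewrite /level; case: ifP => _; last first.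
    by rewrite powR0// gt_eqF.
  rewrite -powRrM; congr (_ `^ _)%R; rewrite /k /conj_exp.
  by field; rewrite (gt_eqF q0)/= subr_eq0 gt_eqF.
have : I <= ((A * K_const p q)%:E * normp p f) * I `^ (1 - q^-1).
  have -> : (1 - q^-1 = k^-1)%R by rewrite qinv opprB addrC subrK.
  rewrite (muleC _ (normp p f)) -muleA -[X in _ * (_ * X `^ _)]E.
  apply: le_trans (@nincr_duality_bound (level (q - 1) n) _ (fun x _ => level_ge0 _ n x)
    (fun x _ => level_le n x qB) (fun x y => @level_nincr _ n x y qB)).
  apply: ge0_le_integral => //.
  - by move=> x _; rewrite lee_fin.
  - by apply: measurable_nincr => x y; apply: level_nincr; exact: ltW.
  - apply: emeasurable_funM mH; apply: measurable_nincr => x y; exact: level_nincr.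
  move=> x _; rewrite /level; case: ifP => _; last by rewrite mul0e.
  apply: (@le_trans _ _ ((fine (trunc n x) `^ (q - 1))%:E * trunc n x)).
    rewrite -truncE -EFinM lee_fin -[X in (_ * X)%R]powRr1// -powRD; last first.
      by rewrite subrK gt_eqF.
    by rewrite subrK.
  by apply: lee_wpmul2l; [rewrite lee_fin powR_ge0|rewrite /trunc ge_min lexx].
move=> /(self_bound _ I0 (level_integral_lty n) C0); rewrite invr_gt0 => /(_ q0) H.
have -> : I = (I `^ q^-1) `^ q by rewrite -poweRrM mulVf ?gt_eqF// poweRe1.
by apply: le_poweR => //; [exact: ltW|exact: poweR_ge0].
Qed.

Lemma level_cvg x : (0 < x)%R -> (level q n x)%:E @[n --> \oo] --> H_op b f x `^ q.
Proof.
move=> x0; have nx : \forall n \near \oo, (x < n%:R)%R by exact: nbhs_infty_gtr.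
case Hx : (H_op b f x) => [h| |].
- have h0 : (0 <= h)%R by rewrite -lee_fin -Hx.
  apply: cvg_near_cst; near=> n.
  rewrite /level ifT; last by near: n.
  rewrite /trunc Hx min_l ?poweR_EFin//= lee_fin ltW//.
  by near: n; exact: nbhs_infty_gtr.
- rewrite poweRyr ?gt_eqF//; apply/cvgeyPge => B; near=> n.
  rewrite /level ifT; last by near: n.
  rewrite /trunc Hx min_r ?leey//= lee_fin.
  have Bn : (B <= n%:R)%R by near: n; exact: nbhs_infty_ger.
  apply: (le_trans Bn); rewrite -[leLHS]powRr1//; apply: ler_powR; last exact: ltW.
  by near: n; exact: nbhs_infty_ger.
- by have := H_pos x; rewrite Hx.
Unshelve. all: by end_near.
Qed.

Lemma H_op_norm_le : normp p f < +oo -> normp q (H_op b f) <= (K_const p q * A)%:E * normp p f.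
Proof.
move=> Nf; have K0 := ltW (K_const_gt0 p1 pq).
have N0 : 0 <= normp p f by rewrite normpE ?poweR_ge0//; exact: Lf.2.
have C0 : 0 <= (A * K_const p q)%:E * normp p f by rewrite mule_ge0// lee_fin mulr_ge0.
have mHq : measurable_fun (pos R) (fun x => H_op b f x `^ q).
  exact: (measurableT_comp (measurable_poweR q)).
rewrite normpE// leb_integral_halfline//; last by move=> x _; exact: poweR_ge0.
suff H : \int[mu]_(x in `]0%R, +oo[) (H_op b f x `^ q) <= ((A * K_const p q)%:E * normp p f) `^ q.
  rewrite mulrC; apply: le_trans (le_poweR _ _ H) _.
  - by rewrite invr_ge0 ltW.
  - by apply: integral_ge0 => x _; exact: poweR_ge0.
  - by rewrite -poweRrM mulfV ?gt_eqF// poweRe1.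
have -> : \int[mu]_(x in `]0%R, +oo[) (H_op b f x `^ q) =
    \int[mu]_(x in `]0%R, +oo[) limn (fun n => (level q n x)%:E).
  apply: eq_integral => x; rewrite inE/= in_itv/= andbT => x0.
  by apply/esym/cvg_lim => //; exact: level_cvg.
have ml n : measurable_fun (pos R) (fun x => (level q n x)%:E).
  by apply: measurable_nincr => x y; apply: level_nincr; exact: ltW.
have := @cvg_monotone_convergence _ _ R mu _ (measurable_itv `]0%R, +oo[) (fun n x => (level q n x)%:E) ml.
move=> C; have {C} := C _ _; move=> C.
have C' : \int[mu]_(x in `]0%R, +oo[) (level q n x)%:E @[n --> \oo] -->
    \int[mu]_(x in `]0%R, +oo[) limn (fun n => (level q n x)%:E).
  apply: C => [n x _|x _ m n mn]; first by rewrite lee_fin.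
  rewrite lee_fin /level; case: (ltP x m%:R%R) => xm; last exact: level_ge0.
  rewrite (lt_le_trans xm) ?ler_nat//; apply: le_powR_nneg; [exact: ltW|exact: trunc_ge0|].
  rewrite -lee_fin !truncE /trunc le_min !ge_min lexx/=.
  by rewrite lee_fin ler_nat mn orbT.
rewrite -(cvg_lim _ C')//; apply: lime_le; first exact: cvgP C'.
by apply: nearW => n; exact: level_integral_bound.
Qed.

End upper_bound.

Lemma sup_pos_ge (R : realType) (c : R -> \bar R) (t : R) : (0 < t)%R -> c t <= sup_pos c.
Proof. by move=> t0; apply: ereal_sup_ubound; exists t => //=; rewrite in_itv/= t0. Qed.

Lemma c2_ge0 (R : realType) (p q : R) (b : R -> \bar R) (t : R) : 0 <= c2 p q b t.
Proof. by rewrite /c2 mule_ge0 ?poweR_ge0// lee_fin powR_ge0. Qed.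

Lemma normp_ge0 (R : realType) (p : R) (f : LT R -> \bar R) : (0 < p)%R ->
  (forall x, (0 < x)%R -> 0 <= f x) -> 0 <= normp p f.
Proof. by move=> p0 f0; rewrite normpE// poweR_ge0. Qed.

(** Required when A_2 = +oo: since +oo * 0 = 0, an infinite constant still demands something of
    functions with norm 0. *)
Lemma normp_H_op_eq0 (R : realType) (p q : R) (b : R -> \bar R) (f : LT R -> \bar R) :
  (0 < p)%R -> (0 < q)%R -> Lplus f -> normp p f = 0 -> normp q (H_op b f) = 0.
Proof.
move=> p0 q0 Lf f0; have [mf fpos] := Lf.
have mfp : measurable_fun [set: LT R] (f \_ (halfline R)).
  by apply/(measurable_restrictT _ (@measurable_halfline R)).
have H0 x : H_op b f x = 0.
  have ms := measurable_levels (b x).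
  have := Lnorm_eq0_eq0 mfp _ f0; rewrite lte_fin => /(_ p0) ae0.
  rewrite /H_op (_ : \int[leb R]_(t in _) _ = \int[leb R]_(t in [set t : LT R | (0 < t)%R /\ t%:E < b x]) cst 0 t).
    by rewrite integral_cst// mul0e.
  apply: ae_eq_integral => //.
  - by apply: measurable_funS mf; [exact: measurable_halfline|move=> t [t0 _]; exact/halflineP].
  - case: ae0 => N [mN N0 hN]; exists N; split => // t /= nt; apply: hN => /= ht; apply: nt.
    move=> [t0 _]; have := ht I; rewrite /patch ifT// inE; exact/halflineP.
rewrite normpE//; last by move=> x _; rewrite H0.
rewrite (_ : \int[leb R]_(x in _) _ = 0) ?poweR0r ?invr_eq0 ?gt_eqF//.
by apply: integral0_eq => x _; rewrite H0 poweR0r// gt_eqF.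
Qed.

Lemma N_const_le (R : realType) (p q : R) (b : R -> \bar R) : (1 < p)%R -> (p <= q)%R ->
  normal_form_parameter b -> N_const p q b <= (K_const p q)%:E * sup_pos (c2 p q b).
Proof.
move=> p1 pq hb; have K0 := K_const_gt0 p1 pq.
have p0 : (0 < p)%R by exact: lt_trans p1.
have q0 : (0 < q)%R by exact: lt_le_trans pq.
have S0 : 0 <= sup_pos (c2 p q b) by apply: le_trans (sup_pos_ge _ ltr01); exact: c2_ge0.
apply: ereal_inf_lbound; split; first by rewrite mule_ge0// lee_fin ltW.
move=> f Lf Nf; have N0 := normp_ge0 p0 Lf.2.
case E : (sup_pos (c2 p q b)) S0 => [A| |]// A0.
  rewrite -EFinM; apply: (H_op_norm_le p1 pq hb) => //.
  by move=> t t0; rewrite -E; exact: sup_pos_ge.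
rewrite gt0_muley ?lte_fin//; move: N0; rewrite le_eqVlt => /predU1P[/esym z|Np].
  by rewrite (normp_H_op_eq0 _ p0 q0 Lf z) z mule0.
by rewrite gt0_mulye// leey.
Qed.

(** * Lower bounds *)

Section lower_bound.
Variable R : realType.
Variables p q : R.
Hypothesis p1 : (1 < p)%R.
Hypothesis pq : (p <= q)%R.
Variable b : R -> \bar R.
Hypothesis hb : normal_form_parameter b.
Variable C : \bar R.
Hypothesis C0 : 0 <= C.
Hypothesis hC : forall f : LT R -> \bar R, Lplus f -> normp p f < +oo ->
  normp q (H_op b f) <= C * normp p f.
Let k := conj_exp q.
Let l := conj_exp p.
Let q1 : (1 < q)%R. Proof. exact: lt_le_trans pq. Qed.
Let k1 : (1 < k)%R. Proof. exact: conj_exp_gt1. Qed.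
Let l1 : (1 < l)%R. Proof. exact: conj_exp_gt1. Qed.
Let k0 : (0 < k)%R. Proof. exact: lt_trans k1. Qed.
Let l0 : (0 < l)%R. Proof. exact: lt_trans l1. Qed.
Let p0 : (0 < p)%R. Proof. exact: lt_trans p1. Qed.
Let q0 : (0 < q)%R. Proof. exact: lt_trans q1. Qed.
Let pinv : (p^-1 = 1 - l^-1)%R.
Proof. by rewrite conj_exp_inv opprB addrC subrK. Qed.
Let qinv : (q^-1 = 1 - k^-1)%R.
Proof. by rewrite conj_exp_inv opprB addrC subrK. Qed.
Variables g w : R -> \bar R.
Hypothesis mg : measurable_fun (pos R) g.
Hypothesis mw : measurable_fun (pos R) w.
Hypothesis g0 : forall x, (0 < x)%R -> 0 <= g x.
Hypothesis w0 : forall x, (0 < x)%R -> 0 <= w x.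
Hypothesis gw : forall t : R, (0 < t)%R ->
  (\int[mu]_(x in `]0%R, t[) g x) `^ conj_exp p = \int[mu]_(x in `]0%R, t[) w x.
Hypothesis gfin : \int[mu]_(x in `]0%R, +oo[) g x < +oo.

Let h := adjoint_op b g.
Let h0 t : 0 <= h t. Proof. exact: adjoint_op_ge0. Qed.
Let J (S : R) := \int[mu]_(t in `]0%R, S[) (h t `^ l).
(* The equality case of Hoelder against [h], cut off so that its norm is finite. *)
Let fS (S : R) (t : LT R) : \bar R := if (t < S)%R then h t `^ (l - 1) else 0.

Let fS_ge0 S t : 0 <= fS S t.
Proof. by rewrite /fS; case: ifP => // _; exact: poweR_ge0. Qed.

Let measurable_fS S : measurable_fun (pos R) (fS S).
Proof.
apply: nonincreasing_emeasurable => x y x0 xy; rewrite /fS.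
case: (ltP y S) => yS; last by case: ifP => // _; exact: poweR_ge0.
rewrite (le_lt_trans xy yS); apply: le_poweR => //; first by rewrite subr_ge0 ltW.
exact: adjoint_op_nincr.
Qed.

Let integral_trunc (S : R) (F : R -> \bar R) : (0 < S)%R ->
  \int[mu]_(t in `]0%R, +oo[) (if (t < S)%R then F t else 0) = \int[mu]_(t in `]0%R, S[) F t.
Proof.
move=> S0; rewrite [LHS]integral_mkcond [RHS]integral_mkcond; apply: eq_integral => x _.
rewrite /patch !mem_setE !in_itv/= andbT; case: (ltP 0%R (x : R)) => //= x0.
Qed.

Let normp_fS S : (0 < S)%R -> normp p (fS S) = J S `^ p^-1.
Proof.
move=> S0; rewrite normpE// leb_integral_halfline; last 2 first.
- exact: (measurableT_comp (measurable_poweR p) (measurable_fS S)).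
- by move=> x _; exact: poweR_ge0.
congr (_ `^ _); rewrite /J -integral_trunc//; apply: eq_integral => x _.
rewrite /fS; case: ifP => _; last by rewrite poweR0r// gt_eqF.
rewrite -poweRrM; congr (_ `^ _); rewrite /l /conj_exp.
by field; rewrite gt_eqF//= subr_eq0 gt_eqF.
Qed.

Let J_lty S : (0 < S)%R -> J S < +oo.
Proof.
move=> S0; pose G := \int[mu]_(x in `]0%R, +oo[) g x.
have ml : measurable_fun (`]0%R, S[ : set R) (fun t => h t `^ l).
  apply: measurable_fun_segment.
  exact: (measurableT_comp (measurable_poweR l) (measurable_adjoint_op hb mg g0)).
apply: (@le_lt_trans _ _ (\int[mu]_(t in `]0%R, S[) (cst (G `^ l) t))).
  apply: ge0_le_integral => //.
  - by move=> x _; exact: poweR_ge0.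
  - by move=> x _; apply: le_poweR; [exact: ltW|exact: h0|exact: adjoint_op_le].
rewrite integral_cst//= lebesgue_measure_itv/= lte_fin S0 -EFinD.
have : G `^ l < +oo by exact: poweR_lty.
have : 0 <= G `^ l by exact: poweR_ge0.
by case: (G `^ l) => [c| |]// _ _; rewrite -EFinM ltry.
Qed.

Let Lplus_fS S : Lplus (fS S).
Proof. by split; [exact: measurable_fun_halfline|move=> x _]. Qed.

(** On (0, S) both fS h and fS^p equal h^l, as (l - 1) p = l. Duality, Hoelder's inequality and the
    hypothesis on [C] give J <= U^(1/k) C J^(1/p), which is solved for J; J is finite because h is
    bounded by the integral of g. *)
Let J_bound S : (0 < S)%R -> J S <= C `^ l *
  (\int[mu]_(x in `]0%R, +oo[) (g x `^ k)) `^ (l / k).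
Proof.
move=> S0; set U := \int[mu]_(x in _) _.
have U0 : 0 <= U by apply: integral_ge0 => x _; exact: poweR_ge0.
have J0 : 0 <= J S by apply: integral_ge0 => x _; exact: poweR_ge0.
have E : \int[leb R]_(x in halfline R) (g x * H_op b (fS S) x) = J S.
  rewrite (H_op_duality hb mg g0 (Lplus_fS S)) leb_integral_halfline; last 2 first.
  - exact: (emeasurable_funM (measurable_fS S) (measurable_adjoint_op hb mg g0)).
  - by move=> x _; rewrite mule_ge0//; exact: h0.
  rewrite /J -integral_trunc//; apply: eq_integral => x _; rewrite /fS.
  case: ifP => _; last by rewrite mul0e.
  rewrite -/(h x) -[X in _ * X](poweRe1 (h0 x)) -poweRD; last first.
    by rewrite /poweRD_def subrK (gt_eqF l0).
  by rewrite subrK.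
have kq : (k^-1 + q^-1 = 1)%R by rewrite qinv addrC subrK.
have mH : measurable_fun (pos R) (H_op b (fS S)).
  by apply: nonincreasing_emeasurable; exact: (H_op_nincr hb (Lplus_fS S)).
have H0 x : 0 <= H_op b (fS S) x by exact: H_op_ge0.
have : J S <= U `^ k^-1 * (C * J S `^ p^-1).
  rewrite -{1}E.
  apply: (le_trans (hoelder_ge0 _ (@measurable_halfline R) (measurable_fun_halfline mg)
    (measurable_fun_halfline mH) _ _ k0 q0 kq)).
  - by move=> x /halflineP; exact: g0.
  - by move=> x _; exact: H0.
  rewrite leb_integral_halfline; last 2 first.
  - exact: (measurableT_comp (measurable_poweR k) mg).
  - by move=> x _; exact: poweR_ge0.
  apply: lee_wpmul2l; first exact: poweR_ge0.
  rewrite -normp_fS// -normpE//; apply: hC => //.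
  by rewrite normp_fS// poweR_lty// J_lty.
rewrite pinv muleA => B.
have li : (0 < l^-1)%R by rewrite invr_gt0.
have {}B := self_bound li J0 (J_lty S0) (mule_ge0 (poweR_ge0 _ _) C0) B.
have -> : J S = (J S `^ l^-1) `^ l by rewrite -poweRrM mulVf ?gt_eqF// poweRe1.
apply: le_trans (le_poweR _ _ B) _; [exact: ltW|exact: poweR_ge0|].
by rewrite poweRM ?poweR_ge0// -poweRrM muleC mulrC.
Qed.

Lemma dual_lower_bound : \int[mu]_(x in `]0%R, +oo[) (w x * b x) <= C `^ conj_exp p *
  (\int[mu]_(x in `]0%R, +oo[) (g x `^ conj_exp q)) `^ (conj_exp p / conj_exp q).
Proof.
rewrite -(integral_adjoint_op_pow hb l1 mg mw g0 w0 gw).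
have mh : measurable_fun (pos R) (fun t => h t `^ l).
  exact: (measurableT_comp (measurable_poweR l) (measurable_adjoint_op hb mg g0)).
have c := integral_itv0y_cvg mh (fun x _ => poweR_ge0 _ _).
rewrite -(cvg_lim _ c)//; apply: lime_le; first exact: cvgP c.
by near=> n; apply: J_bound; rewrite ltr0n; near: n; exact: nbhs_infty_gt.
Unshelve. all: by end_near.
Qed.

End lower_bound.

Lemma measurable_cutoff (R : realType) (S : R) (F : R -> \bar R) :
  measurable_fun (pos R) F ->
  measurable_fun (pos R) (fun x => if (x < S)%R then F x else 0).
Proof.
move=> mF.
rewrite (_ : (fun x => _) = F \_ (`]-oo, S[%classic : set R)); last first.
  by apply/funext => x; rewrite /patch mem_setE in_itv.
apply/(measurable_restrict _ (measurable_itv _) (measurable_itv _)).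
by apply: measurable_funS mF => //; exact: subIsetl.
Qed.

Lemma integral_cutoff (R : realType) (S T : R) (F : R -> \bar R) :
  \int[mu]_(x in `]0%R, T[) (if (x < S)%R then F x else 0) =
  \int[mu]_(x in `]0%R, (Num.min T S)[) F x.
Proof.
rewrite [LHS]integral_mkcond [RHS]integral_mkcond; apply: eq_integral => x _.
rewrite /patch !mem_setE !in_itv/= lt_min; case: (ltP 0%R (x : R)) => //= x0.
by case: (x < T)%R.
Qed.

Lemma integral_cutoffy (R : realType) (S : R) (F : R -> \bar R) :
  \int[mu]_(x in `]0%R, +oo[) (if (x < S)%R then F x else 0) =
  \int[mu]_(x in `]0%R, S[) F x.
Proof.
rewrite [LHS]integral_mkcond [RHS]integral_mkcond; apply: eq_integral => x _.
by rewrite /patch !mem_setE !in_itv/= andbT; case: (ltP 0%R (x : R)).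
Qed.

(** * Lower bounds from functions cut off at a point *)

Section windows.
Variable R : realType.
Variables p q : R.
Hypothesis p1 : (1 < p)%R.
Hypothesis pq : (p <= q)%R.
Variable b : R -> \bar R.
Hypothesis hb : normal_form_parameter b.
Variable C : \bar R.
Hypothesis C0 : 0 <= C.
Hypothesis hC : forall f : LT R -> \bar R, Lplus f -> normp p f < +oo ->
  normp q (H_op b f) <= C * normp p f.
Let k := conj_exp q.
Let l := conj_exp p.
Let q1 : (1 < q)%R. Proof. exact: lt_le_trans pq. Qed.
Let k1 : (1 < k)%R. Proof. exact: conj_exp_gt1. Qed.
Let l1 : (1 < l)%R. Proof. exact: conj_exp_gt1. Qed.
Let kl : (k <= l)%R. Proof. exact: conj_exp_le. Qed.
Let k0 : (0 < k)%R. Proof. exact: lt_trans k1. Qed.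
Let l0 : (0 < l)%R. Proof. exact: lt_trans l1. Qed.

Section test.
Variables g G U W : R -> R.
Hypothesis tg : test_fun g.
Hypothesis pG : prim g G.
Hypothesis pU : prim (fun x => g x `^ k)%R U.
Hypothesis pW : prim (weighted_density k l G g) W.

Let g0 x : (0 < x)%R -> (0 <= g x)%R. Proof. by case: tg => _ h _ _ _; exact: h. Qed.
Let pd0 x : (0 < x)%R -> (0 <= power_density l G g x)%R.
Proof. exact: (power_density_ge0 k1 kl G tg). Qed.
Let min_gt0 (s t : R) : (0 < s)%R -> (0 < t)%R -> (0 < Num.min s t)%R.
Proof. by rewrite lt_min => -> ->. Qed.

Let U_integral x : (0 < x)%R -> \int[mu]_(y in `]0%R, x[) (g y `^ k)%:E = (U x)%:E.
Proof.
apply: (prim_integral _ _ _ pU).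
- by move=> y; exact: (test_powR_cont tg k0).
- by move=> y _; exact: powR_ge0.
- exact: (test_powR_bounded tg k0).
Qed.

Let W_integral x : (0 < x)%R -> \int[mu]_(y in `]0%R, x[) (weighted_density k l G g y)%:E = (W x)%:E.
Proof.
apply: (prim_integral _ _ _ pW).
- by move=> y; exact: (weighted_density_cont tg pG).
- by move=> y; exact: (weighted_density_ge0 k1 kl G tg).
- exact: (weighted_density_bounded k1 kl tg pG).
Qed.

(** A cut-off function is discontinuous in general and no test function. The dual bound asks only
    for measurability, a finite integral and the identity between (int g)^l and int w, which
    survives the cut. *)
Lemma cutoff_lower_bound (S : R) : (0 < S)%R ->
  \int[mu]_(x in `]0%R, S[) ((power_density l G g x)%:E * b x) <= C `^ l * (U S `^ (l / k))%:E.
Proof.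
move=> S0.
have mg := measurable_test tg.
have mpd : measurable_fun (pos R) (EFin \o power_density l G g).
  apply/measurable_EFinP; apply: continuous_positive_itv => x x0.
  exact: (power_density_cont tg pG).
have := @dual_lower_bound R p q p1 pq b hb C C0 hC
  (fun x => if (x < S)%R then (g x)%:E else 0)
  (fun x => if (x < S)%R then (power_density l G g x)%:E else 0)
  (measurable_cutoff S mg) (measurable_cutoff S mpd).
rewrite -/k -/l => H; have {H} := H _ _ _ _.
have -> : \int[mu]_(x in `]0%R, +oo[) ((if (x < S)%R then (g x)%:E else 0) `^ k) = (U S)%:E.
  rewrite -U_integral// -integral_cutoffy; apply: eq_integral => x _.
  by case: ifP => _; [rewrite poweR_EFin|rewrite poweR0r// gt_eqF].
have -> : \int[mu]_(x in `]0%R, +oo[) ((if (x < S)%R then (power_density l G g x)%:E else 0) * b x) =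
    \int[mu]_(x in `]0%R, S[) ((power_density l G g x)%:E * b x).
  by rewrite -integral_cutoffy; apply: eq_integral => x _; case: ifP; rewrite ?mul0e.
rewrite poweR_EFin; apply.
- by move=> x x0; case: ifP => // _; rewrite lee_fin g0.
- by move=> x x0; case: ifP => // _; rewrite lee_fin pd0.
- by move=> t t0; rewrite !integral_cutoff; exact: (power_density_integral k1 kl tg pG (min_gt0 t0 S0)).
- rewrite integral_cutoffy (test_prim_integral tg pG S0); exact: ltry.
Qed.

(** The lower bound for [c2] is available on [al, om] only. What [weight] may lack on (0, al) costs
    at most c^l W(al), and cutting the test function at [om] makes larger t harmless. *)
Lemma window_lower_bound (c al om : R) : (0 <= c)%R -> (0 < al)%R -> (al < om)%R ->
  (forall t, (al <= t <= om)%R -> c%:E <= c2 p q b t) ->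
  (c `^ l * (W om - W al))%:E <= C `^ l * (U om `^ (l / k))%:E.
Proof.
move=> c_ge0 al0 alom hc; have om0 : (0 < om)%R by exact: lt_trans alom.
pose phi (x : R) : \bar R := (l * (G x / x) `^ (l - 1) * g x)%:E.
pose beta (x : R) : \bar R := (c `^ l)%:E * (x `^ (l / k - 1))%:E.
pose cut (S : R) (F : R -> \bar R) (x : R) := if (x < S)%R then F x else 0.
have phi0 (x : R) : (0 < x)%R -> 0 <= phi x.
  move=> x0; rewrite lee_fin mulr_ge0 ?g0// mulr_ge0 ?powR_ge0//; exact: ltW.
have niphi (x y : R) : (0 < x)%R -> (x <= y)%R -> phi y <= phi x.
  by move=> x0 xy; rewrite lee_fin; exact: (slope_density_nincr k1 kl).
have beta0 (x : R) : 0 <= beta x by rewrite mule_ge0// lee_fin powR_ge0.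
have mb : measurable_fun (pos R) beta by exact: measurable_powR_itv.
have mw : measurable_fun (pos R) (weight p b) by exact: measurable_weight.
have w0 x : (0 < x)%R -> 0 <= weight p b x by exact: weight_ge0.
have Ibeta t : (0 < t)%R -> \int[mu]_(x in `]0%R, t[) beta x = (c `^ l * (k / l * t `^ (l / k)))%:E.
  by move=> /ltW t0; exact: (integral_cpowR p1 pq (powR_ge0 _ _) t0).
have mcut S F : measurable_fun (pos R) F -> measurable_fun (pos R) (cut S F).
  exact: measurable_cutoff.
(* [c <= c2] holds on the window only; adding [beta] on [(0, al)] to the weight
   makes the integrated comparison true for all [t]. *)
have cmp (t : R) : (0 < t)%R -> \int[mu]_(x in `]0%R, t[) cut om beta x <=
    \int[mu]_(x in `]0%R, t[) (weight p b x + cut al beta x).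
  move=> t0.
  have mS (s : R) (F : R -> \bar R) : measurable_fun (pos R) F -> measurable_fun (`]0%R, s[ : set R) F.
    exact: measurable_fun_segment.
  have -> : \int[mu]_(x in `]0%R, t[) (weight p b x + cut al beta x) =
      \int[mu]_(x in `]0%R, t[) weight p b x + \int[mu]_(x in `]0%R, t[) cut al beta x.
    apply: ge0_integralD => //.
    - by move=> x; rewrite /= in_itv/= => /andP[x0 _]; exact: w0.
    - exact: mS.
    - by move=> x _; rewrite /cut; case: ifP.
    - by apply: mS; exact: mcut.
  have wI0 (s : R) : 0 <= \int[mu]_(x in `]0%R, s[) weight p b x.
    by apply: integral_ge0 => x; rewrite /= in_itv/= => /andP[x0 _]; exact: w0.
  rewrite !integral_cutoff; case: (leP t al) => tal.
    by rewrite (min_l (le_trans tal (ltW alom))) leeDr.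
  apply: (@le_trans _ _ (\int[mu]_(x in `]0%R, t[) weight p b x)); last first.
    by rewrite leeDl//; apply: integral_ge0 => x _; exact: beta0.
  set s := Num.min t om.
  have s0 : (0 < s)%R by exact: min_gt0.
  have st : (s <= t)%R by rewrite ge_min lexx.
  apply: (@le_trans _ _ (\int[mu]_(x in `]0%R, s[) weight p b x)).
    rewrite (Ibeta _ s0) (c2_powR p1 pq hb s0) EFinM muleC.
    apply: lee_wpmul2l; first by rewrite lee_fin mulr_ge0 ?powR_ge0// divr_ge0// ltW.
    rewrite -poweR_EFin; apply: le_poweR; [exact: ltW|by rewrite lee_fin|].
    by apply: hc; rewrite le_min ge_min lexx orbT (ltW tal) ltW.
  apply: ge0_subset_integral => //.
  - exact: mS.
  - by move=> x; rewrite /= in_itv/= => /andP[x0 _]; exact: w0.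
  - by move=> x; rewrite /= !in_itv/= => /andP[-> xs]; rewrite (lt_le_trans xs).
have cut0 S F (x : R) : (0 < x)%R -> (forall x, (0 < x)%R -> 0 <= F x) -> 0 <= cut S F x.
  by move=> x0 F0; rewrite /cut; case: ifP => // _; exact: F0.
have cphi0 (x : R) : (0 < x)%R -> 0 <= cut om phi x by move=> x0; exact: cut0.
have nicphi (x y : R) : (0 < x)%R -> (x <= y)%R -> cut om phi y <= cut om phi x.
  move=> x0 xy; rewrite /cut; case: (ltP y om) => yo; last by case: ifP => // _; exact: phi0.
  by rewrite (le_lt_trans xy yo) niphi.
have B0 (x : R) : (0 < x)%R -> 0 <= cut om beta x by move=> x0; exact: cut0.
have B1 (x : R) : (0 < x)%R -> 0 <= weight p b x + cut al beta x.
  by move=> x0; rewrite adde_ge0 ?w0 ?cut0.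
have mB1 : measurable_fun (pos R) (fun x => weight p b x + cut al beta x).
  by apply: emeasurable_funD => //; exact: mcut.
have := integral_nonincreasing_comparison cphi0 nicphi (mcut om _ mb) mB1 B0 B1 cmp.
have wdE (x : R) : (0 < x)%R -> beta x * phi x = (c `^ l * weighted_density k l G g x)%:E.
  by move=> x0; rewrite -(weighted_density_weight p1 pq (c `^ l)%R x0 tg pG).
have Icut (S : R) : (0 < S)%R -> \int[mu]_(x in `]0%R, S[) (beta x * phi x) = (c `^ l * W S)%:E.
  move=> S0; rewrite EFinM -(W_integral S0).
  transitivity (\int[mu]_(x in `]0%R, S[) ((c `^ l)%:E * (weighted_density k l G g x)%:E)).
    by apply: eq_integral => x; rewrite inE/= in_itv/= => /andP[x0 _]; exact: wdE.
  apply: ge0_integralZl_segment; first exact: powR_ge0.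
    apply/measurable_EFinP; apply: continuous_positive_itv => x x0.
    exact: (weighted_density_cont tg pG).
  by move=> x x0; rewrite lee_fin (weighted_density_ge0 k1 kl G tg).
have -> : \int[mu]_(x in `]0%R, +oo[) (cut om beta x * cut om phi x) = (c `^ l * W om)%:E.
  rewrite -(Icut _ om0) -integral_cutoffy; apply: eq_integral => x _.
  by rewrite /cut; case: ifP; rewrite ?mul0e.
have -> : \int[mu]_(x in `]0%R, +oo[) ((weight p b x + cut al beta x) * cut om phi x) =
    \int[mu]_(x in `]0%R, om[) ((power_density l G g x)%:E * b x) + (c `^ l * W al)%:E.
  rewrite -(Icut _ al0) -integral_cutoffy -[in X in _ = _ + X]integral_cutoffy.
  have mphi : measurable_fun (pos R) phi by exact: nonincreasing_emeasurable.
  rewrite -ge0_integralD//; last 4 first.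
  - move=> x; rewrite /= in_itv/= andbT => x0; case: ifP => // _.
    by rewrite mule_ge0 ?lee_fin ?pd0//; exact: hb.1.
  - apply: measurable_cutoff; apply: emeasurable_funM.
      apply/measurable_EFinP; apply: continuous_positive_itv => x x0.
      exact: (power_density_cont tg pG).
    by apply: nonincreasing_emeasurable; exact: hb.2.
  - move=> x; rewrite /= in_itv/= andbT => x0; case: ifP => // _.
    by rewrite mule_ge0// phi0.
  - by apply: measurable_cutoff; exact: emeasurable_funM.
  apply: eq_integral => x; rewrite inE/= in_itv/= andbT => x0.
  rewrite /cut; case: (ltP (x : R) om) => xom; last first.
    rewrite mule0; case: (ltP (x : R) al) => xa; last by rewrite adde0.
    by have := lt_le_trans (lt_trans xa alom) xom; rewrite ltxx.
  rewrite ge0_muleDl ?w0//; last by case: ifP.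
  congr (_ + _); first exact/esym/power_density_weight.
  by case: ifP; rewrite ?mul0e.
move=> H; rewrite mulrBr EFinB leeBlDr//; apply: (le_trans H).
by rewrite leeD2r// cutoff_lower_bound.
Qed.

End test.

(** For the constant 1 cut off at t one has U = t and d(G^l) = l x^(l-1) dx, so the lower bound
    reads k t^(l/k) c2^l <= C^l t^(l/k). *)
Lemma c2_le_admissible (t : R) : (0 < t)%R -> (k `^ l^-1)%:E * c2 p q b t <= C.
Proof.
move=> t0.
have pG : prim (fun _ : R => 1 : R)%R (fun x : R => 1 * x)%R by exact: prim_cst.
have pU : prim (fun _ : R => 1 `^ k : R)%R (fun x : R => 1 * x)%R by rewrite powR1; exact: prim_cst.
have tg : test_fun (fun _ : R => 1 : R)%R.
  split => //; [by move=> x _; exact: cst_continuous|by exists 1%R|by exists 1%R].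
have B := cutoff_lower_bound tg pG pU t0.
have C2 := c2_ge0 p q b t.
have E : \int[mu]_(x in `]0%R, t[) ((power_density l (fun x : R => 1 * x)%R (fun _ : R => 1 : R)%R x)%:E * b x) =
    (k * t `^ (l / k))%:E * c2 p q b t `^ l.
  rewrite (_ : k * t `^ (l / k) = l * (k / l * t `^ (l / k)))%R; last by field; rewrite gt_eqF.
  rewrite EFinM -muleA -(c2_powR p1 pq hb t0).
  transitivity (\int[mu]_(x in `]0%R, t[) (l%:E * weight p b x)); last first.
    by apply: ge0_integralZl_segment; [exact: ltW|exact: measurable_weight|exact: weight_ge0].
  apply: eq_integral => x _.
  by rewrite /power_density /weight mul1r mulr1 EFinM -muleA.
move: B; rewrite E mul1r => B.
have tlk : (0 < t `^ (l / k))%R by rewrite powR_gt0.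
have {B} : k%:E * c2 p q b t `^ l <= C `^ l.
  rewrite -(@lee_pmul2l _ (t `^ (l / k))%:E) ?lte_fin// muleA -EFinM mulrC.
  by rewrite (muleC _ (C `^ l)).
have li0 : (0 <= l^-1)%R by rewrite invr_ge0 ltW.
have kc0 : 0 <= k%:E * c2 p q b t `^ l by rewrite mule_ge0 ?poweR_ge0// lee_fin ltW.
move=> /(le_poweR li0 kc0).
rewrite poweRM ?poweR_ge0 ?lee_fin ?(ltW k0)// -!poweRrM mulfV ?gt_eqF// !poweRe1// poweR_EFin.
Qed.

End windows.

(** * Dilations of primitives and test functions *)

Section prim_algebra.
Local Open Scope ring_scope.
Variable R : realType.
Implicit Types (c e x : R) (f g F G : R -> R).

Lemma prim_ext f g F : prim f F -> (forall x, 0 < x -> f x = g x) -> prim g F.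
Proof.
move=> [dF F0] fg; split=> // x x0; exact: (is_derive_ext (dF _ x0) (fg _ x0)).
Qed.

Lemma prim_mulrl c f F : prim f F -> prim (fun x => c * f x) (fun x => c * F x).
Proof.
move=> [dF F0]; split; first by move=> x x0; exact: deriveZ_fun (dF _ x0).
by rewrite -[X in _ --> X](mulr0 c); apply: cvgM => //; exact: cvg_cst.
Qed.

Lemma prim_scale e f F : 0 < e -> prim f F ->
  prim (fun x => f (e^-1 * x)) (fun x => e * F (e^-1 * x)).
Proof.
move=> e0 [dF F0]; have ei : 0 < e^-1 by rewrite invr_gt0.
split.
  move=> x x0; have ex : 0 < e^-1 * x by rewrite mulr_gt0.
  apply: (is_derive_ext (deriveZ_fun e (derive_comp_fun (dF _ ex)
    (deriveZ_fun e^-1 (derive_id_fun x))))).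
  by field; rewrite gt_eqF.
rewrite -[X in _ --> X](mulr0 e); apply: cvgM; first exact: cvg_cst.
apply: (cvg_comp _ _ _ F0) => P [d /= d0 hP]; exists (e * d) => /=; first exact: mulr_gt0.
move=> x /= hx x0; apply: hP; last by rewrite mulr_gt0.
move: hx; rewrite /= !sub0r !normrN !gtr0_norm ?mulr_gt0// mulrC.
by move=> h; rewrite (mulrC e^-1) ltr_pdivrMr.
Qed.

Lemma test_fun_scale e g : 0 < e -> test_fun g -> test_fun (fun x => g (e^-1 * x)).
Proof.
move=> e0 [cg g0 nig [M gM] [x x0 gx]]; have ei : 0 < e^-1 by rewrite invr_gt0.
split.
- move=> y y0; apply: (@continuous_comp _ _ _ (fun x => e^-1 * x) g).
    by apply: continuousM; [exact: cst_continuous|exact: cvg_id].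
  by apply: cg; rewrite mulr_gt0.
- by move=> y y0; rewrite g0// mulr_gt0.
- by move=> y z y0 yz; rewrite nig ?mulr_gt0// ler_pM2l.
- by exists M => y y0; rewrite gM// mulr_gt0.
- by exists (e * x); [exact: mulr_gt0|rewrite mulKf// gt_eqF].
Qed.

(** Integrated, this shows that W and U^(l/k) are both multiplied by e^(l/k) under dilation by e.
    The ratio in the sharp inequality is therefore dilation invariant, and near-extremals can be
    moved to 0 or to infinity. *)
Lemma weighted_density_scale (k l : R) g G e x : 0 < k -> 0 < e -> 0 < x -> 0 <= G (e^-1 * x) ->
  weighted_density k l (fun x => e * G (e^-1 * x)) (fun x => g (e^-1 * x)) x =
  e `^ (l / k - 1) * weighted_density k l G g (e^-1 * x).
Proof.
move=> k0 e0 x0 G0; rewrite /weighted_density /power_density.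
rewrite !powRM ?invr_ge0 ?(ltW e0) ?(ltW x0)//.
rewrite -(powR_inv1 (ltW e0)) -powRrM mulN1r opprK.
have -> : e `^ (l - 1) = e `^ (l / k - 1) * e `^ ((k - 1) * l / k).
  rewrite -(powRDp _ _ e0).
  by congr (_ `^ _); field; rewrite gt_eqF.
by ring.
Qed.

Lemma powR_decay (s e : R) : 0 < s -> 0 < e -> exists2 X, 0 < X & forall x, X <= x -> x `^ (- s) <= e.
Proof.
move=> s0 e0; have ei : 0 < e^-1 by rewrite invr_gt0.
exists (e^-1 `^ s^-1); first by rewrite powR_gt0.
move=> x Xx; have X0 : 0 < e^-1 `^ s^-1 by rewrite powR_gt0.
have x0 : 0 < x := lt_le_trans X0 Xx.
rewrite powRN -[leRHS]invrK lef_pV2 ?posrE ?powR_gt0//.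
have {1}-> : e^-1 = (e^-1 `^ s^-1) `^ s by rewrite -powRrM mulVf ?gt_eqF// powRr1// ltW.
by apply: le_powR_nneg => //; exact: ltW.
Qed.

Lemma powRN_nincr (s x y : R) : 0 <= s -> 0 < x -> x <= y -> y `^ (- s) <= x `^ (- s).
Proof.
move=> s0 x0 xy; have y0 := lt_le_trans x0 xy.
by rewrite !powRN lef_pV2 ?posrE ?powR_gt0//; apply: le_powR_nneg => //; exact: ltW.
Qed.

End prim_algebra.

(** * Extremal functions *)

Section extremals.
Local Open Scope ring_scope.
Variable R : realType.
Implicit Types x : R.
Variables p q : R.
Hypothesis p1 : 1 < p.
Hypothesis pq : p <= q.
Let k := conj_exp q.
Let l := conj_exp p.
Let q1 : 1 < q. Proof. exact: lt_le_trans pq. Qed.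
Let k1 : 1 < k. Proof. exact: conj_exp_gt1. Qed.
Let l1 : 1 < l. Proof. exact: conj_exp_gt1. Qed.
Let kl : k <= l. Proof. exact: conj_exp_le. Qed.
Let k0 : 0 < k. Proof. exact: lt_trans k1. Qed.
Let l0 : 0 < l. Proof. exact: lt_trans l1. Qed.
Let p0 : 0 < p. Proof. exact: lt_trans p1. Qed.
Let q0 : 0 < q. Proof. exact: lt_trans q1. Qed.
Let qinv : q^-1 = 1 - k^-1.
Proof. by rewrite conj_exp_inv opprB addrC subrK. Qed.

(** For g = (1 + x^r)^(-1-1/r) one has x g / G = 1 / (1 + x^r), which is the point where the
    tangent-line estimate is an equality. Both U and W tend to D = l B / r, so W - kappa U^(l/k)
    tends to D - kappa D^(l/k), positive since kappa < D^(-r) = K^l. A large [om] and a small [al]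
    preserve this. *)
Lemma nearly_extremal_lt (kappa : R) : p < q -> 0 < kappa -> kappa < K_const p q `^ l ->
  exists (g G U W : R -> R) (al om : R), [/\ test_fun g, profile k l g G U W, 0 < al < om,
    0 < U om & kappa * U om `^ (l / k) <= W om - W al].
Proof.
move=> pq' kp0 kpK; have kl' : k < l by exact: conj_exp_lt.
pose r := l / k - 1; have r0 : 0 < r by rewrite subr_gt0 ltr_pdivlMr// mul1r.
have [B B0 [BE KE]] := K_const_lt p1 pq pq'.
have [kap [dkap kapb kapB]] := kappa_exists k1 kl'.
have [kap_le kap_ge] := kapB B BE.
rewrite -/k -/l -/r in BE KE dkap kapb kap_le kap_ge.
pose D := l / r * B; have D0 : 0 < D by rewrite mulr_gt0// divr_gt0.
pose y (x : R) := 1 + x `^ r.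
have y1 (x : R) : 1 <= y x by rewrite lerDl powR_ge0.
have y0 (x : R) : 0 < y x by exact: lt_le_trans (y1 x).
have dy (x : R) : 0 < x -> is_derive x (1 : R) y (r * x `^ (r - 1)).
  move=> x0; apply: (is_derive_ext (deriveD_fun (derive_cst_fun 1 x)
    (derive_powR_fun r x0 (derive_id_fun x)))); ring.
have dyp (c x : R) : 0 < x -> is_derive x (1 : R) (fun x => y x `^ c) (c * y x `^ (c - 1) * (r * x `^ (r - 1))).
  by move=> x0; exact: derive_powR_fun (y0 x) (dy _ x0).
have xr (x : R) : 0 < x -> x * x `^ (r - 1) = x `^ r.
  exact: mulr_powRB1p.
have yS (c x : R) : y x `^ c = y x * y x `^ (c - 1).
  exact/esym/mulr_powRB1p.
pose g (x : R) := y x `^ (- (1 + r^-1)).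
pose G (x : R) := x * y x `^ (- r^-1).
pose W (x : R) := l / (k * r) * kap (x `^ r).
(* Integration by parts of g^k = y^(-l/r): the remaining integrand l x^r y^(-l/r-1) is the density
   of W. *)
pose U (x : R) := W x + x * y x `^ (- (l / r)).
have ri : 0 < r^-1 by rewrite invr_gt0.
have s0 : 0 <= 1 + r^-1 by rewrite addr_ge0// ltW.
have y_le1 (s x : R) : 0 <= s -> y x `^ (- s) <= 1.
  by move=> hs; have := powRN_nincr hs (ltr01 : 0 < (1 : R)) (y1 x); rewrite powR1.
have tg : test_fun g.
  split.
  - by move=> x x0; exact: is_derive_cont (dyp _ _ x0).
  - by move=> x _; exact: powR_ge0.
  - move=> x z x0 xz; apply: powRN_nincr => //.
    by rewrite lerD2l; apply: le_powR_nneg; [exact: ltW|exact: ltW|].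
  - by exists 1 => x _; exact: y_le1.
  - by exists 1 => //; exact: powR_gt0.
have pG : prim g G.
  split.
    move=> x x0; apply: (is_derive_ext (deriveM_fun (derive_id_fun x) (dyp (- r^-1) _ x0))).
    rewrite (_ : x * _ = - y x `^ (- r^-1 - 1) * x `^ r); last by rewrite -(xr _ x0); field; rewrite gt_eqF.
    rewrite yS mul1r /g (_ : - (1 + r^-1) = - r^-1 - 1); last by ring.
    by rewrite /y; ring.
  apply: (cvg0_of_bound ltr01 (cvg0_linear 1)) => x /andP[x0 _].
  by rewrite mulr_ge0 ?powR_ge0 ?(ltW x0)//= mul1r ler_piMr ?(ltW x0)// y_le1// ltW.
have wdE (x : R) : 0 < x -> weighted_density k l G g x = l * x `^ r * y x `^ (- (l / r + 1)).
  move=> x0; rewrite /weighted_density /power_density /G /g powRM ?powR_ge0 ?(ltW x0)//.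
  rewrite -powRrM.
  have -> : x `^ r = x `^ (- ((k - 1) * l / k)) * x `^ (l - 1).
    rewrite -(powRDp _ _ x0).
    by congr (_ `^ _); rewrite /r; field; rewrite gt_eqF.
  have -> : y x `^ (- (l / r + 1)) = y x `^ (- r^-1 * (l - 1)) * y x `^ (- (1 + r^-1)).
    rewrite -(powRDp _ _ (y0 x)).
    by congr (_ `^ _); field; rewrite gt_eqF.
  by ring.
have dW (x : R) : 0 < x -> is_derive x (1 : R) W (l * x `^ r * y x `^ (- (l / r + 1))).
  move=> x0; have xr0 : 0 < x `^ r by exact: powR_gt0.
  apply: (is_derive_ext (deriveZ_fun (l / (k * r)) (@derive_comp_fun R kap (fun x => x `^ r) x _ _ (dkap _ xr0)
    (derive_powR_fun r x0 (derive_id_fun x))))).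
  rewrite -powRrM mulfV ?gt_eqF// powRr1 ?(ltW x0)// -/(y x) -(xr _ x0).
  by field; rewrite !gt_eqF.
have W_ge0 (x : R) : 0 < x -> 0 <= W x.
  move=> x0; rewrite mulr_ge0 ?divr_ge0 ?mulr_ge0 ?(ltW l0) ?(ltW k0) ?(ltW r0)//.
  by have /andP[] := kapb _ (powR_gt0 r x0).
have pW : prim (weighted_density k l G g) W.
  split; first by move=> x x0; rewrite wdE//; exact: dW.
  have h0 : (fun x => l / r * x `^ r) x @[x --> 0^'+] --> (0 : R).
    rewrite -[X in _ --> X](mulr0 (l / r)); apply: cvgM; first exact: cvg_cst.
    exact: powR_cvg0.
  apply: (cvg0_of_bound ltr01 h0) => x /andP[x0 _]; rewrite W_ge0//=.
  have /andP[_ hk] := kapb _ (powR_gt0 r x0).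
  apply: (@le_trans _ _ (l / (k * r) * (k * x `^ r))).
    by rewrite ler_pM2l// divr_gt0// mulr_gt0.
  by apply: eq_lerW; field; rewrite !gt_eqF.
have gkE (x : R) : g x `^ k = y x `^ (- (l / r)).
  have lE : l = (r + 1) * k by rewrite /r subrK divfK// gt_eqF.
  by rewrite -powRrM; congr (_ `^ _); rewrite [in RHS]lE; field; rewrite gt_eqF.
have pU : prim (fun x => g x `^ k) U.
  split.
    move=> x x0; rewrite gkE.
    apply: (is_derive_ext (deriveD_fun (dW _ x0) (deriveM_fun (derive_id_fun x) (dyp (- (l / r)) _ x0)))).
    rewrite (_ : x * _ = - l * x `^ r * y x `^ (- (l / r) - 1)); last by rewrite -(xr _ x0); field; rewrite gt_eqF.
    rewrite opprD; ring.
  rewrite -[X in _ --> X](addr0 0); apply: cvgD; first exact: pW.2.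
  apply: (cvg0_of_bound ltr01 (cvg0_linear 1)) => x /andP[x0 _].
  by rewrite mulr_ge0 ?powR_ge0 ?(ltW x0)//= mul1r ler_piMr ?(ltW x0)// y_le1// divr_ge0// ltW.
have pr : profile k l g G U W by split => // x x0; rewrite mulr_gt0// powR_gt0.
have DE : D = l / (k * r) * (k * B) by rewrite /D; field; rewrite !gt_eqF.
have c0 : 0 < l / (k * r) by rewrite divr_gt0// mulr_gt0.
have W_le (x : R) : 0 < x -> W x <= D.
  by move=> x0; rewrite DE ler_pM2l// kap_le// powR_gt0.
have W_cvg : W x @[x --> +oo] --> D.
  apply/cvgrPdist_le => e e0.
  have [v v0 hv] := kap_ge (e / (l / (k * r))) (divr_gt0 e0 c0).
  near=> x; have x0 : 0 < x by near: x; exact: nbhs_pinfty_gt.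
  rewrite ger0_norm ?subr_ge0 ?W_le// lerBlDr -lerBlDl DE.
  have vx : v `^ r^-1 <= x by near: x; exact: nbhs_pinfty_ge.
  have Wv : W (v `^ r^-1) <= W x.
    apply: (prim_mono pW) => //; last exact: powR_gt0.
    by move=> z; exact: (weighted_density_ge0 k1 kl G tg).
  apply: le_trans Wv; rewrite /W -powRrM mulVf ?gt_eqF// powRr1 ?(ltW v0)//.
  rewrite -(ler_pM2l c0) in hv; apply: le_trans hv.
  by apply: eq_lerW; field; rewrite !gt_eqF.
have U_cvg : U x @[x --> +oo] --> D.
  rewrite -[X in _ --> X](addr0 D); apply: cvgD => //.
  apply/cvgrPdist_le => e e0.
  have lB : 0 < l - 1 by rewrite subr_gt0.
  have [X X0 hX] : exists2 X : R, 0 < X & forall x : R, X <= x -> x `^ (- (l - 1)) <= e.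
    exact: powR_decay lB e0.
  near=> x; have x0 : 0 < x by near: x; exact: nbhs_pinfty_gt.
  rewrite sub0r normrN ger0_norm ?mulr_ge0 ?powR_ge0 ?(ltW x0)//.
  have Xx : X <= x by near: x; apply: nbhs_pinfty_ge; exact: num_real.
  apply: le_trans (hX _ Xx).
  have -> : x `^ (- (l - 1)) = x * (x `^ r) `^ (- (l / r)).
    rewrite -powRrM -[X in X * _]powRr1 ?(ltW x0)// -(powRDp _ _ x0).
    by congr (_ `^ _); field; rewrite gt_eqF.
  rewrite ler_pM2l//; apply: powRN_nincr; [by rewrite divr_ge0// ltW|exact: powR_gt0|].
  by rewrite lerDr.
have : (fun x => W x - kappa * U x `^ (l / k)) x @[x --> +oo] --> D - kappa * D `^ (l / k).
  apply: cvgB => //; apply: cvgM; first exact: cvg_cst.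
  have cD : {for D, continuous (fun z : R => z `^ (l / k))}.
    exact: continuous_powR_at.
  exact: (cvg_comp U (fun z : R => z `^ (l / k)) U_cvg cD).
have Dpos : 0 < D - kappa * D `^ (l / k).
  rewrite KE -/D in kpK.
  have {1}-> : D = D `^ (- r) * D `^ (l / k).
    rewrite -(powRDp _ _ D0).
    by rewrite (_ : - r + l / k = 1) ?powRr1 ?(ltW D0)// /r; ring.
  by rewrite subr_gt0 ltr_pM2r// powR_gt0.
move=> /(cvgr_gt _) /(_ _ Dpos) hT.
have [T [T0 hT']] : exists T : R, 0 < T /\ 0 < W T - kappa * U T `^ (l / k).
  apply: (@filter_ex _ (+oo%R : set_system R)); near=> T; split; first by near: T; exact: nbhs_pinfty_gt.
  by near: T.
have [al [al0 alT hal]] : exists al : R, [/\ 0 < al, al < T & W al <= W T - kappa * U T `^ (l / k)].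
  have := pW.2; move=> /(cvgr_le _) => /(_ _ hT') h.
  apply: (@filter_ex _ (0^'+ : set_system R)); near=> z; split.
  - by near: z; exact: nbhs_right_gt.
  - by near: z; exact: nbhs_right_lt.
  - by near: z.
exists g, G, U, W, al, T; split => //; first by rewrite al0.
  apply: (@lt_le_trans _ _ (T * y T `^ (- (l / r)))); last by rewrite lerDr W_ge0.
  by rewrite mulr_gt0// powR_gt0.
by move: hal; lra.
Unshelve. all: by end_near. Qed.

(* [U] grows like a logarithm while the two densities become proportional, with
   ratio [K `^ l], at infinity. *)
Lemma nearly_extremal_eq (kappa : R) : p = q -> 0 < kappa -> kappa < K_const p q `^ l ->
  exists (g G U W : R -> R) (al om : R), [/\ test_fun g, profile k l g G U W, 0 < al < om,
    0 < U om & kappa * U om `^ (l / k) <= W om - W al].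
Proof.
move=> pq' kp0 kpK; have lk : l = k by rewrite /l /k pq'.
set K0 := K_const p q `^ l in kpK; have K00 : 0 < K0 by exact: lt_trans kpK.
have K0E : K0 = k * p `^ (k - 1) by rewrite /K0 /l (K_const_eq p1 pq') -/l lk.
pose a := p^-1; have a0 : 0 < a by rewrite invr_gt0.
have aE : a = 1 - k^-1 by rewrite /a pq'.
have kB : 0 < k - 1 by rewrite subr_gt0.
pose kap' := (kappa + K0) / 2.
have kk' : kappa < kap' by rewrite /kap' midf_lt.
have kK' : kap' < K0 by rewrite /kap' midf_lt.
have kap'0 : 0 < kap' by exact: lt_trans kk'.
(* [th] is the fraction of p x (1 + x)^(-1/k) that [G] exceeds for large x; K0 th^(k-1) = kap' turns
   this into a ratio kap' of the two densities. *)
pose th := (kap' / K0) `^ (k - 1)^-1.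
have q01 : 0 <= kap' / K0 by rewrite divr_ge0 ?(ltW kap'0) ?(ltW K00).
have th1 : 0 < 1 - th.
  have {1}-> : 1 = 1 `^ (k - 1)^-1 :> R by rewrite powR1.
  rewrite subr_gt0 /th; apply: gt0_ltr_powR.
  - by rewrite invr_gt0.
  - by rewrite nnegrE.
  - by rewrite nnegrE ler01.
  - by rewrite ltr_pdivrMr// mul1r.
have thE : K0 * th `^ (k - 1) = kap'.
  rewrite /th -powRrM mulVf ?gt_eqF// powRr1 ?q01//.
  by field; rewrite gt_eqF.
have th0 : 0 <= th by exact: powR_ge0.
have y0 (x : R) : 0 < x -> 0 < 1 + x by move=> x0; rewrite addr_gt0.
have dy (x : R) : is_derive x (1 : R) (fun x => 1 + x) 1.
  by apply: (is_derive_ext (deriveD_fun (derive_cst_fun 1 x) (derive_id_fun x))); ring.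
have dyp (c x : R) : 0 < x -> is_derive x (1 : R) (fun x => (1 + x) `^ c) (c * (1 + x) `^ (c - 1) * 1).
  by move=> x0; exact: derive_powR_fun (y0 _ x0) (dy x).
(* The formal extremal x^(-1/k) has an infinite norm and is unbounded at 0; the shift by 1 removes
   the singularity. *)
pose g (x : R) := (1 + x) `^ (- k^-1).
have ki : 0 <= k^-1 by rewrite invr_ge0 ltW.
have tg : test_fun g.
  split.
  - by move=> x x0; exact: is_derive_cont (dyp _ _ x0).
  - by move=> x _; exact: powR_ge0.
  - by move=> x z x0 xz; apply: powRN_nincr; rewrite ?y0 ?lerD2l.
  - exists 1 => x x0; have := powRN_nincr ki (ltr01 : 0 < (1 : R)) (_ : 1 <= 1 + x).
    by rewrite powR1; apply; rewrite lerDl ltW.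
  - by exists 1 => //; rewrite powR_gt0.
pose G (x : R) := p * ((1 + x) `^ a - 1).
have pG : prim g G.
  split.
    move=> x x0; apply: (is_derive_ext (deriveZ_fun p (deriveB_fun (dyp a _ x0) (derive_cst_fun 1 x)))).
    rewrite subr0 mulr1 mulrA /a mulfV ?gt_eqF// mul1r -/a /g; congr (_ `^ _).
    by rewrite aE; ring.
  have d0 : 0 < 1 + 0 :> R by rewrite addr0.
  have := is_derive_cont (deriveZ_fun p (deriveB_fun (derive_powR_fun a d0 (dy 0)) (derive_cst_fun 1 0))).
  rewrite /prop_for /continuous_at addr0 powR1 subrr mulr0.
  exact: cvg_at_right_filter.
have [G' [U [W [pG' pU pW' _]]]] := profileP k1 kl tg.
have pW : prim (weighted_density k l G g) W.
  apply: (prim_ext pW') => x x0; rewrite /weighted_density /power_density.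
  by rewrite (prim_unique pG' pG _ x0).
have gk (x : R) : 0 < x -> g x `^ k = (1 + x)^-1.
  move=> x0; rewrite /g -powRrM mulNr mulVf ?gt_eqF// powR_inv1//.
  exact/ltW/y0.
have pln : prim (fun x => g x `^ k) (fun x => ln (1 + x)).
  split.
    move=> x x0; rewrite gk//.
    by apply: (is_derive_ext (derive_comp_fun (is_derive1_ln (y0 _ x0)) (dy x))); rewrite mulr1.
  apply: (cvg0_of_bound ltr01 (cvg0_linear 1)) => x /andP[x0 _].
  by rewrite ln_ge0 ?lerDl ?(ltW x0)//= mul1r le_ln1Dx// (lt_trans _ x0)// ltrN10.
have UE (x : R) : 0 < x -> U x = ln (1 + x) by move=> x0; exact: (prim_unique pU pln).
have [X0 X00 hX0] := powR_decay a0 th1.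
have dens (x : R) : X0 <= x -> kap' * g x `^ k <= weighted_density k l G g x.
  move=> Xx; have x0 : 0 < x by exact: lt_le_trans Xx.
  have yx : 0 < 1 + x by exact: y0.
  have hy : (1 + x) `^ (- a) <= 1 - th by apply: hX0; rewrite (le_trans Xx)// lerDr.
  have oneE : 1 = (1 + x) * (1 + x) `^ (- a) * (1 + x) `^ (- k^-1) :> R.
    rewrite -[X in X * _ * _]powRr1 ?(ltW yx)// -!(powRDp _ _ yx).
    by rewrite (_ : 1 - a - k^-1 = 0) ?powRr0// aE; ring.
  have slope : p * th * (1 + x) `^ (- k^-1) * x <= G x.
    rewrite /G -!mulrA ler_pM2l//.
    have -> : (1 + x) `^ a = (1 + x) * (1 + x) `^ (- k^-1).
      rewrite -[X in X * _]powRr1 ?(ltW yx)// -(powRDp _ _ yx).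
      by rewrite aE.
    rewrite [X in _ - X]oneE -subr_ge0 [leRHS](_ : _ = (1 + x) `^ (- k^-1) *
      ((1 + x) - (1 + x) * (1 + x) `^ (- a) - th * x)); last by ring.
    rewrite mulr_ge0 ?powR_ge0//.
    have hyp : (1 + x) * (1 + x) `^ (- a) <= (1 + x) * (1 - th) by rewrite ler_pM2l.
    by move: hyp th0; move: ((1 + x) * _) => z; nra.
  rewrite /weighted_density /power_density lk gk//.
  have Gp : 0 < G x by exact: (test_prim_gt0 tg pG).
  have e1 : (p * th * (1 + x) `^ (- k^-1) * x) `^ (k - 1) <= G x `^ (k - 1).
    apply: le_powR_nneg; [exact: ltW| |exact: slope].
    by rewrite !mulr_ge0 ?powR_ge0 ?(ltW p0) ?(ltW x0).
  apply: (@le_trans _ _ (x `^ (- ((k - 1) * k / k)) *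
      (k * (p * th * (1 + x) `^ (- k^-1) * x) `^ (k - 1) * g x))); last first.
    by rewrite ler_wpM2l ?powR_ge0// ler_wpM2r ?powR_ge0// ler_pM2l.
  rewrite mulfK ?gt_eqF//.
  rewrite !powRM ?mulr_ge0 ?powR_ge0 ?(ltW p0) ?(ltW x0)// -thE K0E.
  rewrite powRN -[(_ `^ (- k^-1)) `^ _]powRrM.
  have -> : (1 + x)^-1 = (1 + x) `^ (- k^-1 * (k - 1)) * g x.
    rewrite /g -(powRDp _ _ yx).
    rewrite -powR_inv1 ?(ltW yx)//; congr (_ `^ _); field; by rewrite gt_eqF.
  apply: eq_lerW; field.
  by rewrite gt_eqF// powR_gt0.
(* Once U reaches the first summand, the surplus (kap' - kappa) U outweighs what is lost below X0.
   The second summand makes M positive and T = exp M larger than X0. *)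
pose M := kap' * U X0 / (kap' - kappa) + X0.
have dk : 0 < kap' - kappa by rewrite subr_gt0.
have U0 : 0 <= U X0 by rewrite UE// ln_ge0// lerDl ltW.
pose T := expR M.
have A0 : 0 <= kap' * U X0 / (kap' - kappa) := divr_ge0 (mulr_ge0 (ltW kap'0) U0) (ltW dk).
have M0 : 0 < M by rewrite /M ltr_wpDl.
have XT : X0 < T.
  apply: (@lt_le_trans _ _ (1 + M)); last exact: expR_ge1Dx.
  by rewrite /M addrA ltrDr ltr_pwDl.
have T0 : 0 < T by exact: lt_trans XT.
have UT : M <= U T.
  rewrite UE// -[leLHS]expRK ler_ln ?posrE ?expR_gt0 ?y0// -/T lerDr; exact: ler01.
exists g, G, U, W, X0, T; split => //.
- by split => // x x0; exact: (test_prim_gt0 tg pG).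
- by rewrite X00.
- exact: lt_le_trans UT.
rewrite lk mulfV ?gt_eqF// powRr1; last by rewrite (le_trans _ UT)// ltW.
have inc : W X0 - kap' * U X0 <= W T - kap' * U T.
  apply: (derive_ge0_le (f := fun x => W x - kap' * U x)) => [|x /andP[Xx _]]; first exact: ltW.
  have x0 : 0 < x by exact: lt_le_trans Xx.
  eexists; last exact: (deriveB_fun (pW.1 _ x0) (deriveZ_fun kap' (pU.1 _ x0))).
  by rewrite subr_ge0 dens.
have : kap' * U X0 <= (kap' - kappa) * U T.
  apply: (@le_trans _ _ ((kap' - kappa) * M)); last by rewrite ler_pM2l.
  rewrite /M mulrDr (mulrC _ (_ / _)) divfK ?gt_eqF// lerDl.
  by apply: mulr_ge0; exact: ltW.
move: inc; move: (W X0) (W T) (U X0) (U T) => w1 w2 u1 u2; lra.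
Qed.

Lemma nearly_extremal (kappa : R) : 0 < kappa -> kappa < K_const p q `^ l ->
  exists (g G U W : R -> R) (al om : R), [/\ test_fun g, profile k l g G U W, 0 < al < om,
    0 < U om & kappa * U om `^ (l / k) <= W om - W al].
Proof.
move=> h0 hK; have [pq'|pq'] := eqVneq p q; first exact: nearly_extremal_eq.
by apply: nearly_extremal_lt => //; rewrite lt_neqAle pq' pq.
Qed.

End extremals.

(** A near-extremal for [kappa] determines a window [al, om]; its dilate by [e] sits where c2 >= c,
    and dilation leaves the ratio unchanged, so c^l kappa <= C^l. As kappa is arbitrary below K^l, a
    value between C^l / c^l and K^l would be contradictory. *)
Lemma windows_K_bound (R : realType) (p q : R) (b : R -> \bar R) (C : \bar R) (c : R) :
  (1 < p)%R -> (p <= q)%R -> normal_form_parameter b -> 0 <= C ->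
  (forall f : LT R -> \bar R, Lplus f -> normp p f < +oo ->
    normp q (H_op b f) <= C * normp p f) -> (0 <= c)%R ->
  (forall al om : R, (0 < al)%R -> (al < om)%R -> exists2 e, (0 < e)%R &
    forall t : R, (e * al <= t <= e * om)%R -> c%:E <= c2 p q b t) ->
  (K_const p q * c)%:E <= C.
Proof.
move=> p1 pq hb C0 hC c0 hw; have K0 := K_const_gt0 p1 pq.
set k := conj_exp q; set l := conj_exp p.
have q1 : (1 < q)%R by exact: lt_le_trans pq.
have k1 : (1 < k)%R by exact: conj_exp_gt1.
have l1 : (1 < l)%R by exact: conj_exp_gt1.
have k0 : (0 < k)%R by exact: lt_trans k1.
have l0 : (0 < l)%R by exact: lt_trans l1.
have key (kappa : R) : (0 < kappa)%R -> (kappa < K_const p q `^ l)%R -> (c `^ l * kappa)%:E <= C `^ l.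
  move=> kp0 kpK.
  have [g [G [U [W [al [om [tg [pG pU pW G0] /andP[al0 alom] Uom ext]]]]]]] := nearly_extremal p1 pq kp0 kpK.
  have [e e0 he] := hw _ _ al0 alom.
  have om0 := lt_trans al0 alom.
  have ee : (e^-1 * (e * om) = om)%R by rewrite mulKf// gt_eqF.
  have ea : (e^-1 * (e * al) = al)%R by rewrite mulKf// gt_eqF.
  have pWe : prim (weighted_density k l (fun x => e * G (e^-1 * x))%R (fun x => g (e^-1 * x))%R)
      (fun x => e `^ (l / k - 1) * (e * W (e^-1 * x)))%R.
    apply: (prim_ext (prim_mulrl (e `^ (l / k - 1))%R (prim_scale e0 pW))) => x x0.
    by rewrite weighted_density_scale// ltW// G0// mulr_gt0// invr_gt0.
  have := window_lower_bound p1 pq hb C0 hC (test_fun_scale e0 tg) (prim_scale e0 pG)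
    (prim_scale e0 pU) pWe c0 (mulr_gt0 e0 al0) _ he.
  rewrite ltr_pM2l// ee ea => /(_ alom) B.
  have el : (e `^ (l / k) = e `^ (l / k - 1) * e)%R.
    by rewrite -[X in _ = (_ * X)%R]powRr1 ?(ltW e0)// -powRD ?subrK// (gt_eqF e0) implybT.
  have elp : (0 < e `^ (l / k))%R by rewrite powR_gt0.
  have Ulp : (0 < U om `^ (l / k))%R by rewrite powR_gt0.
  rewrite -(@lee_pmul2r _ (e `^ (l / k) * U om `^ (l / k))%:E) ?lte_fin ?mulr_gt0//.
  rewrite -EFinM -powRM ?(ltW e0) ?(ltW Uom)//.
  apply: le_trans B; rewrite lee_fin powRM ?(ltW e0) ?(ltW Uom)// -mulrA; apply: ler_wpM2l; first exact: powR_ge0.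
  rewrite mulrCA -mulrBr mulrA -mulrBr el -!mulrA.
  by rewrite ler_wpM2l ?powR_ge0// ler_wpM2l// ltW.
case: C C0 hC key => [C| |]//; rewrite ?leey// lee_fin => C0 _ key.
rewrite lee_fin leNgt; apply/negP => CK.
have c_gt0 : (0 < c)%R.
  rewrite lt0r c0 andbT; apply/negP => /eqP c00; move: CK; rewrite c00 mulr0 ltNge C0//.
have clp : (0 < c `^ l)%R by rewrite powR_gt0.
have lt1 : (C `^ l / c `^ l < K_const p q `^ l)%R.
  rewrite ltr_pdivrMr// -powRM ?(ltW K0)//.
  by rewrite gt0_ltr_powR// nnegrE ?mulr_ge0 ?(ltW K0).
pose kappa := ((C `^ l / c `^ l + K_const p q `^ l) / 2)%R.
have h1 : (C `^ l / c `^ l < kappa)%R by rewrite midf_lt.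
have h2 : (kappa < K_const p q `^ l)%R by rewrite midf_lt.
have kp0 : (0 < kappa)%R by apply: le_lt_trans h1; rewrite divr_ge0 ?powR_ge0.
have := key _ kp0 h2; rewrite poweR_EFin lee_fin leNgt; apply/negP; rewrite negbK.
by rewrite mulrC -ltr_pdivrMr.
Qed.

(** Reduces statements on lower limits, which may be infinite, to real numbers strictly below
    them. *)
Lemma lee_of_real_lt (R : realType) (x y : \bar R) :
  (forall r : R, r%:E < x -> r%:E <= y) -> x <= y.
Proof.
move=> H; rewrite leNgt; apply/negP; case: x y H => [x| |] [y| |]// H; rewrite ?ltNyr ?ltry ?ltNyy// => yx.
- rewrite lte_fin in yx; have := H ((x + y) / 2)%R; rewrite lte_fin lee_fin.
  by have [h1 h2] := midf_lt yx; rewrite addrC => /(_ h2); rewrite leNgt h1.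
- by have := H (x - 1)%R; rewrite lte_fin gtrBl ltr01 => /(_ isT).
- by have := H (y + 1)%R; rewrite ltry => /(_ isT); rewrite lee_fin leNgt ltrDl ltr01.
- by have := H 0%R; rewrite ltry => /(_ isT).
Qed.

(** * Lower limits at 0 and at infinity *)

Section liminf.
Variable R : realType.
Implicit Types c d : R -> \bar R.

Lemma lt_liminf_0 c (y : \bar R) : y < liminf_0 c ->
  exists2 e : R, (0 < e)%R & forall t : R, (0 < t < e)%R -> y <= c t.
Proof.
rewrite /liminf_0 limf_einfE => /ereal_sup_gt[_ [P [e /= e0 hP] <-]] yP.
exists e => // t /andP[t0 te]; apply: (le_trans (ltW yP)); apply: ereal_inf_lbound; exists t => //.
by apply: hP => //=; rewrite sub0r normrN gtr0_norm.
Qed.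

Lemma ge_liminf_0 c (y : \bar R) (e : R) : (0 < e)%R ->
  (forall t : R, (0 < t < e)%R -> y <= c t) -> y <= liminf_0 c.
Proof.
move=> e0 H; rewrite /liminf_0 limf_einfE.
apply: (@le_trans _ _ (ereal_inf [set c x | x in [set t : R | (0 < t < e)%R]])).
  by apply/ereal_infP => _ [t te <-]; exact: H.
apply: ereal_sup_ubound; exists [set t : R | (0 < t < e)%R] => //.
exists e => // t /= te t0; rewrite t0/=; move: te.
by rewrite sub0r normrN gtr0_norm.
Qed.

Lemma lt_liminf_oo c (y : \bar R) : y < liminf_oo c ->
  exists M : R, forall t : R, (M < t)%R -> y <= c t.
Proof.
rewrite /liminf_oo limf_einfE => /ereal_sup_gt[_ [P [M [_ hP]] <-]] yP.
exists M => t Mt; apply: (le_trans (ltW yP)); apply: ereal_inf_lbound; exists t => //.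
exact: hP.
Qed.

Lemma ge_liminf_oo c (y : \bar R) (M : R) :
  (forall t : R, (M < t)%R -> y <= c t) -> y <= liminf_oo c.
Proof.
move=> H; rewrite /liminf_oo limf_einfE.
apply: (@le_trans _ _ (ereal_inf [set c x | x in [set t : R | (M < t)%R]])).
  by apply/ereal_infP => _ [t te <-]; exact: H.
apply: ereal_sup_ubound; exists [set t : R | (M < t)%R] => //.
by exists M; split => //; exact: num_real.
Qed.

End liminf.

(** * The two conditions on the parameter *)

Section conditions.
Variable R : realType.
Variables p q : R.
Hypothesis p1 : (1 < p)%R.
Hypothesis pq : (p <= q)%R.
Variable b : R -> \bar R.
Hypothesis hb : normal_form_parameter b.
Let k := conj_exp q.
Let l := conj_exp p.
Let q1 : (1 < q)%R. Proof. exact: lt_le_trans pq. Qed.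
Let k1 : (1 < k)%R. Proof. exact: conj_exp_gt1. Qed.
Let l1 : (1 < l)%R. Proof. exact: conj_exp_gt1. Qed.
Let kl : (k <= l)%R. Proof. exact: conj_exp_le. Qed.
Let k0 : (0 < k)%R. Proof. exact: lt_trans k1. Qed.
Let l0 : (0 < l)%R. Proof. exact: lt_trans l1. Qed.
Let qinv : (q^-1 = 1 - k^-1)%R.
Proof. by rewrite conj_exp_inv opprB addrC subrK. Qed.
Let b0 x : (0 < x)%R -> 0 <= b x. Proof. exact: hb.1. Qed.
Let w0 x : (0 < x)%R -> 0 <= weight p b x. Proof. exact: weight_ge0. Qed.
Let mw := measurable_weight p hb.
Let lk0 : (0 < l / k)%R. Proof. exact: divr_gt0. Qed.
Let sub (t : R) : `]0%R, t[%classic `<=` (`]0%R, +oo[%classic : set R).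
Proof. by move=> x; rewrite /= !in_itv/= => /andP[->]. Qed.

Let beta (c x : R) : \bar R := (c `^ l)%:E * (x `^ (l / k - 1))%:E.

Let beta_ge0 c x : 0 <= beta c x.
Proof. by rewrite mule_ge0// lee_fin powR_ge0. Qed.

Let mbeta c : measurable_fun (pos R) (beta c).
Proof. exact: measurable_powR_itv. Qed.

Let integral_beta c t : (0 <= t)%R ->
  \int[mu]_(x in `]0%R, t[) beta c x = (c `^ l * (k / l * t `^ (l / k)))%:E.
Proof. by move=> t0; exact: (integral_cpowR p1 pq (powR_ge0 _ _) t0). Qed.

Lemma c0_ge0 x : (0 < x)%R -> 0 <= c0 p q b x.
Proof. by move=> x0; rewrite /c0 mule_ge0 ?poweR_ge0// lee_fin powR_ge0. Qed.

Let c0_powR x : (0 < x)%R -> (x `^ (l / k))%:E * c0 p q b x `^ l = (x `^ l)%:E * b x.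
Proof.
move=> x0; rewrite /c0 poweRM ?poweR_ge0 ?lee_fin ?powR_ge0//.
rewrite -poweRrM mulVf ?gt_eqF// poweRe1 ?b0// poweR_EFin (muleC (b x)) muleA -EFinM.
rewrite -powRrM -(powRDp _ _ x0).
by rewrite qinv (_ : l / k + _ = l)%R//; field; rewrite gt_eqF.
Qed.

(** Hence c2^l at t is the mean of c0^l over (0, t) with respect to x^(l/k-1) dx, which is why
    bounds for [c0] pass to [c2]. *)
Let c0_weight x : (0 < x)%R -> weight p b x = (x `^ (l / k - 1))%:E * c0 p q b x `^ l.
Proof.
move=> x0; have xx : (0 < x)%R := x0.
have E : (x `^ (- 1))%:E * ((x `^ (l / k))%:E * c0 p q b x `^ l) = (x `^ (- 1))%:E * ((x `^ l)%:E * b x).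
  by rewrite c0_powR.
move: E; rewrite !muleA -!EFinM -!(powRDp _ _ x0).
by rewrite /weight -/l !(addrC (-1)%R) => <-.
Qed.

Lemma c2_le_of_c0_le (A t : R) : (0 <= A)%R -> (0 < t)%R ->
  (forall x, (0 < x < t)%R -> c0 p q b x <= A%:E) -> c2 p q b t <= A%:E.
Proof.
move=> A0 t0 hA; have c2p := c2_ge0 p q b t.
have : (k / l * t `^ (l / k))%:E * c2 p q b t `^ l <= (k / l * t `^ (l / k))%:E * (A `^ l)%:E.
  rewrite -(c2_powR p1 pq hb t0) -EFinM (mulrC _ (A `^ l)%R) -integral_beta ?(ltW t0)//.
  apply: ge0_le_integral => //.
  - by move=> x; rewrite /= in_itv/= => /andP[x0 _]; exact: w0.
  - exact: measurable_fun_segment.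
  - exact: measurable_fun_segment.
  - move=> x; rewrite /= in_itv/= => /andP[x0 xt]; rewrite (c0_weight x0) /beta muleC.
    apply: lee_wpmul2r; first by rewrite lee_fin powR_ge0.
    rewrite -poweR_EFin; apply: le_poweR; [exact: ltW|exact: c0_ge0|].
    by apply: hA; rewrite x0.
have kt : (0 < k / l * t `^ (l / k))%R by rewrite mulr_gt0 ?powR_gt0// divr_gt0.
rewrite lee_pmul2l// => H.
have li0 : (0 <= l^-1)%R by rewrite invr_ge0 ltW.
have := le_poweR li0 (poweR_ge0 _ _) H.
by rewrite poweR_EFin -poweRrM -powRrM mulfV ?gt_eqF// powRr1// poweRe1.
Qed.

(** Only the part [M, t) of the mean is retained. The loss M^(l/k) is negligible for large t, and M
    = 0 serves the lower limit at 0. *)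
Lemma c2_ge_of_c0_ge (c M t : R) : (0 <= c)%R -> (0 <= M)%R -> (M <= t)%R -> (0 < t)%R ->
  (forall x, (0 < x)%R -> (M <= x < t)%R -> c%:E <= c0 p q b x) ->
  (c `^ l * (t `^ (l / k) - M `^ (l / k)))%:E <= (t `^ (l / k))%:E * c2 p q b t `^ l.
Proof.
move=> c_ge0 M0 Mt t0 hc.
have kl0 : (0 < k / l)%R by exact: divr_gt0.
rewrite -(@lee_pmul2l _ (k / l)%:E) ?lte_fin// muleA -EFinM -(c2_powR p1 pq hb t0).
rewrite mulrCA mulrBr mulrBr EFinB leeBlDr//.
rewrite -integral_beta ?(ltW t0)// -integral_beta//.
have -> : \int[mu]_(x in `]0%R, M[) beta c x =
    \int[mu]_(x in `]0%R, t[) (if (x < M)%R then beta c x else 0).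
  by rewrite integral_cutoff min_r.
have mS (F : R -> \bar R) : measurable_fun (pos R) F -> measurable_fun (`]0%R, t[ : set R) F.
  exact: measurable_fun_segment.
have mc : measurable_fun (`]0%R, t[ : set R) (fun x => if (x < M)%R then beta c x else 0).
  by apply: mS; exact: measurable_cutoff.
rewrite -ge0_integralD//; last 3 first.
- by move=> x; rewrite /= in_itv/= => /andP[x0 _]; exact: w0.
- exact: mS.
- by move=> x _; case: ifP.
apply: ge0_le_integral => //.
- exact: mS.
- by apply: emeasurable_funD => //; exact: mS.
- move=> x; rewrite /= in_itv/= => /andP[x0 xt]; case: (ltP (x : R) M) => xM.
    by rewrite leeDr// w0.
  rewrite adde0 (c0_weight x0) /beta muleC; apply: lee_wpmul2l; first by rewrite lee_fin powR_ge0.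
  rewrite -poweR_EFin; apply: le_poweR; [exact: ltW|by rewrite lee_fin|].
  by apply: hc => //; rewrite xM.
Qed.

(** Monotonicity of b bounds the integral of x^(l-1) b over (0, t) from below by t^l b(t) / l.
    Together with the factor k / l in [c2_powR] this leaves k^(1/l) = (q')^(1/p'). *)
Lemma c0_le_c2 t : (0 < t)%R -> c0 p q b t <= (k `^ l^-1)%:E * c2 p q b t.
Proof.
move=> t0; have c2p := c2_ge0 p q b t.
have : (t `^ (l / k))%:E * c0 p q b t `^ l <= (t `^ (l / k))%:E * (k%:E * c2 p q b t `^ l).
  rewrite c0_powR// muleA -EFinM (_ : t `^ (l / k) * k = l * (k / l * t `^ (l / k)))%R; last by field; rewrite gt_eqF.
  rewrite (EFinM l) -muleA -(c2_powR p1 pq hb t0).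
  have bt := b0 t0.
  have -> : (t `^ l)%:E * b t = l%:E * \int[mu]_(x in `]0%R, t[) ((x `^ (l - 1))%:E * b t).
    rewrite ge0_integralZr//; last 2 first.
    - exact: measurable_fun_segment (measurable_EFin_powR _).
    - by move=> x _; rewrite lee_fin powR_ge0.
    rewrite integral_powRB1 ?(ltW l1)// muleA -EFinM mulrA mulfV ?gt_eqF// mul1r//.
  apply: lee_wpmul2l; first by rewrite lee_fin ltW.
  apply: ge0_le_integral => //.
  - by move=> x _; rewrite mule_ge0// lee_fin powR_ge0.
  - apply: emeasurable_funM; last exact: measurable_cst.
    exact: measurable_fun_segment (measurable_EFin_powR _).
  - exact: measurable_fun_segment.
  - move=> x; rewrite /= in_itv/= => /andP[x0 xt]; apply: lee_wpmul2l; first by rewrite lee_fin powR_ge0.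
    by apply: hb.2 => //; exact: ltW.
rewrite lee_pmul2l ?lte_fin ?powR_gt0// => H.
have li0 : (0 <= l^-1)%R by rewrite invr_ge0 ltW.
have := le_poweR li0 (poweR_ge0 _ _) H.
rewrite poweRM ?poweR_ge0 ?lee_fin ?(ltW k0)// -!poweRrM mulfV ?gt_eqF// !poweRe1 ?c0_ge0//.
Qed.

Lemma sup_c2_le_sup_c0 : sup_pos (c2 p q b) <= sup_pos (c0 p q b).
Proof.
apply/ereal_supP => _ [t /= + <-]; rewrite in_itv/= andbT => t0.
have S0 : 0 <= sup_pos (c0 p q b) by apply: le_trans (sup_pos_ge _ t0); exact: c0_ge0.
case E : (sup_pos (c0 p q b)) S0 => [A| |]// A0; last by rewrite leey.
by apply: c2_le_of_c0_le => // x /andP[x0 _]; rewrite -E; exact: sup_pos_ge.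
Qed.

Lemma sup_c0_le_sup_c2 : sup_pos (c0 p q b) <= (k `^ l^-1)%:E * sup_pos (c2 p q b).
Proof.
apply/ereal_supP => _ [t /= + <-]; rewrite in_itv/= andbT => t0.
apply: (le_trans (c0_le_c2 t0)); apply: lee_wpmul2l; first by rewrite lee_fin powR_ge0.
exact: sup_pos_ge.
Qed.

Let root_le (c : R) (X : \bar R) : (0 <= c)%R -> 0 <= X -> (c `^ l)%:E <= X `^ l -> c%:E <= X.
Proof.
move=> c_ge0 X0 H; have li0 : (0 <= l^-1)%R by rewrite invr_ge0 ltW.
have := le_poweR li0 _ H; rewrite poweR_EFin -poweRrM -powRrM mulfV ?gt_eqF// powRr1// poweRe1//.
by apply; rewrite lee_fin powR_ge0.
Qed.

Lemma liminf_0_c0_le : liminf_0 (c0 p q b) <= liminf_0 (c2 p q b).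
Proof.
apply: lee_of_real_lt => y /lt_liminf_0[e e0 he]; apply: (ge_liminf_0 e0) => t /andP[t0 te].
have [y0|/ltW y0] := leP 0%R y; last by apply: le_trans (c2_ge0 _ _ _ _); rewrite lee_fin.
apply: root_le => //; first exact: c2_ge0.
have tp : (0 < t `^ (l / k))%R by rewrite powR_gt0.
rewrite -(@lee_pmul2l _ (t `^ (l / k))%:E) ?lte_fin// -EFinM.
have := @c2_ge_of_c0_ge y 0 t y0 (lexx _) (ltW t0) t0.
rewrite powR0 ?gt_eqF// subr0 mulrC; apply=> x x0 /andP[_ xt].
by apply: he; rewrite x0 (lt_trans xt).
Qed.

Lemma liminf_oo_c0_le : liminf_oo (c0 p q b) <= liminf_oo (c2 p q b).
Proof.
apply: lee_of_real_lt => y /lt_liminf_oo[M hM]; apply: lee_of_real_lt => z; rewrite lte_fin => zy.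
have [z0|/ltW z0] := leP 0%R z; last first.
  by apply: (@ge_liminf_oo _ _ _ 0%R) => t _; apply: le_trans (c2_ge0 _ _ _ _); rewrite lee_fin.
have y0 : (0 < y)%R by exact: le_lt_trans zy.
pose m := (`|M| + 1)%R; have m0 : (0 < m)%R by rewrite ltr_wpDl.
have Mm : (M < m)%R by rewrite (le_lt_trans (ler_norm _))// ltrDl.
have dl : (0 < y `^ l - z `^ l)%R by rewrite subr_gt0 gt0_ltr_powR// nnegrE// ltW.
(* The inequality z^l T <= y^l (T - m^(l/k)) holds for T >= Q; it is needed at T = t^(l/k). *)
pose Q := (y `^ l * m `^ (l / k) / (y `^ l - z `^ l))%R.
have Q0 : (0 < Q)%R by rewrite divr_gt0// mulr_gt0// powR_gt0.
apply: (@ge_liminf_oo _ _ _ (Num.max m (Q `^ (l / k)^-1))%R) => t; rewrite gt_max => /andP[mt Qt].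
have t0 := lt_trans m0 mt.
have tp : (0 < t `^ (l / k))%R by rewrite powR_gt0.
apply: root_le => //; first exact: c2_ge0.
rewrite -(@lee_pmul2l _ (t `^ (l / k))%:E) ?lte_fin// -EFinM.
apply: le_trans (@c2_ge_of_c0_ge y m t (ltW y0) (ltW m0) (ltW mt) t0 _); last first.
  by move=> x x0 /andP[mx _]; apply: hM; exact: lt_le_trans mx.
have Qts : (Q <= t `^ (l / k))%R.
  have {1}-> : Q = ((Q `^ (l / k)^-1) `^ (l / k))%R.
    by rewrite -powRrM mulVf ?gt_eqF// powRr1// ltW.
  by apply: le_powR_nneg; [exact: ltW|exact: powR_ge0|exact: ltW].
rewrite lee_fin; move: Qts; rewrite /Q ler_pdivrMr//.
move: (t `^ _)%R (y `^ _)%R (z `^ _)%R (m `^ _)%R => T Y Z M'; nra.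
Qed.

Lemma liminf_0_admissible (C : \bar R) : 0 <= C ->
  (forall f : LT R -> \bar R, Lplus f -> normp p f < +oo ->
    normp q (H_op b f) <= C * normp p f) -> (K_const p q)%:E * liminf_0 (c2 p q b) <= C.
Proof.
move=> C0 hC; have K0 := K_const_gt0 p1 pq.
rewrite -lee_pdivlMl//; apply: lee_of_real_lt => y /lt_liminf_0[e e0 he].
rewrite lee_pdivlMl// -EFinM.
have [y0|/ltW y0] := leP 0%R y; last by apply: le_trans C0; rewrite lee_fin mulr_ge0_le0// ltW.
apply: (windows_K_bound p1 pq hb C0 hC y0) => al om al0 alom.
have om0 := lt_trans al0 alom.
have e20 : (0 < e / (2 * om))%R by rewrite divr_gt0// mulr_gt0.
(* This dilation carries the window into (0, e / 2], inside the strict range t < e. *)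
exists (e / (2 * om))%R => // t /andP[t1 t2]; apply: he.
apply/andP; split; first by apply: lt_le_trans t1; rewrite mulr_gt0.
apply: (le_lt_trans t2); rewrite (_ : e / (2 * om) * om = e / 2)%R; last by field; rewrite gt_eqF.
by rewrite ltr_pdivrMr// mulr_natr mulr2n ltrDl.
Qed.

Lemma liminf_oo_admissible (C : \bar R) : 0 <= C ->
  (forall f : LT R -> \bar R, Lplus f -> normp p f < +oo ->
    normp q (H_op b f) <= C * normp p f) -> (K_const p q)%:E * liminf_oo (c2 p q b) <= C.
Proof.
move=> C0 hC; have K0 := K_const_gt0 p1 pq.
rewrite -lee_pdivlMl//; apply: lee_of_real_lt => y /lt_liminf_oo[M hM].
rewrite lee_pdivlMl// -EFinM.
have [y0|/ltW y0] := leP 0%R y; last by apply: le_trans C0; rewrite lee_fin mulr_ge0_le0// ltW.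
apply: (windows_K_bound p1 pq hb C0 hC y0) => al om al0 alom.
have M1 : (0 < `|M| + 1)%R by rewrite ltr_wpDl.
(* This dilation carries the left end of the window to |M| + 1, beyond M. *)
exists ((`|M| + 1) / al)%R; first by rewrite divr_gt0.
move=> t /andP[t1 _]; apply: hM; apply: lt_le_trans t1.
by rewrite divfK ?gt_eqF// (le_lt_trans (ler_norm _))// ltrDl.
Qed.

End conditions.


Theorem lemma3p19 (R : realType) (p q : R) (b : R -> \bar R)
    (hp : (1 < p)%R) (hpq : (p <= q)%R) (hb : normal_form_parameter b) :
  let A0 := sup_pos (c0 p q b) in
  let A2 := sup_pos (c2 p q b) in
  let A0_0 := liminf_0 (c0 p q b) in
  let A2_0 := liminf_0 (c2 p q b) in
  let A0_oo := liminf_oo (c0 p q b) in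
  let A2_oo := liminf_oo (c2 p q b) in
  let K := (K_const p q)%:E in
  let r := (conj_exp q `^ (conj_exp p)^-1)%:E in
  [/\ A2 <= A0, A0 <= r * A2, A0_0 <= A2_0 & A0_oo <= A2_oo] /\
  [/\ maxe (maxe A0 (K * A0_0)) (K * A0_oo) <=
        maxe (maxe (r * A2) (K * A2_0)) (K * A2_oo),
      maxe (maxe (r * A2) (K * A2_0)) (K * A2_oo) <= N_const p q b,
      N_const p q b <= K * A2 &
      K * A2 <= K * A0].
Proof.
move=> A0 A2 A0_0 A2_0 A0_oo A2_oo K r.
have h1 : A2 <= A0 by exact: sup_c2_le_sup_c0.
have h2 : A0 <= r * A2 by exact: sup_c0_le_sup_c2.
have h3 : A0_0 <= A2_0 by exact: liminf_0_c0_le.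
have h4 : A0_oo <= A2_oo by exact: liminf_oo_c0_le.
have K0 : 0 <= K by rewrite lee_fin ltW// K_const_gt0.
split; split => //.
- rewrite !ge_max !le_max h2 /= !(lee_wpmul2l K0 h3) !(lee_wpmul2l K0 h4).
  by rewrite !orbT.
- apply/ereal_infP => C [C0 hC]; rewrite !ge_max; apply/andP; split; last exact: liminf_oo_admissible.
  apply/andP; split; last exact: liminf_0_admissible.
  have r0 : (0 < conj_exp q `^ (conj_exp p)^-1)%R.
    by rewrite powR_gt0// (lt_trans ltr01)// conj_exp_gt1// (lt_le_trans hp).
  rewrite -lee_pdivlMl//; apply/ereal_supP => _ [t /= + <-]; rewrite in_itv/= andbT => t0.
  by rewrite lee_pdivlMl//; exact: (c2_le_admissible hp hpq hb C0 hC t0).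
- exact: N_const_le.
- exact: lee_wpmul2l.
Qed.
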